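(* Let $(\mathcal{X},\mu)$ be a tree equipped with any measure. Let $T$ be an integral operator $$ Tf(x)=\sum_{y\in\mathcal{X}}K(x,y)f(y)\mu(\{y\}) $$ which is bounded on $L^2(\mathcal{X})$ and whose kernel $K:\mathcal{X}\times\mathcal{X}\to\mathbb{C}$ is symmetric, that is, $K(x,y)=K(y,x)$ for all $x,y\in\mathcal{X}$. Assume that $K$ satisfies the integral size condition $$ \sup_{Q\in\mathscr{D}}\ \sup_{x\in Q}\ \sum_{z\in Q^{(1)}\setminus Q}|K(x,z)|\,\mu(\{z\})<\infty $$ and the Hörmander condition $$ \sup_{Q\in\mathscr{D}}\ \sup_{x,y\in Q}\ \sum_{z\in\mathcal{X}\setminus Q}|K(z,x)-K(z,y)|\,\mu(\{z\})<\infty . $$ Then $T$ satisfies the following endpoint bounds: (a) $T$ maps $L^1(\mathcal{X})$ to $L^{1,\infty}(\mathcal{X})$; (b) $T$ maps $\mathrm{H}^1(\mathcal{X})$ to $L^1(\mathcal{X})$; (c) $T$ maps $L^\infty(\mathcal{X})$ to $\mathrm{BMO}(\mathcal{X})$.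
   Context: **Tree.** A tree $\mathcal{X}$ is a connected graph without loops (cycles), here with a distinguished vertex $0$ (the origin); $|x|$ is the graph distance from $x$ to $0$. The tree is not assumed to be radial (i.e. the number of neighbours of a vertex $x$ need not depend only on $|x|$), and no assumption is made on the measure $\mu$. For $x\neq0$, $x^{(1)}$ is the neighbour of $x$ with $|x^{(1)}|=|x|-1$, and $x^{(k)}$ is the $k$-th iterate. $L^p(\mathcal{X})=L^p(\mathcal{X},\mu)$, and $L^{1,\infty}(\mathcal{X})$ is weak $L^1$ with respect to $\mu$. **Dyadic sets.** The sector with vertex $x$ is $S_x=\{x\}\cup\{y: y^{(k)}=x\text{ for some }k\ge1\}$. For $k\ge0$ let $\mathscr{D}_k$ be the partition of $\mathcal{X}$ $$\mathscr{D}_k=\big\{\{x\}:|x|<k\big\}\cup\big\{S_y:|y|=k\big\},$$ so $\mathscr{D}_0=\{\mathcal{X}\}$, and let $\mathscr{D}=\bigcup_{k\ge0}\mathscr{D}_k$. For $Q\in\mathscr{D}$, $Q\ne\mathcal{X}$, the parent $Q^{(1)}$ is the unique element of $\mathscr{D}_{k-1}$ containing $Q$, where $k$ is the smallest index with $Q\in\mathscr{D}_k$. The set $Q=\mathcal{X}$ has no parent and contributes nothing to the size condition. **Function spaces.** Write $\langle f\rangle_Q$ for the average of $f$ over $Q$ with respect to $\mu$, $\mathsf{E}_kf=\sum_{Q\in\mathscr{D}_k}\langle f\rangle_Q1_Q$ for $k\ge0$, and $\mathsf{D}_kf=\mathsf{E}_kf-\mathsf{E}_{k-1}f$ for $k\ge1$.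 The spaces $\mathrm{BMO}(\mathcal{X})$ and $\mathrm{H}^1(\mathcal{X})$ are the martingale spaces of this filtration, given by the norms $$\|f\|_{\mathrm{BMO}}=\|\mathsf{E}_0f\|_\infty+\sup_{k\ge1}\big\|\mathsf{E}_k|f-\mathsf{E}_{k-1}f|\big\|_\infty ,\qquad \|f\|_{\mathrm{H}^1}=\Big\|\Big(\sum_{k\ge1}|\mathsf{D}_kf|^2\Big)^{1/2}\Big\|_{L^1(\mathcal{X})},$$ where the elements of $\mathrm{H}^1(\mathcal{X})$ are understood to have vanishing integral with respect to $\mu$. *)

(* Defs.v *)
From HB Require Import structures.
From mathcomp Require Import all_boot all_order all_algebra.
From mathcomp Require Import complex.
From mathcomp Require Import all_classical all_reals all_analysis.
Set Implicit Arguments.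
Unset Strict Implicit.
Unset Printing Implicit Defensive.
Import Order.TTheory GRing.Theory Num.Theory.
Import numFieldNormedType.Exports.
Local Open Scope classical_set_scope.
Local Open Scope ring_scope.
Local Open Scope complex_scope.

Section Tree.
Context {X : choiceType}.
Implicit Types (e : rel X) (o x y : X) (Q : set X).

Definition is_tree e : Prop :=
  [/\ symmetric e, irreflexive e,
      forall x y, exists p, path e x p /\ last x p = y
    & forall c : seq X, ucycle e c -> (size c <= 2)%N].

Definition walk e x y (n : nat) : Prop :=
  exists p : seq X, [/\ path e x p, last x p = y & size p = n].

Definition dist e x y : nat :=
  xget 0%N [set n | walk e x y n /\ forall m, walk e x y m -> (n <= m)%N].

(* x^{(1)}; the default value at x = o is o, which does not affect the sectors
   below. *)
Definition pred_vertex e o x : X :=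
  xget o [set y | e x y /\ dist e x o = (dist e y o).+1].

Definition sector e o x : set X :=
  [set x] `|` [set y | exists2 k, (1 <= k)%N & iter k (pred_vertex e o) y = x].

Definition dyadic e o (k : nat) : set (set X) :=
  [set [set x] | x in [set x | (dist e x o < k)%N]] `|`
  [set sector e o y | y in [set y | dist e y o = k]].

Definition all_dyadic e o : set (set X) := \bigcup_k dyadic e o k.

(* P = Q^{(1)}; no P qualifies when Q is the whole tree. *)
Definition is_parent e o Q (P : set X) : Prop :=
  exists k : nat, [/\ dyadic e o k.+1 Q,
    forall j, (j <= k)%N -> ~ dyadic e o j Q,
    dyadic e o k P & Q `<=` P].

End Tree.

Section Operators.
Context {R : realType} {d : measure_display} {X : measurableType d}.
Variable mu : {measure set X -> \bar R}.
Implicit Types (f g : X -> R[i]) (K : X -> X -> R[i]) (Q : set X).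

Definition cabs (z : R[i]) : R := Normc.normc z.

(* Every subset is measurable, and mu is given by finite point masses, possibly
   zero; mu [set: X] may be infinite.  The last clause is automatic when X is
   countable. *)
Definition point_mass_measure : Prop :=
  [/\ forall A : set X, measurable A,
      forall x, (mu [set x] < +oo)%E
    & forall A : set X, mu A = (\esum_(x in A) mu [set x])%E].

(* Unordered sums over X; meaningful for absolutely summable families. *)
Definition rsum (h : X -> R) : R :=
  fine (\esum_(y in [set: X]) (Num.max (h y) 0)%:E)%E -
  fine (\esum_(y in [set: X]) (Num.max (- h y) 0)%:E)%E.

Definition csum g : R[i] :=
  rsum (fun y => complex.Re (g y)) +i* rsum (fun y => complex.Im (g y)).

Definition opT_term K f (x y : X) : R[i] :=
  K x y * f y * (fine (mu [set y]))%:C.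

Definition opT K f (x : X) : R[i] := csum (opT_term K f x).

(* The series defining T f converges absolutely at almost every point. *)
Definition opT_defined K f : Prop :=
  {ae mu, forall x, summable [set: X] (fun y => (cabs (opT_term K f x y))%:E)}.

Definition cLnorm (p : \bar R) f : \bar R :=
  Lnorm mu p (fun x => (cabs (f x))%:E).

Definition in_Lp (p : \bar R) f : Prop := (cLnorm p f < +oo)%E.

Definition weakL1_norm f : \bar R :=
  ereal_sup [set (l%:E * mu [set x | (l < cabs (f x))%R])%E
            | l in [set l : R | 0 < l]].

Definition cintegral Q f : R[i] :=
  Rintegral mu Q (fun x => complex.Re (f x)) +i*
  Rintegral mu Q (fun x => complex.Im (f x)).

(* For complex functions and for nonnegative extended real ones.  Both averages
   are 0 when mu Q is 0 or infinite, since fine +oo = 0 and 0^-1 = 0. *)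
Definition avg f Q : R[i] := cintegral Q f * ((fine (mu Q))^-1)%:C.

Definition eavg (h : X -> \bar R) Q : \bar R :=
  ((\int[mu]_(x in Q) h x) * ((fine (mu Q))^-1)%:E)%E.

Variables (e : rel X) (o : X).

Definition condE (k : nat) f (x : X) : R[i] :=
  \sum_(Q \in dyadic e o k) (avg f Q * \1_Q x).

Definition econdE (k : nat) (h : X -> \bar R) (x : X) : \bar R :=
  (\sum_(Q \in dyadic e o k) (eavg h Q * (\1_Q x)%:E))%E.

Definition mdiff (k : nat) f (x : X) : R[i] := condE k f x - condE k.-1 f x.

Definition BMO_norm f : \bar R :=
  (cLnorm +oo (condE 0 f) +
   ereal_sup [set Lnorm mu +oo
                (econdE k (fun y => (cabs (f y - condE k.-1 f y))%:E))
             | k in [set k : nat | (1 <= k)%N]])%E.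

Definition H1_norm f : \bar R :=
  Lnorm mu 1 (fun x =>
    ((\sum_(1 <= k <oo) (cabs (mdiff k f x) ^+ 2)%:E) `^ (2^-1)%R)%E).

Definition in_H1 f : Prop :=
  [/\ in_Lp 1 f, cintegral [set: X] f = 0 & (H1_norm f < +oo)%E].

Definition opT_bounded K (A : (X -> R[i]) -> Prop)
    (normA normB : (X -> R[i]) -> \bar R) : Prop :=
  exists C : R, forall f, A f ->
    opT_defined K f /\ (normB (opT K f) <= C%:E * normA f)%E.

Definition size_condition K : Prop :=
  (ereal_sup [set s : \bar R | exists Q P x, [/\ is_parent e o Q P, Q x &
     s = \esum_(z in P `\` Q) ((cabs (K x z))%:E * mu [set z])] ] < +oo)%E.

Definition Hormander_condition K : Prop :=
  (ereal_sup [set s : \bar R | exists Q x y,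
     [/\ all_dyadic e o Q, Q x, Q y &
     s = \esum_(z in ~` Q) ((cabs (K z x - K z y)%R)%:E * mu [set z])] ]
   < +oo)%E.

End Operators.

(* Main.v *)
Require Import Defs.
From mathcomp Require Import all_boot all_order all_algebra.
From mathcomp Require Import finmap complex ring lra.
From mathcomp Require Import all_classical all_reals all_analysis.

(** The level-[k] dyadic sets of a tree partition its vertices, each partition
    refines the preceding one, and every vertex is isolated from some level on
    ([tree_block_nested]).  With [Q k x] the block of level [k] containing [x],
    the theorem becomes one about an atomic measure space filtered by nested
    partitions.

    The measure is not doubling: a block may be negligible in its parent, and
    blocks may have infinite mass.  The size condition replaces doubling.  On
    the gap between a block and its parent it bounds the kernel absolutely;
    outside the parent, the Hormander condition applies to the parent.  Hence
    subtracting a mean over the parent, and not over the block itself, is always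
    harmless ([kernel_atom], [kop_oscillation]).  On a block of infinite mass
    every mean is [0] by convention, and the Hormander condition then needs no
    cancellation at all ([kernel_infinite_block]): the rows of the kernel are
    summable, so their averages over larger and larger finite parts of the block
    tend to [0].

    Weak type (1, 1).  At height [lam], stop at the largest dyadic set [B]
    around [y] on which the average of [|f|] exceeds [lam], and spread the mass
    at [y] uniformly over the parent [P] of [B].  The difference between the
    point mass and its spread copy is an atom for which [T] is integrable off
    [B].  The copies overlap, because parents of disjoint blocks are only nested
    or disjoint, but nestedness together with the average of [|f|] over a parent
    being at most [lam] bounds the square of their sum ([good_L2]); [L^2]
    boundedness finishes ([kop_weak11]).

    [L^infinity] to BMO.  On a child [B] of [P], [T f] minus its mean over [P]
    is bounded up to the contribution of [f] on [B], which the [L^2] bound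
    controls.  This gives the quadratic oscillation ([kop_BMO2]), hence the BMO
    bound by Cauchy-Schwarz.

    [H^1] to [L^1].  Since [T] is symmetric, testing [T f] against a bounded
    function [g] of finite support amounts to pairing [f] with [T g], whose
    quadratic oscillation has just been bounded.  Fefferman's inequality
    [fefferman] bounds such pairings by the norm of the square function, and
    holds for all nested partitions ([kop_H1]). *)

Set Implicit Arguments.
Unset Strict Implicit.
Unset Printing Implicit Defensive.
Import Order.TTheory GRing.Theory Num.Theory.
Local Open Scope classical_set_scope.
Local Open Scope ring_scope.

(** * Unordered sums *)

Section UnorderedSums.
Context {R : realType}.

Lemma esum_subset {I : choiceType} (A B : set I) (a : I -> \bar R) :
  A `<=` B -> (forall i, (0 <= a i)%E) ->
  (\esum_(i in A) a i <= \esum_(i in B) a i)%E.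
Proof.
move=> AB a0; rewrite esum_mkcond [leRHS]esum_mkcond; apply: le_esum => i _.
case: ifPn => [|_]; last by case: ifP.
by rewrite inE => /AB Bi; rewrite mem_set.
Qed.

Lemma esum_ge_term {I : choiceType} (A : set I) (a : I -> \bar R) i :
  A i -> (forall i, (0 <= a i)%E) -> (a i <= \esum_(i in A) a i)%E.
Proof.
move=> Ai a0; rewrite -(@esum_set1 R I i a)//.
by apply: esum_subset => // j ->.
Qed.

Lemma esum_pZl {I : choiceType} (A : set I) (c : R) (a : I -> \bar R) :
  0 <= c -> (forall i, (0 <= a i)%E) ->
  (\esum_(i in A) (c%:E * a i) = c%:E * \esum_(i in A) a i)%E.
Proof.
move=> c0 a0; rewrite /esum -ereal_supZl//; last first.
  by apply/set0P; exists 0%E, set0; [exact: fsets_set0|rewrite fsbig_set0].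
congr ereal_sup; apply/seteqP; split => [_ [F FA <-]|_ [_ [F FA <-] <-]] /=.
  exists (\sum_(x \in F) a x)%E; first by exists F.
  rewrite !fsbig_finite; [|by case: FA..].
  by rewrite ge0_sume_distrr.
exists F => //.
rewrite !fsbig_finite; [|by case: FA..].
by rewrite ge0_sume_distrr.
Qed.

Lemma esum_exchange {I J : choiceType} (A : set I) (B : set J)
    (a : I -> J -> \bar R) : (forall i j, (0 <= a i j)%E) ->
  (\esum_(i in A) \esum_(j in B) a i j = \esum_(j in B) \esum_(i in A) a i j)%E.
Proof.
move=> a0; rewrite (@esum_esum _ _ _ A (fun=> B))// (@esum_esum _ _ _ B (fun=> A))//.
rewrite (reindex_esum (B `*`` (fun=> A)) _ (fun x => (x.2, x.1)))//.
split=> //=.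
- by move=> [i j] [/=].
- by move=> [i1 i2] [j1 j2] /= _ _ [] -> ->.
- by move=> [i1 i2] [Pi1 Qi2] /=; exists (i2, i1).
Qed.

(** The blocks [r x] partition [A], and unordered summation of nonnegative
    families is associative. *)
Lemma le_esum_blocks {I : choiceType} (A : set I) (r : I -> set I)
    (a b : I -> \bar R) :
  (forall x, A x -> r x `<=` A) -> (forall x, A x -> r x x) ->
  (forall x y, A x -> r x y -> r y = r x) ->
  (forall x, (0 <= a x)%E) -> (forall x, (0 <= b x)%E) ->
  (forall x, A x -> (\esum_(y in r x) a y <= \esum_(y in r x) b y)%E) ->
  (\esum_(x in A) a x <= \esum_(x in A) b x)%E.
Proof.
move=> rA rr req a0 b0 ab.
have key (c : I -> \bar R) : (forall x, (0 <= c x)%E) ->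
    (\esum_(x in A) c x = \esum_(Q in [set r x | x in A]) \esum_(y in Q) c y)%E.
  move=> c0; rewrite esum_esum// (reindex_esum A _ (fun x => (r x, x)) )//=.
  split => //=.
  - by move=> x Ax; split => /=; [exists x|exact: rr].
  - by move=> x y _ _ [].
  - move=> [Q x] /= [[y Ay <-] ryx]; exists x; first exact: (rA y).
    by rewrite (req y).
rewrite !key//; apply: le_esum => _ [x Ax <-]; exact: ab.
Qed.

End UnorderedSums.

Section Indicators.
Context {S : pzRingType} {X : Type}.
Implicit Types (A : set X) (x : X).

Lemma indic_in A x : A x -> \1_A x = 1 :> S.
Proof. by move=> Ax; rewrite indicE mem_set. Qed.

Lemma indic_out A x : ~ A x -> \1_A x = 0 :> S.
Proof. by move=> Ax; rewrite indicE memNset. Qed.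

End Indicators.

Section Cabs.
Context {R : realType}.
Implicit Types (z : R[i]) (r : R).

Lemma cabs_ge0 z : 0 <= cabs z.
Proof. by case: z => a b; exact: sqrtr_ge0. Qed.

Lemma cabs0 : cabs (0 : R[i]) = 0.
Proof. exact: Normc.normc0. Qed.

Lemma cabs1 : cabs (1 : R[i]) = 1.
Proof. exact: Normc.normc1. Qed.

Lemma cabsM z1 z2 : cabs (z1 * z2) = cabs z1 * cabs z2.
Proof. exact: Normc.normcM. Qed.

Lemma cabsN z : cabs (- z) = cabs z.
Proof. by case: z => a b; rewrite /cabs /Normc.normc /= !sqrrN. Qed.

Lemma cabsD z1 z2 : cabs (z1 + z2) <= cabs z1 + cabs z2.
Proof. exact: le_normcD. Qed.

Lemma cabsB z1 z2 : cabs (z1 - z2) <= cabs z1 + cabs z2.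
Proof. by rewrite (le_trans (cabsD _ _))// cabsN. Qed.

Lemma cabs_distC z1 z2 : cabs (z1 - z2) = cabs (z2 - z1).
Proof. by rewrite -cabsN opprB. Qed.

Lemma cabs_sqr z : cabs z ^+ 2 = complex.Re z ^+ 2 + complex.Im z ^+ 2.
Proof. by case: z => a b; rewrite /cabs /= sqr_sqrtr// addr_ge0 ?sqr_ge0. Qed.

Lemma cabs_real r : cabs r%:C%C = `|r|.
Proof. by rewrite /cabs /= expr0n addr0 sqrtr_sqr. Qed.

Lemma cabs_ge0_real r : 0 <= r -> cabs r%:C%C = r.
Proof. by move=> r0; rewrite cabs_real ger0_norm. Qed.

Lemma cabs_eq0 z : cabs z = 0 -> z = 0.
Proof. exact: Normc.eq0_normc. Qed.

Lemma Re_le_cabs z : `|complex.Re z| <= cabs z.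
Proof.
by rewrite -sqrtr_sqr; case: z => a b; apply: ler_wsqrtr; rewrite lerDl sqr_ge0.
Qed.

Lemma Im_le_cabs z : `|complex.Im z| <= cabs z.
Proof.
by rewrite -sqrtr_sqr; case: z => a b; apply: ler_wsqrtr; rewrite lerDr sqr_ge0.
Qed.

Lemma cabs_indic {X : Type} (A : set X) x : cabs (\1_A x : R[i]) = \1_A x.
Proof. by rewrite !indicE; case: (x \in A) => /=; [exact: cabs1|exact: cabs0]. Qed.

(** Used to express the modulus of a sum as the sum of a rotated family. *)
Lemma cabs_rotate z : exists u : R[i], cabs u <= 1 /\ u * z = (cabs z)%:C%C.
Proof.
have [->|z0] := eqVneq z 0; first by exists 0; rewrite mulr0 cabs0.
have az0 : cabs z != 0 by apply: contra z0 => /eqP/cabs_eq0 ->.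
exists ((cabs z)%:C%C / z); split; last by rewrite mulfVK.
by rewrite cabsM cabs_ge0_real ?cabs_ge0// /cabs Normc.normcV divff.
Qed.

Lemma Re_realM r z : complex.Re (r%:C%C * z) = r * complex.Re z.
Proof. by case: z => a b /=; rewrite mul0r subr0. Qed.

End Cabs.
#[global] Hint Extern 0 (is_true (0 <= cabs _)) => exact: cabs_ge0 : core.
#[global] Hint Extern 0 (is_true (0 <= cabs _ ^+ 2)) => exact: sqr_ge0 : core.

Section SignedSums.
Context {R : realType} {d : measure_display} {X : measurableType d}.
Implicit Types (f g : X -> R[i]) (h k : X -> R).

Definition rsble h : Prop := (\esum_(x in [set: X]) (`|h x|)%:E < +oo)%E.

Let pos_fin h : rsble h ->
  (\esum_(y in [set: X]) (Num.max (h y) 0)%:E \is a fin_num)%E.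
Proof.
move=> hs; rewrite ge0_fin_numE; last first.
  by apply: esum_ge0 => x _; rewrite lee_fin le_max lexx orbT.
apply: le_lt_trans hs; apply: le_esum => x _; rewrite lee_fin.
by rewrite ge_max normr_ge0 andbT ler_norm.
Qed.

Let rsbleN h : rsble h -> rsble (fun x => - h x).
Proof. by rewrite /rsble; under [in X in _ -> X]eq_esum do rewrite normrN. Qed.

Let neg_fin h : rsble h ->
  (\esum_(y in [set: X]) (Num.max (- h y) 0)%:E \is a fin_num)%E.
Proof. by move=> /rsbleN/pos_fin. Qed.

(** The positive part of a sum is not the sum of the positive parts.  Additivity
    comes from moving all negative terms to the other side, where every family
    is nonnegative. *)
Lemma rsum_diff h (p q : X -> R) : (forall x, 0 <= p x) -> (forall x, 0 <= q x) ->
  (\esum_(x in [set: X]) (p x)%:E \is a fin_num)%E ->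
  (\esum_(x in [set: X]) (q x)%:E \is a fin_num)%E ->
  (forall x, h x = p x - q x) ->
  rsum h = fine (\esum_(x in [set: X]) (p x)%:E)%E
         - fine (\esum_(x in [set: X]) (q x)%:E)%E.
Proof.
move=> p0 q0 pf qf hE.
have hs : rsble h.
  apply: (@le_lt_trans _ _ (\esum_(x in [set: X]) (p x)%:E +
                           \esum_(x in [set: X]) (q x)%:E)%E); last first.
    by rewrite lte_add_pinfty// ltey_eq ?pf ?qf.
  rewrite -esumD; [|by move=> x _; rewrite lee_fin..].
  apply: le_esum => x _; rewrite -EFinD lee_fin hE.
  by rewrite (le_trans (ler_normB _ _))// !ger0_norm.
have := pos_fin hs; have := neg_fin hs; rewrite /rsum => nf pof.
apply/eqP; rewrite subr_eq -addrA [- _ + _]addrC addrA eq_sym subr_eq eq_sym; apply/eqP.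
rewrite -!fineD//; congr fine.
rewrite -!esumD; try by move=> x _; rewrite lee_fin ?le_max ?lexx ?orbT.
apply: eq_esum => x _; rewrite -!EFinD; congr EFin.
rewrite hE /Num.max; case: ltP => ?; case: ltP => ?; lra.
Qed.

Lemma rsumD h k : rsble h -> rsble k ->
  rsum (fun x => h x + k x) = rsum h + rsum k.
Proof.
move=> hs ks.
rewrite (@rsum_diff _ (fun x => Num.max (h x) 0 + Num.max (k x) 0)
                     (fun x => Num.max (- h x) 0 + Num.max (- k x) 0)).
- under eq_esum do rewrite EFinD.
  under [X in _ - fine X]eq_esum do rewrite EFinD.
  rewrite !esumD; try by move=> x _; rewrite lee_fin ?le_max ?lexx ?orbT.
  rewrite !fineD ?(pos_fin hs) ?(pos_fin ks) ?(neg_fin hs) ?(neg_fin ks)//.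
  by rewrite /rsum opprD addrACA.
- by move=> x; rewrite addr_ge0// le_max lexx orbT.
- by move=> x; rewrite addr_ge0// le_max lexx orbT.
- under eq_esum do rewrite EFinD.
  rewrite esumD; try by move=> x _; rewrite lee_fin ?le_max ?lexx ?orbT.
  by rewrite fin_numD (pos_fin hs) (pos_fin ks).
- under eq_esum do rewrite EFinD.
  rewrite esumD; try by move=> x _; rewrite lee_fin ?le_max ?lexx ?orbT.
  by rewrite fin_numD (neg_fin hs) (neg_fin ks).
- move=> x; rewrite /Num.max.
  case: ltP => ?; case: ltP => ?; case: ltP => ?; case: ltP => ?; lra.
Qed.

Lemma rsumN h : rsum (fun x => - h x) = - rsum h.
Proof. by rewrite /rsum opprB; under [X in _ - fine X = _]eq_esum do rewrite opprK. Qed.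

Lemma rsumZ (c : R) h : rsum (fun x => c * h x) = c * rsum h.
Proof.
wlog c0 : c / 0 <= c => [ih|].
  have [/ih//|/ltW c0] := leP 0 c.
  have : rsum (fun x => - c * h x) = - c * rsum h by apply: ih; rewrite oppr_ge0.
  under [in LHS]eq_fun do rewrite mulNr.
  by rewrite rsumN mulNr => /oppr_inj.
rewrite /rsum mulrBr.
have mx (r : R) : Num.max (c * r) 0 = c * Num.max r 0.
  by rewrite -[X in Num.max _ X](mulr0 c) maxr_pMr.
have f0 (F : X -> R) : fine (\esum_(y in [set: X]) (Num.max (c * F y) 0)%:E)%E =
    c * fine (\esum_(y in [set: X]) (Num.max (F y) 0)%:E)%E.
  under eq_esum do rewrite mx EFinM.
  rewrite esum_pZl//; last by move=> x; rewrite lee_fin le_max lexx orbT.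
  set E := esum _ _.
  have : (0 <= E)%E by apply: esum_ge0 => x _; rewrite lee_fin le_max lexx orbT.
  case: E => [r _ //|_ |//].
  have [->|c0'] := eqVneq c 0; first by rewrite mul0e mul0r.
  by rewrite gt0_muley ?lte_fin ?lt_neqAle 1?eq_sym ?c0'//= mulr0.
rewrite f0; congr (_ - _); rewrite -f0; congr fine.
by apply: eq_esum => x _; rewrite mulrN.
Qed.

Lemma rsum_ge0E h : (forall x, 0 <= h x) ->
  rsum h = fine (\esum_(x in [set: X]) (h x)%:E)%E.
Proof.
move=> h0; rewrite /rsum [X in _ - fine X]esum1; last first.
  by move=> x _; rewrite max_r// oppr_le0.
by rewrite subr0; congr fine; apply: eq_esum => x _; rewrite max_l.
Qed.

Lemma rsum_le_abs h : rsble h ->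
  ((rsum h)%:E <= \esum_(x in [set: X]) (`|h x|)%:E)%E.
Proof.
move=> hs; apply: (@le_trans _ _ (\esum_(y in [set: X]) (Num.max (h y) 0)%:E)%E).
  rewrite -[leRHS]fineK ?pos_fin// lee_fin /rsum lerBlDr lerDl fine_ge0//.
  by apply: esum_ge0 => x _; rewrite lee_fin le_max lexx orbT.
apply: le_esum => x _; rewrite lee_fin.
by rewrite ge_max normr_ge0 andbT ler_norm.
Qed.

Definition csble f : Prop := (\esum_(x in [set: X]) (cabs (f x))%:E < +oo)%E.

Let Re_sble f : csble f -> rsble (fun x => complex.Re (f x)).
Proof.
move=> fs; apply: le_lt_trans fs; apply: le_esum => x _.
by rewrite lee_fin Re_le_cabs.
Qed.

Let Im_sble f : csble f -> rsble (fun x => complex.Im (f x)).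
Proof.
move=> fs; apply: le_lt_trans fs; apply: le_esum => x _.
by rewrite lee_fin Im_le_cabs.
Qed.

Lemma csumD f g : csble f -> csble g ->
  csum (fun x => f x + g x) = csum f + csum g.
Proof.
move=> fs gs; rewrite /csum.
have -> : (fun y => complex.Re (f y + g y)) =
          (fun y => complex.Re (f y) + complex.Re (g y)).
  by apply/funext => y; case: (f y) (g y) => ? ? [].
have -> : (fun y => complex.Im (f y + g y)) =
          (fun y => complex.Im (f y) + complex.Im (g y)).
  by apply/funext => y; case: (f y) (g y) => ? ? [].
by rewrite (rsumD (Re_sble fs) (Re_sble gs)) (rsumD (Im_sble fs) (Im_sble gs)).
Qed.

Lemma rsbleZ (c : R) h : rsble h -> rsble (fun x => c * h x).
Proof.
move=> hs; rewrite /rsble; under eq_esum do rewrite normrM EFinM.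
by rewrite esum_pZl// lte_mul_pinfty//.
Qed.

Lemma csumZ (c : R[i]) f : csble f -> csum (fun x => c * f x) = c * csum f.
Proof.
move=> fs; case: c => a b; rewrite /csum.
have -> : (fun y => complex.Re ((a +i* b)%C * f y)) =
          (fun y => a * complex.Re (f y) + - b * complex.Im (f y)).
  by apply/funext => y; case: (f y) => ? ? /=; rewrite mulNr.
have -> : (fun y => complex.Im ((a +i* b)%C * f y)) =
          (fun y => a * complex.Im (f y) + b * complex.Re (f y)).
  by apply/funext => y; case: (f y) => ? ? /=.
have [fR fI] := (Re_sble fs, Im_sble fs).
rewrite (rsumD (rsbleZ a fR) (rsbleZ (- b) fI)).
rewrite (rsumD (rsbleZ a fI) (rsbleZ b fR)) !rsumZ.
by apply/eqP; rewrite eq_complex /= mulNr !eqxx.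
Qed.

Lemma cabs_csum_le f :
  ((cabs (csum f))%:E <= \esum_(x in [set: X]) (cabs (f x))%:E)%E.
Proof.
have [fs|] := boolP (\esum_(x in [set: X]) (cabs (f x))%:E < +oo)%E; last first.
  by rewrite -leNgt leye_eq => /eqP ->; rewrite leey.
have [u [u1 uE]] := cabs_rotate (csum f).
have -> : cabs (csum f) = rsum (fun x => complex.Re (u * f x)).
  have := csumZ u fs; rewrite uE => /(congr1 (@complex.Re R)) /= <-.
  by [].
have us : csble (fun x => u * f x).
  rewrite /csble; under eq_esum do rewrite cabsM EFinM.
  rewrite esum_pZl//; last by move=> x; rewrite lee_fin.
    by rewrite lte_mul_pinfty// lee_fin.
apply: le_trans (rsum_le_abs (Re_sble us)) _.
apply: le_esum => x _; rewrite lee_fin (le_trans (Re_le_cabs _))// cabsM.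
by rewrite ler_piMl.
Qed.

End SignedSums.

Section SumExchange.
Context {R : realType} {d : measure_display} {X : measurableType d}.

Lemma rsum_exchange (F : X -> X -> R) :
  (\esum_(x in [set: X]) \esum_(y in [set: X]) (`|F x y|)%:E < +oo)%E ->
  rsum (fun x => rsum (F x)) = rsum (fun y => rsum (F ^~ y)).
Proof.
pose P x y := Num.max (F x y) 0; pose N x y := Num.max (- F x y) 0.
have P0 x y : 0 <= P x y by rewrite le_max lexx orbT.
have N0 x y : 0 <= N x y by rewrite le_max lexx orbT.
have PF x y : P x y <= `|F x y| by rewrite ge_max normr_ge0 andbT ler_norm.
have NF x y : N x y <= `|F x y|.
  by rewrite ge_max normr_ge0 andbT -normrN ler_norm.
have fin (G H : X -> X -> R) : (forall x y, 0 <= G x y <= `|H x y|) ->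
    (\esum_(x in [set: X]) \esum_(y in [set: X]) (`|H x y|)%:E < +oo)%E ->
    (forall x, \esum_(y in [set: X]) (G x y)%:E \is a fin_num)%E /\
    (\esum_(x in [set: X]) (fine (\esum_(y in [set: X]) (G x y)%:E))%:E
      = \esum_(x in [set: X]) \esum_(y in [set: X]) (G x y)%:E)%E /\
    (\esum_(x in [set: X]) \esum_(y in [set: X]) (G x y)%:E \is a fin_num)%E.
  move=> GH Hs.
  have G0 x : (0 <= \esum_(y in [set: X]) (G x y)%:E)%E.
    by apply: esum_ge0 => y _; rewrite lee_fin; case/andP: (GH x y).
  have GS : (\esum_(x in [set: X]) \esum_(y in [set: X]) (G x y)%:E < +oo)%E.
    apply: le_lt_trans Hs; apply: le_esum => x _; apply: le_esum => y _.
    by rewrite lee_fin; case/andP: (GH x y).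
  have Gf x : (\esum_(y in [set: X]) (G x y)%:E \is a fin_num)%E.
    rewrite ge0_fin_numE//; apply: le_lt_trans GS.
    exact: (@esum_ge_term _ _ _ (fun x => \esum_(y in [set: X]) (G x y)%:E)%E x).
  split=> //; split; last by rewrite ge0_fin_numE// esum_ge0.
  by apply: eq_esum => x _; rewrite fineK.
move=> Fs.
have Fs' : (\esum_(y in [set: X]) \esum_(x in [set: X]) (`|F x y|)%:E < +oo)%E.
  by rewrite esum_exchange.
have [P1 [P2 P3]] := fin P F (fun x y => introT andP (conj (P0 x y) (PF x y))) Fs.
have [N1 [N2 N3]] := fin N F (fun x y => introT andP (conj (N0 x y) (NF x y))) Fs.
have [P1' [P2' P3']] := fin (fun y x => P x y) (fun y x => F x y)
  (fun y x => introT andP (conj (P0 x y) (PF x y))) Fs'.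
have [N1' [N2' N3']] := fin (fun y x => N x y) (fun y x => F x y)
  (fun y x => introT andP (conj (N0 x y) (NF x y))) Fs'.
rewrite (@rsum_diff _ _ _ (fun x => rsum (F x))
  (fun x => fine (\esum_(y in [set: X]) (P x y)%:E)%E)
  (fun x => fine (\esum_(y in [set: X]) (N x y)%:E)%E)) ?P2 ?N2//; last first.
- by move=> x; apply: fine_ge0; apply: esum_ge0 => y _; rewrite lee_fin.
- by move=> x; apply: fine_ge0; apply: esum_ge0 => y _; rewrite lee_fin.
rewrite (@rsum_diff _ _ _ (fun y => rsum (F ^~ y))
  (fun y => fine (\esum_(x in [set: X]) (P x y)%:E)%E)
  (fun y => fine (\esum_(x in [set: X]) (N x y)%:E)%E)) ?P2' ?N2'//; last first.
- by move=> x; apply: fine_ge0; apply: esum_ge0 => y _; rewrite lee_fin.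
- by move=> x; apply: fine_ge0; apply: esum_ge0 => y _; rewrite lee_fin.
by congr (fine _ - fine _); apply: esum_exchange => x y; rewrite lee_fin.
Qed.

Lemma csum_exchange (F : X -> X -> R[i]) :
  (\esum_(x in [set: X]) \esum_(y in [set: X]) (cabs (F x y))%:E < +oo)%E ->
  csum (fun x => csum (F x)) = csum (fun y => csum (F ^~ y)).
Proof.
move=> Fs; rewrite /csum /=.
rewrite (@rsum_exchange (fun x y => complex.Re (F x y))); last first.
  apply: le_lt_trans Fs; apply: le_esum => x _; apply: le_esum => y _.
  by rewrite lee_fin Re_le_cabs.
rewrite (@rsum_exchange (fun x y => complex.Im (F x y)))//.
apply: le_lt_trans Fs; apply: le_esum => x _; apply: le_esum => y _.
by rewrite lee_fin Im_le_cabs.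
Qed.

End SumExchange.

(** * Sums weighted by point masses *)

Definition wsum {R : realType} {X : choiceType} (w : X -> R) (A : set X)
    (h : X -> R) : \bar R :=
  (\esum_(x in A) (h x * w x)%:E)%E.

(** Equal to [0] for sets of infinite mass, the convention that makes averages
    over such sets vanish. *)
Definition mass {R : realType} {X : choiceType} (w : X -> R) (A : set X) : R :=
  fine (wsum w A (fun=> 1)).

Section WeightedSums.
Context {R : realType} {X : choiceType}.
Variable w : X -> R.
Hypothesis w_ge0 : forall x, 0 <= w x.
Implicit Types (A B : set X) (h k : X -> R) (c : R).
Local Notation wsum := (wsum w).
Local Notation mass := (mass w).

Let pos h : (forall x, 0 <= h x) -> forall x, (0 <= (h x * w x)%:E)%E.
Proof. by move=> h0 x; rewrite lee_fin mulr_ge0. Qed.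

Lemma wsum_ge0 A h : (forall x, 0 <= h x) -> (0 <= wsum A h)%E.
Proof. by move=> h0; apply: esum_ge0 => x _; exact: pos. Qed.

Lemma wsum_le A h k : (forall x, A x -> 0 < w x -> h x <= k x) ->
  (wsum A h <= wsum A k)%E.
Proof.
move=> hk; apply: le_esum => x Ax; rewrite lee_fin.
have := w_ge0 x; rewrite le_eqVlt => /predU1P[<-|wx]; first by rewrite !mulr0.
by rewrite ler_pM2r// hk.
Qed.

Lemma eq_wsum A h k : (forall x, A x -> 0 < w x -> h x = k x) ->
  wsum A h = wsum A k.
Proof. by move=> hk; apply/eqP; rewrite eq_le !wsum_le// => x Ax wx; rewrite hk. Qed.

Lemma wsum_sub A B h : A `<=` B -> (forall x, 0 <= h x) ->
  (wsum A h <= wsum B h)%E.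
Proof. by move=> AB h0; apply: esum_subset => //; exact: pos. Qed.

Lemma wsum_term A h x : A x -> (forall x, 0 <= h x) ->
  ((h x * w x)%:E <= wsum A h)%E.
Proof.
by move=> Ax h0; apply: (@esum_ge_term R _ _ (fun x => (h x * w x)%:E) x) => //; exact: pos.
Qed.

Lemma wsum_set1 x h : (forall x, 0 <= h x) -> wsum [set x] h = (h x * w x)%:E.
Proof. by move=> h0; rewrite /wsum esum_set1//; exact: pos. Qed.

Lemma wsumD A h k : (forall x, 0 <= h x) -> (forall x, 0 <= k x) ->
  wsum A (fun x => h x + k x) = (wsum A h + wsum A k)%E.
Proof.
move=> h0 k0; rewrite /wsum -esumD//; [|by move=> *; exact: pos..].
by apply: eq_esum => x _; rewrite -EFinD mulrDl.
Qed.

Lemma wsumZ A c h : 0 <= c -> (forall x, 0 <= h x) ->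
  wsum A (fun x => c * h x) = (c%:E * wsum A h)%E.
Proof.
move=> c0 h0; rewrite /wsum -esum_pZl//; last exact: pos.
by apply: eq_esum => x _; rewrite -EFinM mulrA.
Qed.

Lemma wsum_mkcond A h : wsum A h = wsum [set: X] (fun x => h x * \1_A x).
Proof.
rewrite /wsum esum_mkcond; apply: eq_esum => x _; rewrite indicE.
by case: ifP => _; rewrite ?mulr1// mulr0 mul0r.
Qed.

Lemma wsum_leD A h h1 h2 c1 c2 :
  (forall x, 0 <= h1 x) -> (forall x, 0 <= h2 x) ->
  (forall x, A x -> 0 < w x -> h x <= h1 x + h2 x) ->
  (wsum A h1 <= c1%:E)%E -> (wsum A h2 <= c2%:E)%E ->
  (wsum A h <= (c1 + c2)%:E)%E.
Proof.
move=> h10 h20 hh H1 H2; rewrite (le_trans (wsum_le hh))//.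
by rewrite wsumD// EFinD leeD.
Qed.

Lemma wsum_leZ A h k c c' : 0 <= c -> (forall x, 0 <= k x) ->
  (forall x, A x -> 0 < w x -> h x <= c * k x) ->
  (wsum A k <= c'%:E)%E -> (wsum A h <= (c * c')%:E)%E.
Proof.
move=> c0 k0 hk kc; rewrite (le_trans (wsum_le hk))// wsumZ// EFinM.
by rewrite lee_wpmul2l// lee_fin.
Qed.

Lemma wsum_le1 A h k c : (forall x, A x -> 0 < w x -> h x <= k x) ->
  (wsum A k <= c%:E)%E -> (wsum A h <= c%:E)%E.
Proof. by move=> hk; exact: le_trans (wsum_le hk). Qed.

Lemma wsum_cover A B C h c1 c2 : A `<=` B `|` C -> (forall x, 0 <= h x) ->
  (wsum B h <= c1%:E)%E -> (wsum C h <= c2%:E)%E ->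
  (wsum A h <= (c1 + c2)%:E)%E.
Proof.
move=> ABC h0 HB HC.
have i0 (D : set X) x : 0 <= \1_D x :> R by rewrite indicE.
rewrite wsum_mkcond; move: HB HC; rewrite (wsum_mkcond B) (wsum_mkcond C).
apply: wsum_leD => [x|x|x _ _]; [by rewrite mulr_ge0..|].
rewrite -mulrDr ler_wpM2l// !indicE.
have [/set_mem/ABC[/mem_set ->|/mem_set ->]|_] := boolP (x \in A).
- by rewrite lerDl.
- by rewrite lerDr.
- by rewrite addr_ge0.
Qed.

(** Tonelli, as a bound: [F x] is dominated by the inner sums over [y], and
    the sums over [x] of the kernel are controlled first. *)
Lemma wsum_tonelli A B (F : X -> R) (k : X -> X -> R) (c : X -> R) C :
  (forall x y, 0 <= k x y) ->
  (forall x, A x -> 0 < w x -> ((F x)%:E <= wsum B (k x))%E) ->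
  (forall y, B y -> 0 < w y -> (wsum A (k ^~ y) <= (c y)%:E)%E) ->
  (wsum B c <= C%:E)%E -> (wsum A F <= C%:E)%E.
Proof.
move=> k0 Fk kc cC.
apply: (@le_trans _ _ (\esum_(x in A) \esum_(y in B) (k x y * w y * w x)%:E)%E).
  apply: le_esum => x Ax.
  have := w_ge0 x; rewrite le_eqVlt => /predU1P[<-|wx].
    by rewrite mulr0 esum_ge0// => y _; rewrite mulr0.
  rewrite mulrC EFinM; under eq_esum do rewrite mulrC EFinM.
  rewrite esum_pZl//; last by move=> y; exact: pos.
  by rewrite lee_pmul2l//; exact: Fk.
rewrite esum_exchange; last by move=> x y; rewrite lee_fin !mulr_ge0.
apply: le_trans cC; apply: le_esum => y By.
have := w_ge0 y; rewrite le_eqVlt => /predU1P[<-|wy].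
  by rewrite mulr0 esum1// => x _; rewrite mulr0 mul0r.
under eq_esum do rewrite mulrAC mulrC EFinM.
rewrite mulrC EFinM esum_pZl//; last by move=> x; rewrite lee_fin mulr_ge0.
by rewrite lee_pmul2l//; exact: kc.
Qed.

Lemma wsum_blocks A (r : X -> set X) h k :
  (forall x, A x -> r x `<=` A) -> (forall x, A x -> r x x) ->
  (forall x y, A x -> r x y -> r y = r x) ->
  (forall x, 0 <= h x) -> (forall x, 0 <= k x) ->
  (forall x, A x -> 0 < w x -> (wsum (r x) h <= wsum (r x) k)%E) ->
  (wsum A h <= wsum A k)%E.
Proof.
move=> rA rr req h0 k0 hk; apply: (le_esum_blocks rA rr req (pos h0) (pos k0)).
move=> x Ax.
have [[z [rz wz]]|nw] := pselect (exists z, r x z /\ 0 < w z).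
  rewrite -(req _ _ Ax rz); exact: (hk _ (rA _ Ax _ rz)).
rewrite esum1// ?esum_ge0// => [y _|y ry]; first exact: pos.
have := w_ge0 y; rewrite le_eqVlt => /predU1P[<-|wy]; first by rewrite mulr0.
by case: nw; exists y.
Qed.

(** Cauchy-Schwarz on a set of finite mass, in the form given by
    [h <= (c + h ^ 2 / c) / 2]. *)
Lemma wsum_cauchy_schwarz A h c m : 0 < c -> (forall x, 0 <= h x) ->
  (wsum A (fun=> 1%R) <= m%:E)%E ->
  (wsum A (fun x => (h x ^+ 2)%R) <= (c ^+ 2 * m)%:E)%E ->
  (wsum A h <= (c * m)%:E)%E.
Proof.
move=> c0 h0 Hm H2.
have -> : c * m = (c / 2) * m + (2 * c)^-1 * (c ^+ 2 * m).
  by field; rewrite gt_eqF.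
have c2 : 0 <= c / 2 by rewrite divr_ge0// ltW.
have c3 : 0 <= (2 * c)^-1 by rewrite invr_ge0 mulr_ge0// ltW.
apply: (@wsum_leD _ _ (fun=> c / 2) (fun x => (2 * c)^-1 * h x ^+ 2)) => //.
- by move=> x; rewrite mulr_ge0// sqr_ge0.
- move=> x _ _; rewrite -subr_ge0.
  have -> : c / 2 + (2 * c)^-1 * h x ^+ 2 - h x = (2 * c)^-1 * (c - h x) ^+ 2.
    by field; rewrite gt_eqF.
  by rewrite mulr_ge0// sqr_ge0.
- by apply: (wsum_leZ c2 _ _ Hm) => // x _ _; rewrite mulr1.
- by apply: (wsum_leZ c3 _ _ H2) => // x; exact: sqr_ge0.
Qed.

Lemma mass_ge0 A : 0 <= mass A.
Proof. by apply: fine_ge0; apply: wsum_ge0. Qed.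

Lemma massE A : (wsum A (fun=> 1%R) < +oo)%E -> wsum A (fun=> 1%R) = (mass A)%:E.
Proof. by move=> fA; rewrite fineK// ge0_fin_numE// wsum_ge0. Qed.

Lemma mass_infty A : wsum A (fun=> 1%R) = +oo%E -> mass A = 0.
Proof. by rewrite /mass => ->. Qed.

Lemma mass_dichotomy A :
  (wsum A (fun=> 1%R) < +oo)%E \/ wsum A (fun=> 1%R) = +oo%E.
Proof.
have [|] := boolP (wsum A (fun=> 1%R) < +oo)%E; first by left.
by rewrite -leNgt leye_eq => /eqP; right.
Qed.

Lemma mass_gt0 A x : (wsum A (fun=> 1%R) < +oo)%E -> A x -> 0 < w x -> 0 < mass A.
Proof.
move=> fA Ax wx; rewrite (lt_le_trans wx)// -lee_fin -massE//.
by have := @wsum_term A (fun=> 1) x Ax (fun=> ler01); rewrite mul1r.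
Qed.

(** On sets of infinite mass the bound holds because [(mass A)^-1] is [0]. *)
Lemma wsum_avg1 A : (wsum A (fun=> (mass A)^-1%R) <= 1%:E)%E.
Proof.
have [fA|/mass_infty ->] := mass_dichotomy A; last first.
  by rewrite invr0 /wsum esum1// => x _; rewrite mul0r.
have -> : wsum A (fun=> (mass A)^-1) = wsum A (fun=> (mass A)^-1 * 1).
  by apply: eq_wsum => x _ _; rewrite mulr1.
rewrite wsumZ// ?invr_ge0 ?mass_ge0// massE// -EFinM lee_fin.
by have [->|m0] := eqVneq (mass A) 0; rewrite ?mulr0// mulVf.
Qed.

Lemma wsum_cst A c : 0 <= c -> (wsum A (fun=> 1%R) < +oo)%E ->
  wsum A (fun=> c) = (c * mass A)%:E.
Proof.
move=> c0 fA; rewrite EFinM -massE// -wsumZ//.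
by apply: eq_wsum => x _ _; rewrite mulr1.
Qed.

End WeightedSums.

Definition wint {R : realType} {d} {X : measurableType d} (w : X -> R)
    (f : X -> R[i]) : R[i] :=
  csum (fun x => f x * (w x)%:C%C).

Definition wsble {R : realType} {X : choiceType} (w : X -> R) (f : X -> R[i]) :=
  (wsum w [set: X] (fun x => cabs (f x)) < +oo)%E.

Section WeightedComplexSums.
Context {R : realType} {d : measure_display} {X : measurableType d}.
Variable w : X -> R.
Hypothesis w_ge0 : forall x, 0 <= w x.
Implicit Types (A B : set X) (f g : X -> R[i]) (h k : X -> R) (c : R[i]).
Local Notation wsum := (wsum w).
Local Notation mass := (mass w).
Local Notation wint := (wint w).
Local Notation wsble := (wsble w).

Let absE f x : cabs (f x * (w x)%:C%C) = cabs (f x) * w x.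
Proof. by rewrite cabsM cabs_ge0_real. Qed.

Let csbleE f : wsble f -> csble (fun x => f x * (w x)%:C%C).
Proof. by rewrite /csble; under eq_esum do rewrite absE. Qed.

Lemma wsbleW f (C : R) :
  (wsum [set: X] (fun x => cabs (f x)) <= C%:E)%E -> wsble f.
Proof. by move=> /le_lt_trans; apply; exact: ltry. Qed.

Lemma wsble_le f g : (forall x, 0 < w x -> cabs (f x) <= cabs (g x)) ->
  wsble g -> wsble f.
Proof. by move=> fg; apply: le_lt_trans; apply: wsum_le => // x _; exact: fg. Qed.

Lemma wsbleD f g : wsble f -> wsble g -> wsble (fun x => f x + g x).
Proof.
move=> fs gs; rewrite /wsble.
apply: (@le_lt_trans _ _ (wsum [set: X] (fun x => cabs (f x) + cabs (g x)))).
  by apply: wsum_le => // x _ _; exact: cabsD.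
by rewrite wsumD// lte_add_pinfty.
Qed.

Lemma wsbleZ c f : wsble f -> wsble (fun x => c * f x).
Proof.
move=> fs; rewrite /wsble; under [X in wsum _ X]eq_fun do rewrite cabsM.
by rewrite wsumZ// lte_mul_pinfty// lee_fin.
Qed.

Lemma wsbleN f : wsble f -> wsble (fun x => - f x).
Proof. by rewrite /wsble; under [in X in _ -> X]eq_fun do rewrite cabsN. Qed.

Lemma wsbleB f g : wsble f -> wsble g -> wsble (fun x => f x - g x).
Proof. by move=> fs /wsbleN; exact: wsbleD. Qed.

Lemma wsble_indic f A : wsble f -> wsble (fun x => f x * \1_A x).
Proof.
by apply: wsble_le => x _; rewrite cabsM cabs_indic ler_piMr// indicE.
Qed.

Lemma wintD f g : wsble f -> wsble g ->
  wint (fun x => f x + g x) = wint f + wint g.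
Proof.
move=> /csbleE fs /csbleE gs; rewrite /wint -csumD//.
by under eq_fun do rewrite mulrDl.
Qed.

Lemma wintZ c f : wsble f -> wint (fun x => c * f x) = c * wint f.
Proof.
move=> /csbleE fs; rewrite /wint -csumZ//.
by under eq_fun do rewrite -mulrA.
Qed.

Lemma wintN f : wsble f -> wint (fun x => - f x) = - wint f.
Proof.
by move=> fs; rewrite -mulN1r -wintZ//; under [in RHS]eq_fun do rewrite mulN1r.
Qed.

Lemma wintB f g : wsble f -> wsble g ->
  wint (fun x => f x - g x) = wint f - wint g.
Proof. by move=> fs gs; rewrite wintD ?wintN//; exact: wsbleN. Qed.

Lemma eq_wint f g : (forall x, 0 < w x -> f x = g x) -> wint f = wint g.
Proof.
move=> fg; rewrite /wint; congr csum; apply/funext => x.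
have := w_ge0 x; rewrite le_eqVlt => /predU1P[<-|/fg ->//].
by rewrite !mulr0.
Qed.

Lemma cabs_wint f :
  ((cabs (wint f))%:E <= wsum [set: X] (fun x => cabs (f x)))%E.
Proof. by apply: (le_trans (cabs_csum_le _)); under eq_esum do rewrite absE. Qed.

Lemma cabs_wint_le f A h (C : R) :
  (forall x, ~ A x -> f x = 0) -> (forall x, A x -> 0 < w x -> cabs (f x) <= h x) ->
  (wsum A h <= C%:E)%E -> cabs (wint f) <= C.
Proof.
move=> fA fh hC; rewrite -lee_fin (le_trans (cabs_wint f))// (le_trans _ hC)//.
rewrite [leRHS]wsum_mkcond; apply: wsum_le => // x _ wx; rewrite indicE.
have [/set_mem Ax|/negP xA] := boolP (x \in A); first by rewrite mulr1 fh.
by rewrite mulr0 fA ?cabs0// => Ax; apply: xA; rewrite inE.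
Qed.

Lemma wint0 : wint (fun=> 0) = 0.
Proof.
have s0 : wsble (fun=> 0).
  by rewrite /wsble /wsum esum1// => x _; rewrite cabs0 mul0r.
by have := wintZ 0 s0; rewrite !mul0r.
Qed.

Lemma wint_exchange (F : X -> X -> R[i]) (k : X -> R) C :
  (forall x, 0 < w x -> (wsum [set: X] (fun y => cabs (F x y)) <= (k x)%:E)%E) ->
  (wsum [set: X] k <= C%:E)%E ->
  wint (fun x => wint (F x)) = wint (fun y => wint (F ^~ y)).
Proof.
move=> Fk kC.
have sE (a : X -> R[i]) (x : X) : (\esum_(y in [set: X])
    (cabs (a y * (w y)%:C%C * (w x)%:C%C))%:E =
    (w x)%:E * wsum [set: X] (fun y => cabs (a y)))%E.
  rewrite /wsum -esum_pZl//; last by move=> y; rewrite lee_fin mulr_ge0.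
  by apply: eq_esum => y _; rewrite cabsM absE cabs_ge0_real// mulrC EFinM.
have FC : (\esum_(x in [set: X]) \esum_(y in [set: X])
    (cabs (F x y * (w y)%:C%C * (w x)%:C%C))%:E < +oo)%E.
  apply: (@le_lt_trans _ _ C%:E); last exact: ltry.
  apply: le_trans kC; apply: le_esum => x _; rewrite sE.
  have := w_ge0 x; rewrite le_eqVlt => /predU1P[<-|wx]; first by rewrite mul0e mulr0.
  by rewrite mulrC EFinM lee_pmul2l//; exact: Fk.
have xE x : wint (F x) * (w x)%:C%C =
    csum (fun y => F x y * (w y)%:C%C * (w x)%:C%C).
  have := w_ge0 x; rewrite le_eqVlt => /predU1P[<-|wx].
    rewrite mulr0 -[LHS](wint0); congr csum; apply/funext => y.
    by rewrite mulr0 mul0r.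
  rewrite mulrC -csumZ.
    by congr csum; apply/funext => y; rewrite mulrC.
  rewrite /csble; under eq_esum do rewrite absE.
  by apply: le_lt_trans (Fk x wx) _; exact: ltry.
have yE y : wint (F ^~ y) * (w y)%:C%C =
    csum (fun x => F x y * (w y)%:C%C * (w x)%:C%C).
  have := w_ge0 y; rewrite le_eqVlt => /predU1P[<-|wy].
    rewrite mulr0 -[LHS](wint0); congr csum; apply/funext => x.
    by rewrite mulr0 !mul0r.
  rewrite mulrC -csumZ.
    by congr csum; apply/funext => x; rewrite mulrCA mulrA.
  rewrite /csble.
  have : (\esum_(x in [set: X]) (cabs (F x y * (w y)%:C%C * (w x)%:C%C))%:E < +oo)%E.
    apply: le_lt_trans FC; apply: le_esum => x _.
    apply: (@esum_ge_term _ _ _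
      (fun y => (cabs (F x y * (w y)%:C%C * (w x)%:C%C))%:E) y) => // z.
    by rewrite lee_fin.
  have -> : (\esum_(x in [set: X]) (cabs (F x y * (w y)%:C%C * (w x)%:C%C))%:E =
     (w y)%:E * \esum_(x in [set: X]) (cabs (F x y * (w x)%:C%C))%:E)%E.
    rewrite -esum_pZl//; last by move=> x; rewrite lee_fin.
    apply: eq_esum => x _; rewrite mulrAC [in LHS]cabsM cabs_ge0_real// -EFinM.
    by congr EFin; rewrite [LHS]mulrC.
  case: (esum _ _) => [r _|/=|//]; first exact: ltry.
  by rewrite gt0_muley ?lte_fin.
transitivity (csum (fun x => csum (fun y => F x y * (w y)%:C%C * (w x)%:C%C))).
  by congr csum; apply/funext => x; exact: xE.
by rewrite csum_exchange//; congr csum; apply/funext => y; rewrite -yE.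
Qed.

Lemma wint_set1 f x : (forall y, y <> x -> f y = 0) ->
  wint f = f x * (w x)%:C%C.
Proof.
move=> fx.
have one (h : X -> R) : (forall y, y <> x -> h y = 0) -> rsum h = h x.
  move=> hx; rewrite /rsum.
  have key (F : X -> R) : (forall y, y <> x -> F y = 0) ->
      \esum_(y in [set: X]) (Num.max (F y) 0)%:E = (Num.max (F x) 0)%:E.
    move=> Fx; rewrite -[RHS](@esum_set1 R X x (fun y => (Num.max (F y) 0)%:E)).
      rewrite [in RHS]esum_mkcond; apply: eq_esum => y _.
      case: ifPn => // /negP; rewrite inE/= => yx; rewrite Fx ?maxxx//.
    by rewrite lee_fin le_max lexx orbT.
  rewrite !key//=; last by move=> y yx; rewrite hx ?oppr0.
  rewrite /Num.max; case: ltP => ?; case: ltP => ?; lra.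
rewrite /wint /csum !one; first by case: (_ * _).
  by move=> y yx; rewrite fx// mul0r.
by move=> y yx; rewrite fx// mul0r.
Qed.

Lemma wint_real (r : X -> R) : (forall x, 0 <= r x) ->
  wint (fun x => (r x)%:C%C) = (fine (wsum [set: X] r))%:C%C.
Proof.
move=> r0; rewrite /wint /csum.
have -> : (fun y => complex.Re ((r y)%:C%C * (w y)%:C%C)) = (fun y => r y * w y).
  by apply/funext => y /=; rewrite mulr0 subr0.
have -> : (fun y => complex.Im ((r y)%:C%C * (w y)%:C%C)) = (fun=> 0).
  by apply/funext => y /=; rewrite mulr0 mul0r addr0.
congr (_ +i* _)%C; first by rewrite rsum_ge0E// => x; rewrite mulr_ge0.
by rewrite rsum_ge0E// esum1.
Qed.

Lemma wint_indic A : wint (\1_A : X -> R[i]) = (mass A)%:C%C.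
Proof.
rewrite /mass wsum_mkcond -wint_real => [|x]; last by rewrite mul1r indicE.
congr wint; apply/funext => x; rewrite mul1r !indicE.
by case: (x \in A).
Qed.

Lemma wint_sum (I : Type) (s : seq I) (F : I -> X -> R[i]) :
  (forall i, wsble (F i)) ->
  wsble (fun x => \sum_(i <- s) F i x) /\
  wint (fun x => \sum_(i <- s) F i x) = \sum_(i <- s) wint (F i).
Proof.
move=> Fs; elim: s => [|i s [IH1 IH2]].
  split; last by rewrite big_nil -[RHS]wint0; congr wint; apply/funext => x; rewrite big_nil.
  by rewrite /wsble /wsum esum1// => x _; rewrite big_nil cabs0 mul0r.
have -> : (fun x => \sum_(j <- i :: s) F j x) =
          (fun x => F i x + \sum_(j <- s) F j x).
  by apply/funext => x; rewrite big_cons.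
by split; [exact: wsbleD|rewrite wintD// IH2 big_cons].
Qed.

End WeightedComplexSums.

(** * Nested partitions *)

(** [Q k x] is the block of level [k] containing [x].  Encoding the partitions by
    their block maps avoids indexing blocks: sums over blocks become
    sums over points. *)
Definition nested_partitions {X : Type} (Q : nat -> X -> set X) : Prop :=
  [/\ forall x, Q 0%N x = [set: X],
      forall k x, Q k x x,
      forall k x y, Q k x y -> Q k y = Q k x,
      forall k x, Q k.+1 x `<=` Q k x
    & forall x, exists n, Q n x = [set x]].

Section NestedPartitions.
Context {X : Type} (Q : nat -> X -> set X).
Hypothesis HQ : nested_partitions Q.

Lemma block0 x : Q 0 x = [set: X]. Proof. by case: HQ. Qed.

Lemma block_self k x : Q k x x. Proof. by case: HQ. Qed.

Lemma block_eq k x y : Q k x y -> Q k y = Q k x.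
Proof. by case: HQ => _ _ H _ _; exact: H. Qed.

Lemma block_sym k x y : Q k x y -> Q k y x.
Proof. by move=> /block_eq ->; exact: block_self. Qed.

Lemma block_sub j k x : (j <= k)%N -> Q k x `<=` Q j x.
Proof.
have subS i y : Q i.+1 y `<=` Q i y by case: HQ => _ _ _ + _; exact.
elim: k => [|k IH]; first by rewrite leqn0 => /eqP ->.
rewrite leq_eqVlt => /predU1P[->//|]; rewrite ltnS => /IH.
exact: subset_trans (subS k x).
Qed.

Lemma block_isolated x : exists n, forall k, (n <= k)%N -> Q k x = [set x].
Proof.
have [n nx] : exists n, Q n x = [set x] by case: HQ => _ _ _ _; exact.
exists n => k nk; apply/seteqP; split => [|y ->]; last exact: block_self.
by rewrite -nx; exact: block_sub.
Qed.

Lemma block_separate x y : x <> y -> exists k, Q k x y /\ ~ Q k.+1 x y.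
Proof.
move=> xy; have [n nx] := block_isolated x.
have Pn : exists k, `[< ~ Q k x y >].
  by exists n; apply/asboolP; rewrite (nx n (leqnn n)) => yx; apply: xy; rewrite yx.
case: (ex_minnP Pn) => -[|k] /asboolP Qk kmin.
  by case: Qk; rewrite block0.
exists k; split=> //; apply: contrapT => /asboolP /kmin.
by rewrite ltnn.
Qed.

Lemma block_meet j k x y z : (j <= k)%N -> Q j x z -> Q k y z -> Q k y `<=` Q j x.
Proof.
by move=> jk /block_eq <- /block_eq <-; exact: block_sub.
Qed.

End NestedPartitions.

(** * Calderon-Zygmund kernels over nested partitions *)

Definition kop {R : realType} {d} {X : measurableType d} (w : X -> R)
    (K : X -> X -> R[i]) (f : X -> R[i]) (x : X) : R[i] :=
  wint w (fun y => K x y * f y).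

(** One constant serves all three conditions.  In the last one [C] bounds the
    square of the operator norm on [L^2]; finiteness of the right-hand norm is
    expressed by the real bound [c]. *)
Definition dyadic_CZ_kernel {R : realType} {d} {X : measurableType d}
    (w : X -> R) (Q : nat -> X -> set X) (K : X -> X -> R[i]) (C : R) : Prop :=
  [/\ 1 <= C,
      forall x y, K x y = K y x,
      forall k x, (wsum w (Q k x `\` Q k.+1 x) (fun z => cabs (K x z)) <= C%:E)%E,
      forall k x y, Q k x y ->
        (wsum w (~` Q k x) (fun z => cabs (K z x - K z y)%R) <= C%:E)%E
    & forall f c, (wsum w [set: X] (fun x => (cabs (f x) ^+ 2)%R) <= c%:E)%E ->
        (wsum w [set: X] (fun x => (cabs (kop w K f x) ^+ 2)%R) <= (C * c)%:E)%E].

Section KernelBounds.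
Context {R : realType} {d : measure_display} {X : measurableType d}.
Variables (w : X -> R) (Q : nat -> X -> set X) (K : X -> X -> R[i]) (C : R).
Hypothesis w_ge0 : forall x, 0 <= w x.
Hypothesis HQ : nested_partitions Q.
Hypothesis HK : dyadic_CZ_kernel w Q K C.
Implicit Types (A B : set X) (f g : X -> R[i]).
Local Notation wsum := (wsum w).
Local Notation mass := (mass w).
Local Notation wint := (wint w).
Local Notation wsble := (wsble w).
Local Notation T := (kop w K).

Lemma kernel_C1 : 1 <= C. Proof. by case: HK. Qed.
Lemma kernel_C0 : 0 < C. Proof. exact: lt_le_trans kernel_C1. Qed.
Lemma kernel_C_ge0 : 0 <= C. Proof. exact: ltW kernel_C0. Qed.
Hint Resolve kernel_C_ge0 kernel_C0 : core.

Lemma kernel_sym x y : K x y = K y x. Proof. by case: HK. Qed.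

Lemma kernel_size k x :
  (wsum (Q k x `\` Q k.+1 x) (fun z => cabs (K x z)) <= C%:E)%E.
Proof. by case: HK. Qed.

Lemma kernel_hormander k x y : Q k x y ->
  (wsum (~` Q k x) (fun z => cabs (K z x - K z y)%R) <= C%:E)%E.
Proof. by case: HK => _ _ _ H _; exact: H. Qed.

Lemma kernel_L2 f c : (wsum [set: X] (fun x => (cabs (f x) ^+ 2)%R) <= c%:E)%E ->
  (wsum [set: X] (fun x => (cabs (T f x) ^+ 2)%R) <= (C * c)%:E)%E.
Proof. by case: HK => _ _ _ _; exact. Qed.

(** Testing the [L^2] bound on a point mass. *)
Lemma kernel_diag x : cabs (K x x) * w x <= C.
Proof.
have := w_ge0 x; rewrite le_eqVlt => /predU1P[<-|wx]; first by rewrite mulr0.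
have /kernel_L2 : (wsum [set: X]
    (fun y => (cabs (\1_[set x] y : R[i]) ^+ 2)%R) <= (w x)%:E)%E.
  rewrite -[w x]mul1r -(@wsum_set1 R X w w_ge0 x (fun=> 1))//.
  rewrite [leRHS]wsum_mkcond; apply: wsum_le => // y _ _.
  by rewrite cabs_indic indicE; case: (y \in _); rewrite ?mul1r ?expr1n ?expr0n /=.
have TE : T (\1_[set x]) x = K x x * (w x)%:C%C.
  rewrite /kop (@wint_set1 _ _ _ _ _ x); last first.
    move=> y yx; rewrite indicE; have -> : y \in [set x] = false.
      by apply/negP; rewrite inE.
    by rewrite mulr0.
  by rewrite indicE mem_set// mulr1.
move=> /(le_trans (@wsum_term _ _ w w_ge0 _ (fun y => cabs (T (\1_[set x]) y) ^+ 2) x I _)).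
rewrite TE lee_fin ler_pM2r// cabsM cabs_ge0_real//.
move=> /(_ (fun=> sqr_ge0 _)) H.
rewrite -(@ler_pXn2r _ 2)// ?nnegrE ?mulr_ge0// ?(le_trans H)//.
by rewrite expr2 ler_peMl// kernel_C1.
Qed.

(** The size condition at the last level where [x] and [y] share a block. *)
Lemma kernel_pointwise x y : cabs (K x y) * w y <= C.
Proof.
have [<-|/eqP xy] := eqVneq x y; first exact: kernel_diag.
have [k [xk nxk]] := block_separate HQ xy.
rewrite -lee_fin (le_trans _ (kernel_size k x))//.
exact: (wsum_term w_ge0 (h := fun z => cabs (K x z))).
Qed.

Lemma kernel_row k x :
  (wsum (~` Q k x) (fun y => cabs (K x y)) <= (C * k%:R)%:E)%E.
Proof.
elim: k => [|k IH].
  by rewrite (block0 HQ) setCT mulr0 /wsum esum_set0.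
rewrite -natr1 mulrDr mulr1.
apply: (wsum_cover w_ge0 _ _ IH (kernel_size k x)) => // y nxy.
by have [xy|nxy'] := pselect (Q k x y); [right|left].
Qed.

Lemma kernel_row_sble x : wsble (K x).
Proof.
have [n nx] := block_isolated HQ x; have := kernel_row n x.
rewrite nx// => H.
apply: (@wsbleW _ _ _ _ _ (C * n%:R + cabs (K x x) * w x)).
apply: (@wsum_cover _ _ _ w_ge0 _ _ [set x] _ _ _ _ _ H) => //; last by rewrite wsum_set1.
by move=> y _ /=; have [->|/eqP yx] := eqVneq y x; [right|left].
Qed.

Lemma kernel_mul_bounded_sble x f M : (forall y, 0 < w y -> cabs (f y) <= M) ->
  wsble (fun y => K x y * f y).
Proof.
move=> fM; have := kernel_row_sble x => Ks.
apply: (wsble_le w_ge0 _ (wsbleZ w_ge0 (`|M|%:C%C) Ks)) => y wy.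
rewrite [leRHS]cabsM cabs_real normr_id mulrC cabsM ler_wpM2r//.
exact: le_trans (fM y wy) (ler_norm _).
Qed.

Lemma kernel_mul_sble x f : 0 < w x -> wsble f -> wsble (fun y => K x y * f y).
Proof.
move=> wx fs; apply: (wsble_le w_ge0 _ (wsbleZ w_ge0 ((C / w x)%:C%C) fs)) => y wy.
rewrite [leRHS]cabsM cabs_ge0_real ?divr_ge0// cabsM ler_wpM2r//.
by rewrite ler_pdivlMr// kernel_sym kernel_pointwise.
Qed.

(** On a block of infinite mass the Hormander condition needs no cancellation:
    the rows of [K] are summable, so their averages over larger and larger
    finite parts of the block tend to [0]. *)
Lemma kernel_infinite_block k x : wsum (Q k x) (fun=> 1%R) = +oo%E ->
  (wsum (~` Q k x) (fun z => cabs (K z x)) <= C%:E)%E.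
Proof.
move=> Qoo; rewrite /wsum; apply: ge_ereal_sup => _ [F [finF FQ] <-].
rewrite fsbig_finite//= sumEFin lee_fin.
set s := finmap.enum_fset (fset_set F); set a := \sum_(z <- s) _.
pose r z := fine (wsum [set: X] (fun y => cabs (K z y))).
have rE z : wsum [set: X] (fun y => cabs (K z y)) = (r z)%:E.
  by rewrite fineK// ge0_fin_numE ?wsum_ge0//; exact: kernel_row_sble.
(* [D] bounds the sum of [|K z y| w z w y] over [z] in [F] and [y] in any part
   of the block, so it is negligible against the mass of a large part. *)
pose D := \sum_(z <- s) r z * w z.
have D0 : 0 <= D.
  by apply: sumr_ge0 => z _; rewrite mulr_ge0// fine_ge0// wsum_ge0.
have sQ z : z \in s -> (~` Q k x) z.
  by move=> zs; have : z \in fset_set F := zs; rewrite in_fset_set// inE => /FQ.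
have aC y : Q k x y -> a <= C + \sum_(z <- s) cabs (K z y) * w z.
  move=> xy; rewrite -lerBlDr -sumrB -lee_fin (le_trans _ (kernel_hormander xy))//.
  apply: esum_ge; exists F => //; rewrite fsbig_finite//= -sumEFin; apply: lee_sum => z _; rewrite lee_fin.
  rewrite -mulrBl ler_wpM2r// lerBlDr -[X in cabs X <= _](subrK (K z y)).
  exact: cabsD.
rewrite leNgt; apply/negP => Ca.
have aC0 : 0 < a - C by rewrite subr_gt0.
(* A finite part [G] of the block whose mass contradicts the bound [D]. *)
have : (((D + 1) / (a - C))%:E < wsum (Q k x) (fun=> 1%R))%E.
  by rewrite Qoo ltry.
move=> /ereal_sup_gt[_ [G [finG GQ] <-]].
rewrite fsbig_finite//= sumEFin lte_fin ltr_pdivrMr//.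
under eq_bigr do rewrite mul1r.
set t := finmap.enum_fset (fset_set G); apply/negP; rewrite -leNgt.
apply: (@le_trans _ _ D); last by rewrite lerDl.
have tQ y : y \in t -> Q k x y.
  by move=> yt; have : y \in fset_set G := yt; rewrite in_fset_set// inE => /GQ.
apply: (@le_trans _ _ (\sum_(y <- t) \sum_(z <- s) cabs (K z y) * w z * w y)).
  rewrite mulr_suml [leLHS]big_seq [leRHS]big_seq; apply: ler_sum => y yt.
  by rewrite mulrC -mulr_suml ler_wpM2r// lerBlDl aC//; exact: tQ.
rewrite exchange_big; apply: ler_sum => z _ /=.
under eq_bigr do rewrite mulrAC.
rewrite -mulr_suml ler_wpM2r// -lee_fin -rE.
apply: esum_ge; exists G => //; rewrite fsbig_finite//=.
by rewrite -sumEFin.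
Qed.

End KernelBounds.

(** * Means and local estimates *)

Definition mean {R : realType} {d} {X : measurableType d} (w : X -> R)
    (A : set X) (f : X -> R[i]) : R[i] :=
  ((mass w A)^-1)%:C%C * wint w (fun x => f x * \1_A x).

Section Means.
Context {R : realType} {d : measure_display} {X : measurableType d}.
Variable w : X -> R.
Hypothesis w_ge0 : forall x, 0 <= w x.
Implicit Types (A B : set X) (f g : X -> R[i]).
Local Notation wsum := (wsum w).
Local Notation mass := (mass w).
Local Notation wint := (wint w).
Local Notation wsble := (wsble w).
Local Notation mean := (mean w).

Lemma wsble_on A f (C : R) : (wsum A (fun x => cabs (f x)) <= C%:E)%E ->
  wsble (fun x => f x * \1_A x).
Proof.
rewrite wsum_mkcond => H; apply: (@wsbleW _ _ _ _ _ C).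
by under [X in wsum _ X]eq_fun do rewrite cabsM cabs_indic.
Qed.

Lemma wsble_on_bounded A f M : (wsum A (fun=> 1%R) < +oo)%E ->
  (forall x, A x -> 0 < w x -> cabs (f x) <= M) ->
  wsble (fun x => f x * \1_A x).
Proof.
move=> fA fM; apply: (@wsble_on _ _ (`|M| * mass A)).
rewrite -(wsum_cst w_ge0)//; apply: wsum_le => // x Ax wx.
by rewrite (le_trans (fM x Ax wx)) ?ler_norm.
Qed.

Lemma mean_infinite A f : wsum A (fun=> 1%R) = +oo%E -> mean A f = 0.
Proof. by move=> /mass_infty; rewrite /mean => ->; rewrite invr0 mul0r. Qed.

Lemma cabs_mean_le A f c : 0 <= c ->
  (wsum A (fun x => cabs (f x)) <= (c * mass A)%:E)%E -> cabs (mean A f) <= c.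
Proof.
move=> c0 H; rewrite cabsM cabs_ge0_real ?invr_ge0 ?mass_ge0//.
have H2 : cabs (wint (fun x => f x * \1_A x)) <= c * mass A.
  apply: (cabs_wint_le w_ge0 (A := A) _ _ H) => [x Ax|x _ _].
    by rewrite indic_out// mulr0.
  by rewrite cabsM cabs_indic ler_piMr// indicE; case: (_ \in _).
have := mass_ge0 w_ge0 A; rewrite le_eqVlt => /predU1P[m0|m0].
  by rewrite -m0 invr0 mul0r.
by rewrite mulrC ler_pdivrMr.
Qed.

Lemma meanD A f g : wsble (fun x => f x * \1_A x) -> wsble (fun x => g x * \1_A x) ->
  mean A (fun x => f x + g x) = mean A f + mean A g.
Proof.
move=> fs gs; rewrite /mean -mulrDr -wintD//.
by congr (_ * wint _); apply/funext => x; rewrite mulrDl.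
Qed.

Lemma meanN A f : wsble (fun x => f x * \1_A x) ->
  mean A (fun x => - f x) = - mean A f.
Proof.
move=> fs; rewrite /mean -mulrN -wintN//.
by congr (_ * wint _); apply/funext => x; rewrite mulNr.
Qed.

Lemma mean_cst A f c : (wsum A (fun=> 1%R) < +oo)%E -> 0 < mass A ->
  (forall x, A x -> 0 < w x -> f x = c) -> mean A f = c.
Proof.
move=> fA m0 fc; rewrite /mean.
have -> : wint (fun x => f x * \1_A x) = wint (fun x => c * \1_A x).
  apply: eq_wint => // x wx; rewrite indicE.
  by have [/set_mem Ax|_] := boolP (x \in A); rewrite ?mulr0// fc.
rewrite wintZ//; last first.
  have : wsble (fun x => 1 * \1_A x).
    by apply: (@wsble_on_bounded A (fun=> 1) 1) => // x _ _; rewrite cabs1.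
  by under eq_fun do rewrite mul1r.
rewrite (wint_indic w_ge0) mulrCA -rmorphM mulVf ?mulr1//.
by rewrite gt_eqF.
Qed.

(** Move the number inside the mean, where it averages to itself. *)
Lemma cabs_sub_mean A f a : (wsum A (fun=> 1%R) < +oo)%E -> 0 < mass A ->
  wsble (fun x => f x * \1_A x) ->
  ((cabs (a - mean A f)%R)%:E
    <= wsum A (fun x => ((mass A)^-1 * cabs (a - f x))%R))%E.
Proof.
move=> fA m0 fs.
have sa : wsble (fun x => a * \1_A x).
  by apply: (@wsble_on_bounded A (fun=> a) (cabs a)).
rewrite -{1}(@mean_cst A (fun=> a) a fA m0)// -meanN// -meanD//; last first.
  by under eq_fun do rewrite mulNr; exact: wsbleN.
have mV : 0 <= (mass A)^-1 by rewrite invr_ge0 ltW.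
rewrite /mean cabsM cabs_ge0_real// EFinM wsumZ//.
rewrite lee_pmul2l ?lte_fin ?invr_gt0//.
apply: (le_trans (cabs_wint w_ge0 _)).
rewrite [leRHS]wsum_mkcond; apply: wsum_le => // x _ _.
by rewrite cabsM cabs_indic.
Qed.

End Means.

Section LocalEstimates.
Context {R : realType} {d : measure_display} {X : measurableType d}.
Variables (w : X -> R) (Q : nat -> X -> set X) (K : X -> X -> R[i]) (C : R).
Hypothesis w_ge0 : forall x, 0 <= w x.
Hypothesis HQ : nested_partitions Q.
Hypothesis HK : dyadic_CZ_kernel w Q K C.
Implicit Types (A B : set X) (f g : X -> R[i]).
Local Notation wsum := (wsum w).
Local Notation mass := (mass w).
Local Notation wint := (wint w).
Local Notation wsble := (wsble w).
Local Notation mean := (mean w).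
Local Notation T := (kop w K).
Local Notation cut f A := (fun y => (f y * \1_A y)%R).
Let C1 : 1 <= C := kernel_C1 HK.
Let C0 : 0 < C := kernel_C0 HK.
Let C_ge0 : 0 <= C := kernel_C_ge0 HK.

(** The [L^2] bound, tested on a bounded function supported by a set of finite
    mass. *)
Lemma kop_local_L2 A f M : (wsum A (fun=> 1%R) < +oo)%E ->
  (forall x, A x -> 0 < w x -> cabs (f x) <= M) ->
  (wsum [set: X] (fun x => (cabs (T (cut f A) x) ^+ 2)%R)
    <= (C * (M ^+ 2 * mass A))%:E)%E.
Proof.
move=> fA fM; apply: (kernel_L2 HK).
rewrite -(wsum_cst w_ge0) ?sqr_ge0// [leRHS]wsum_mkcond.
apply: wsum_le => // x _ wx; rewrite cabsM cabs_indic exprMn indicE.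
have [/set_mem Ax|_] := boolP (x \in A); last by rewrite expr0n/= !mulr0.
rewrite expr1n !mulr1 lerXn2r// ?nnegrE//; last exact: fM.
exact: le_trans (fM x Ax wx).
Qed.

Lemma kop_local_L1 A f M : 0 < M -> (wsum A (fun=> 1%R) < +oo)%E ->
  (forall x, A x -> 0 < w x -> cabs (f x) <= M) ->
  (wsum A (fun x => cabs (T (cut f A) x)) <= (C * M * mass A)%:E)%E.
Proof.
move=> M0 fA fM; apply: wsum_cauchy_schwarz => //; rewrite ?mulr_gt0//.
  by rewrite massE.
apply: (le_trans (wsum_sub w_ge0 (@subsetT _ A) _)) => //.
apply: (le_trans (kop_local_L2 fA fM)); rewrite lee_fin exprMn mulrA.
rewrite ler_wpM2r ?mass_ge0// ler_wpM2r ?sqr_ge0//.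
by rewrite expr2 ler_peMl.
Qed.

Lemma cut_bounded A f M y : cabs (f y) <= M -> cabs (f y * \1_A y) <= M.
Proof.
move=> fM; rewrite cabsM cabs_indic indicE (le_trans _ fM)// ler_piMr//.
by case: (_ \in _).
Qed.

Lemma kop_split A f M x : (forall y, 0 < w y -> cabs (f y) <= M) ->
  T f x = T (cut f A) x + T (cut f (~` A)) x.
Proof.
move=> fM; have cutM B y : 0 < w y -> cabs (f y * \1_B y) <= M.
  by move=> wy; apply: cut_bounded; exact: fM.
rewrite /kop -wintD//; try by
  apply: (kernel_mul_bounded_sble w_ge0 HQ HK) => z; exact: cutM.
congr wint; apply/funext => z; rewrite -!mulrDr.
have [Az|nAz] := pselect (A z).
  by rewrite (indic_in Az) indic_out ?addr0 ?mulr1//; apply.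
by rewrite (indic_out nAz) indic_in// add0r mulr1.
Qed.

(** The part of [T f] coming from outside the block is bounded there by a
    constant that grows with the level: the size condition at each ancestor
    contributes once. *)
Lemma kop_block_summable k x f M : 0 < M -> (forall y, 0 < w y -> cabs (f y) <= M) ->
  (wsum (Q k x) (fun=> 1%R) < +oo)%E ->
  (wsum (Q k x) (fun y => cabs (T f y)) < +oo)%E.
Proof.
move=> M0 fM fQ; set B := Q k x in fQ *.
apply: (@le_lt_trans _ _ (C * M * mass B + M * (C * k%:R) * mass B)%:E); last exact: ltry.
apply: (@wsum_leD _ _ _ w_ge0 _ _ (fun y => cabs (T (cut f B) y))
  (fun=> M * (C * k%:R))) => //.
- by move=> y; rewrite !mulr_ge0// ltW.
- move=> y By _; rewrite (kop_split B y fM) (le_trans (cabsD _ _))// lerD2l.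
  apply: (@cabs_wint_le _ _ _ _ w_ge0 _ (~` B) (fun z => M * cabs (K y z))).
  + by move=> z nz; rewrite indic_out// !mulr0.
  + move=> z _ wz; rewrite cabsM mulrC ler_wpM2r//.
    by apply: cut_bounded; exact: fM.
  + apply: (@wsum_leZ _ _ _ w_ge0 _ _ (fun z => cabs (K y z))) => //; first exact: ltW.
    by rewrite /B -(block_eq HQ By); exact: (kernel_row w_ge0 HQ HK).
- by apply: (kop_local_L1 M0 fQ) => y _; exact: fM.
- by rewrite wsum_cst// !mulr_ge0// ltW.
Qed.

(** The size condition moves [T] from a block to its parent without any
    cancellation; outside the parent the mean over the parent supplies it. *)
Lemma kernel_atom k y : 0 < w y ->
  (wsum (~` Q k.+1 y) (fun x => cabs (K x y - mean (Q k y) (K x))%R)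
    <= (3 * C)%:E)%E.
Proof.
move=> wy; set P := Q k y.
have sz : (wsum (P `\` Q k.+1 y) (fun x => cabs (K x y)) <= C%:E)%E.
  apply: le_trans (kernel_size HK k y); apply: wsum_le => // x _ _.
  by rewrite (kernel_sym HK).
have cover : ~` Q k.+1 y `<=` (P `\` Q k.+1 y) `|` ~` P.
  by move=> x nx; have [Px|nPx] := pselect (P x); [left|right].
have [fP|Poo] := mass_dichotomy w P; last first.
  rewrite (_ : 3 * C = C + 2 * C); last by ring.
  apply: (wsum_cover w_ge0 cover) => //.
    by apply: wsum_le1 sz => // x _ _; rewrite mean_infinite// subr0.
  apply: (@wsum_le1 _ _ _ w_ge0 _ _ (fun x => cabs (K x y))).
    by move=> x _ _; rewrite mean_infinite// subr0.
  apply: le_trans (kernel_infinite_block w_ge0 HQ HK Poo) _.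
  by rewrite lee_fin; have := C0; lra.
have Py : P y by exact: block_self.
have m0 := mass_gt0 w_ge0 fP Py wy.
have mV : 0 <= (mass P)^-1 by rewrite invr_ge0 ltW.
rewrite (_ : 3 * C = (C + C) + C); last by ring.
apply: (wsum_cover w_ge0 cover) => //.
  apply: (@wsum_leD _ _ _ w_ge0 _ _ (fun x => cabs (K x y))
    (fun x => cabs (mean P (K x)))) => //; first by move=> x _ _; exact: cabsB.
  rewrite (_ : C = (mass P)^-1 * (C * 1 * mass P)); last first.
    by rewrite mulr1 mulrCA mulVf ?mulr1// gt_eqF.
  apply: (@wsum_leZ _ _ _ w_ge0 _ _
    (fun x => cabs (T (cut (fun=> 1%R) P) x))) => //.
    move=> x _ _; rewrite cabsM cabs_ge0_real//.
    suff -> : T (cut (fun=> 1%R) P) x = wint (fun z => K x z * \1_P z) by [].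
    by congr wint; apply/funext => z; rewrite mul1r.
  apply: (@le_trans _ _ (wsum P (fun x => cabs (T (cut (fun=> 1%R) P) x)))).
    by apply: wsum_sub => // x [].
  by apply: (@kop_local_L1 P (fun=> 1) 1) => // x _ _; rewrite cabs1.
apply: (@wsum_tonelli _ _ _ w_ge0 _ P _
  (fun x z => (mass P)^-1 * cabs (K x y - K x z)) (fun=> (mass P)^-1 * C)).
- by move=> x z; rewrite mulr_ge0.
- move=> x _ _; apply: cabs_sub_mean => //.
  exact: (wsble_indic w_ge0 _ (kernel_row_sble w_ge0 HQ HK x)).
- move=> z Pz _; apply: (@wsum_leZ _ _ _ w_ge0 _ _ (fun x => cabs (K x y - K x z))) => //.
  exact: (kernel_hormander HK).
- rewrite wsum_cst ?mulr_ge0// lee_fin mulrAC mulVf ?mul1r//.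
  by rewrite gt_eqF.
Qed.

(** Split [f] over the block [B], the gap [P] minus [B], and the complement of the
    parent [P].  The size condition bounds the image of the second part on [B];
    by the Hormander condition the image of the third has bounded variation over
    [P]; the mean over [P] of the image of the first two parts is bounded by
    [L^2] boundedness. *)
Lemma kop_oscillation k x f M : 0 < M -> (forall y, 0 < w y -> cabs (f y) <= M) ->
  0 < w x ->
  cabs (T f x - mean (Q k x) (T f)) <= cabs (T (cut f (Q k.+1 x)) x) + 3 * C * M.
Proof.
move=> M0 fM wx; set P := Q k x; set B := Q k.+1 x.
have M_ge0 := ltW M0.
have BP : B `<=` P by exact: block_sub.
pose S := P `\` B; pose O := ~` P.
have cutM A y : 0 < w y -> cabs (f y * \1_A y) <= M.
  by move=> wy; apply: cut_bounded; exact: fM.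
have sK A z : wsble (fun y => K z y * (f y * \1_A y)).
  by apply: (kernel_mul_bounded_sble w_ge0 HQ HK) => y; exact: cutM.
have TP z : T f z = T (cut f P) z + T (cut f O) z by exact: kop_split fM.
have TB z : T (cut f P) z = T (cut f B) z + T (cut f S) z.
  rewrite /kop -wintD//; congr wint; apply/funext => y.
  rewrite -mulrDr -mulrDr; congr (_ * (_ * _)).
  have [By|nBy] := pselect (B y).
    by rewrite (indic_in By) (indic_in (BP _ By)) indic_out ?addr0// => -[].
  rewrite (indic_out nBy) add0r; have [Py|nPy] := pselect (P y).
    by rewrite !indic_in.
  by rewrite !indic_out// => -[].
have TS : cabs (T (cut f S) x) <= C * M.
  apply: (@cabs_wint_le _ _ _ _ w_ge0 _ S (fun y => M * cabs (K x y))).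
  - by move=> y nSy; rewrite indic_out// !mulr0.
  - by move=> y Sy wy; rewrite cabsM mulrC ler_wpM2r// cutM.
  - rewrite mulrC; apply: (@wsum_leZ _ _ _ w_ge0 _ _ (fun y => cabs (K x y))) => //.
    exact: (kernel_size HK k x).
have TO z : P z -> cabs (T (cut f O) x - T (cut f O) z) <= C * M.
  move=> Pz; rewrite /kop -wintB//.
  apply: (@cabs_wint_le _ _ _ _ w_ge0 _ O (fun y => M * cabs (K y x - K y z))).
  - by move=> y nOy; rewrite indic_out// !mulr0 subr0.
  - move=> y Oy wy; rewrite -mulrBl cabsM mulrC.
    by rewrite !(kernel_sym HK _ y) ler_wpM2r// cutM.
  - rewrite mulrC; apply: (@wsum_leZ _ _ _ w_ge0 _ _ (fun y => cabs (K y x - K y z))) => //.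
    exact: (kernel_hormander HK).
have [fP|Poo] := mass_dichotomy w P; last first.
  rewrite mean_infinite// subr0 TP TB -addrA (le_trans (cabsD _ _))// lerD2l.
  rewrite (le_trans (cabsD _ _))// (_ : 3 * C * M = C * M + 2 * (C * M)); last by ring.
  rewrite lerD// (@le_trans _ _ (C * M))//; last first.
    by rewrite ler_peMl ?mulr_ge0// ler1n.
  apply: (@cabs_wint_le _ _ _ _ w_ge0 _ O (fun y => M * cabs (K y x))).
  - by move=> y nOy; rewrite indic_out// !mulr0.
  - by move=> y Oy wy; rewrite cabsM mulrC (kernel_sym HK) ler_wpM2r// cutM.
  - rewrite mulrC; apply: (@wsum_leZ _ _ _ w_ge0 _ _ (fun y => cabs (K y x))) => //.
    exact: (kernel_infinite_block w_ge0 HQ HK Poo).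
have m0 : 0 < mass P by exact: (mass_gt0 w_ge0 fP (block_self HQ k x)).
have mV : 0 <= (mass P)^-1 by rewrite invr_ge0 ltW.
have LP := kop_local_L1 M0 fP (fun y _ => fM y).
have sP : wsble (cut (T (cut f P)) P) by exact: wsble_on LP.
have sO : wsble (cut (T (cut f O)) P).
  apply: (@wsble_on_bounded _ _ _ _ w_ge0 _ _ (cabs (T (cut f O) x) + C * M)) => //.
  move=> z Pz _; rewrite -[X in cabs X](subrK (T (cut f O) x)).
  rewrite (le_trans (cabsD _ _))// addrC lerD2l cabs_distC; exact: TO.
have -> : mean P (T f) = mean P (T (cut f P)) + mean P (T (cut f O)).
  by rewrite -meanD//; congr mean; apply/funext => z; exact: TP.
have MP : cabs (mean P (T (cut f P))) <= C * M.
  by apply: (cabs_mean_le w_ge0 _ LP); rewrite mulr_ge0.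
have MO : cabs (T (cut f O) x - mean P (T (cut f O))) <= C * M.
  rewrite -lee_fin (le_trans (cabs_sub_mean w_ge0 _ fP m0 sO))//.
  rewrite (_ : C * M = (mass P)^-1 * (C * M) * mass P); last first.
    by rewrite mulrAC mulVf ?mul1r// gt_eqF.
  rewrite -wsum_cst ?mulr_ge0//; apply: wsum_le => // z Pz _.
  by rewrite ler_wpM2l// TO.
rewrite TP TB.
set a := T _ x; set b := T _ x; set c := T _ x in MO *; set u := mean _ _ in MP *.
set v := mean _ _ in MO *.
have -> : a + b + c - (u + v) = a + (b + ((- u) + (c - v))) by ring.
rewrite (le_trans (cabsD _ _))// lerD2l (le_trans (cabsD _ _))//.
rewrite (_ : 3 * C * M = C * M + (C * M + C * M)); last by ring.
by rewrite lerD// (le_trans (cabsD _ _))// lerD// cabsN.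
Qed.

(** Averaging the oscillation in [L^2] costs nothing more than in [L^1], and is
    the form that the duality with [H^1] consumes. *)
Lemma kop_BMO2 k x f M : 0 < M -> (forall y, 0 < w y -> cabs (f y) <= M) ->
  (wsum (Q k.+1 x) (fun=> 1%R) < +oo)%E ->
  (wsum (Q k.+1 x) (fun y => (cabs (T f y - mean (Q k y) (T f)) ^+ 2)%R)
    <= (20 * C ^+ 2 * M ^+ 2 * mass (Q k.+1 x))%:E)%E.
Proof.
move=> M0 fM; set B := Q k.+1 x => fB.
have -> : 20 * C ^+ 2 * M ^+ 2 * mass B =
  2 * (C ^+ 2 * (M ^+ 2 * mass B)) + 2 * (3 * C * M) ^+ 2 * mass B by ring.
apply: (@wsum_leD _ _ _ w_ge0 _ _ (fun y => 2 * cabs (T (cut f B) y) ^+ 2)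
   (fun=> 2 * (3 * C * M) ^+ 2)).
- by move=> y; rewrite mulr_ge0.
- by move=> y; rewrite mulr_ge0// sqr_ge0.
- move=> y By wy.
  have := kop_oscillation k M0 fM wy; rewrite (block_eq HQ By).
  set a := cabs _; set b := cabs _ => ab.
  have a0 : 0 <= a by exact: cabs_ge0.
  have b0 : 0 <= b by exact: cabs_ge0.
  have ab2 : a ^+ 2 <= (b + 3 * C * M) ^+ 2.
    by apply: lerXn2r; rewrite ?nnegrE// (le_trans a0).
  rewrite (le_trans ab2)//.
  rewrite -subr_ge0 (_ : _ - _ = (b - 3 * C * M) ^+ 2) ?sqr_ge0//; ring.
- apply: (@wsum_leZ _ _ _ w_ge0 _ _ (fun y => cabs (T (cut f B) y) ^+ 2)) => //.
  apply: (le_trans (wsum_sub w_ge0 (@subsetT _ B) _)) => //.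
  apply: (le_trans (kop_local_L2 fB (fun y _ => fM y))); rewrite lee_fin.
  have Mm : 0 <= M ^+ 2 * mass B by rewrite mulr_ge0 ?sqr_ge0// mass_ge0.
  by rewrite (ler_wpM2r Mm)// expr2 ler_peMl.
- by rewrite wsum_cst// mulr_ge0// sqr_ge0.
Qed.

Lemma kop_mean0 x f M : 0 < M -> (forall y, 0 < w y -> cabs (f y) <= M) ->
  cabs (mean (Q 0 x) (T f)) <= C * M.
Proof.
move=> M0 fM; rewrite (block0 HQ).
have CM : 0 <= C * M by rewrite mulr_ge0// ltW.
have [fX|Xoo] := mass_dichotomy w [set: X]; last by rewrite mean_infinite// cabs0.
apply: (cabs_mean_le w_ge0 CM).
have := kop_local_L1 M0 fX (fun y _ => fM y).
suff -> : cut f [set: X] = f by [].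
by apply/funext => y; rewrite indic_in// mulr1.
Qed.

End LocalEstimates.

(** * Weak type (1, 1) *)

(** Comparability puts at least one of the pairs [(i, j)] and [(j, i)] into the
    restricted sum, and both contribute the same product. *)
Lemma esum_square_comparable {R : realType} {I : choiceType} (b : I -> R)
    (S : I -> set I) : (forall i, 0 <= b i) ->
  (forall i j, b i != 0 -> b j != 0 -> S i j \/ S j i) ->
  (\esum_(i in [set: I]) \esum_(j in [set: I]) (b i * b j)%:E <=
   \esum_(i in [set: I]) (2%:E * \esum_(j in S i) (b i * b j)%:E))%E.
Proof.
move=> b0 bS.
pose D i j := (b i * b j * \1_(S i) j)%:E : \bar R.
have D0 i j : (0 <= D i j)%E by rewrite lee_fin !mulr_ge0// indicE.
have DE i : (\esum_(j in S i) (b i * b j)%:E = \esum_(j in [set: I]) D i j)%E.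
  rewrite esum_mkcond; apply: eq_esum => j _; rewrite /D indicE.
  by case: ifP => _; rewrite ?mulr1// mulr0.
have s0 i : (0 <= \esum_(j in [set: I]) D i j)%E by apply: esum_ge0.
apply: (@le_trans _ _ (\esum_(i in [set: I]) \esum_(j in [set: I]) (D i j + D j i)%E)%E).
  apply: le_esum => i _; apply: le_esum => j _.
  rewrite /D -EFinD lee_fin [b j * b i]mulrC -mulrDr.
  have [->|bi] := eqVneq (b i) 0; first by rewrite !mul0r.
  have [->|bj] := eqVneq (b j) 0; first by rewrite mulr0 !mul0r.
  rewrite ler_peMr ?mulr_ge0//.
  by case: (bS i j bi bj) => Sij; rewrite (indic_in Sij) ?lerDl ?lerDr indicE.
under eq_esum do rewrite esumD//.
rewrite esumD//; last by move=> i _; exact: esum_ge0.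
rewrite [X in (_ + X)%E]esum_exchange//.
under [leRHS]eq_esum do rewrite DE.
by rewrite esum_pZl// mule_natl mule2n.
Qed.

Section WeakType.
Context {R : realType} {d : measure_display} {X : measurableType d}.
Variables (w : X -> R) (Q : nat -> X -> set X) (K : X -> X -> R[i]) (C : R).
Hypothesis w_ge0 : forall x, 0 <= w x.
Hypothesis HQ : nested_partitions Q.
Hypothesis HK : dyadic_CZ_kernel w Q K C.
Implicit Types (A B : set X) (f g : X -> R[i]).
Local Notation wsum := (wsum w).
Local Notation mass := (mass w).
Local Notation wint := (wint w).
Local Notation wsble := (wsble w).
Local Notation mean := (mean w).
Local Notation T := (kop w K).
Let C1 : 1 <= C := kernel_C1 HK.
Let C0 : 0 < C := kernel_C0 HK.
Let C_ge0 : 0 <= C := kernel_C_ge0 HK.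

Section StoppingTime.
Variables (f : X -> R[i]) (N lam : R).
Hypothesis fN : (wsum [set: X] (fun x => cabs (f x)) <= N%:E)%E.
Hypothesis lam0 : 0 < lam.
Let lam_ge0 : 0 <= lam := ltW lam0.

(** An average of at most [lam], written without division: null blocks are then
    light, and so are blocks of infinite mass. *)
Definition light k x : Prop :=
  (wsum (Q k x) (fun y => cabs (f y)) <= lam%:E * wsum (Q k x) (fun=> 1%R))%E.

Hypothesis light0 : forall x, light 0 x.

Definition heavy_set : set X := [set x | exists k, ~ light k x].

(** The first heavy block around a point of [heavy_set] has level [stop x + 1];
    the blocks of level up to [stop x], its parent included, are light.  The
    offset keeps the parent at hand, and is legitimate because the block of
    level [0] is light. *)
Definition stop (x : X) : nat :=
  xget 0%N [set k | ~ light k.+1 x /\ forall j, (j <= k)%N -> light j x].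

Local Notation Om := heavy_set.
Local Notation P := (fun y => Q (stop y) y).

Lemma stopP x : Om x ->
  ~ light (stop x).+1 x /\ forall j, (j <= stop x)%N -> light j x.
Proof.
move=> [k0 k0P].
have ex : exists k, `[< ~ light k x >] by exists k0; apply/asboolP.
case: (ex_minnP ex) => -[|k] /asboolP nk kmin; first by have := light0 x.
rewrite /stop; case: xgetP => [_ _ //|/(_ k)/=]; case; split=> // j jk.
by apply: contrapT => /asboolP/kmin; rewrite leqNgt ltnS jk.
Qed.

(** First heavy blocks are equal or disjoint: inside such a block the stopping
    level is constant. *)
Lemma stop_eq x y : Om x -> Q (stop x).+1 x y -> Om y /\ stop y = stop x.
Proof.
move=> Ox xy; have [nx lx] := stopP Ox.
have lE j : (j <= (stop x).+1)%N -> light j y = light j x.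
  by move=> jk; rewrite /light (block_eq HQ (block_sub HQ jk xy)).
have Oy : Om y by exists (stop x).+1; rewrite lE.
split=> //; have [ny ly] := stopP Oy.
apply/eqP; rewrite eqn_leq; apply/andP; split; rewrite leqNgt; apply/negP => h.
  by apply: nx; rewrite -lE//; exact: ly.
by apply: ny; rewrite lE 1?ltnW//; exact: lx.
Qed.

Lemma heavy_set_mass : (wsum Om (fun=> 1%R) <= (N / lam)%:E)%E.
Proof.
have lV : 0 <= lam^-1 by rewrite invr_ge0.
apply: (@le_trans _ _ (wsum Om (fun x => lam^-1 * cabs (f x)))); last first.
  rewrite mulrC; apply: (@wsum_leZ _ _ _ w_ge0 _ _ (fun x => cabs (f x))) => //.
  by apply: le_trans fN; apply: wsum_sub.
apply: (@wsum_blocks _ _ _ w_ge0 Om (fun x => Q (stop x).+1 x)) => //.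
- by move=> x Ox y /(stop_eq Ox)[].
- by move=> x _; exact: block_self.
- by move=> x y Ox xy; have [_ ->] := stop_eq Ox xy; exact: (block_eq HQ).
- by move=> x; rewrite mulr_ge0.
- move=> x /stopP[/negP nl _] _.
  by rewrite wsumZ// lee_pdivlMl// ltW// ltNge.
Qed.

Lemma light_outside x : ~ Om x -> 0 < w x -> cabs (f x) <= lam.
Proof.
move=> nO wx; have [n nx] := block_isolated HQ x.
have : light n x by apply: contrapT => nl; apply: nO; exists n.
rewrite /light nx// !wsum_set1// mul1r -EFinM lee_fin.
by rewrite ler_pM2r.
Qed.

(** The modulus of what [y] contributes to [spread z] below, kept real and
    nonnegative so that sums over pairs of points can be exchanged freely. *)
Let b y z := cabs (f y) * \1_Om y * (mass (P y))^-1 * \1_(P y) z.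

Let b_ge0 y z : 0 <= b y z.
Proof. by rewrite /b !mulr_ge0// ?invr_ge0 ?mass_ge0// indicE. Qed.

Let indicR_le1 A x : \1_A x <= 1 :> R.
Proof. by rewrite indicE; case: (_ \in _). Qed.

Let indicR_ge0 A x : 0 <= \1_A x :> R.
Proof. by rewrite indicE. Qed.

Let b_mass y : (wsum [set: X] (b y) <= (cabs (f y))%:E)%E.
Proof.
rewrite -[cabs (f y)]mulr1.
apply: (@wsum_leZ _ _ _ w_ge0 _ _ (fun z => (mass (P y))^-1 * \1_(P y) z)) => //.
- by move=> z; rewrite mulr_ge0// invr_ge0 mass_ge0.
- move=> z _ _; rewrite /b -!mulrA ler_wpM2l// ler_piMl//.
  by rewrite mulr_ge0// invr_ge0 mass_ge0.
- by rewrite -(wsum_mkcond _ _ (fun=> (mass (P y))^-1)) wsum_avg1.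
Qed.

Let b_le y z : 0 < w z -> b y z <= (w z)^-1 * cabs (f y).
Proof.
move=> wz; rewrite /b -!mulrA [leRHS]mulrC ler_wpM2l//.
have [Pz|nPz] := pselect (P y z); last first.
  by rewrite (indic_out nPz) !mulr0 invr_ge0 ltW.
rewrite (indic_in Pz) mulr1 (@le_trans _ _ (mass (P y))^-1)//.
  by rewrite ler_piMl// invr_ge0 mass_ge0.
have [fP|Poo] := mass_dichotomy w (P y); last first.
  by rewrite mass_infty// invr0 invr_ge0 ltW.
rewrite lef_pV2 ?posrE//; last exact: (mass_gt0 w_ge0 fP Pz).
by rewrite -lee_fin -massE// -[w z]mul1r; exact: (wsum_term w_ge0 (h := fun=> 1)).
Qed.

(** What replaces [f] on [heavy_set]: each point mass becomes a uniform density
    on the parent of the first heavy block around it. *)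
Let spread z := wint (fun y => f y * \1_Om y * ((mass (P y))^-1)%:C%C * \1_(P y) z).

Let cabs_b y z :
  cabs (f y * \1_Om y * ((mass (P y))^-1)%:C%C * \1_(P y) z) = b y z.
Proof. by rewrite !cabsM !cabs_indic cabs_ge0_real// invr_ge0 mass_ge0. Qed.

Let fs : wsble f := wsbleW fN.

Let b_sble z : 0 < w z ->
  wsble (fun y => f y * \1_Om y * ((mass (P y))^-1)%:C%C * \1_(P y) z).
Proof.
move=> wz; have wV : 0 <= (w z)^-1 by rewrite invr_ge0 ltW.
apply: (wsble_le w_ge0 _ (wsbleZ w_ge0 ((w z)^-1)%:C%C fs)) => y wy.
by rewrite cabs_b [leRHS]cabsM cabs_ge0_real// b_le.
Qed.

Let spread_le z : ((cabs (spread z))%:E <= wsum [set: X] (b ^~ z))%E.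
Proof.
apply: (le_trans (cabs_wint w_ge0 _)); apply: wsum_le => // y _ _.
by rewrite cabs_b.
Qed.

Let spread_sble : wsble spread.
Proof.
apply: (@wsbleW _ _ _ _ _ N).
apply: (@wsum_tonelli _ _ _ w_ge0 _ [set: X] _ (fun z y => b y z)
  (fun y => cabs (f y))) => //.
Qed.

(** Expanding the square gives pairs of parent blocks that meet, hence are
    nested.  Keeping the pairs with [P y'] inside [P y], the inner sum is at
    most the sum of [|f|] over the light block [P y], that is [lam] times its
    mass, and the mass cancels the normalization of the outer term. *)
Let spread_L2 : (wsum [set: X] (fun z => (cabs (spread z) ^+ 2)%R)
  <= (2 * (lam * N))%:E)%E.
Proof.
pose S y : set X := [set y' | P y' `<=` P y].
pose s y z := fine (wsum (S y) (b ^~ z)).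
have s_ge0 y z : 0 <= s y z by apply: fine_ge0; apply: wsum_ge0.
have bfin z : 0 < w z -> wsum [set: X] (b ^~ z) \is a fin_num.
  move=> wz; rewrite ge0_fin_numE ?wsum_ge0//.
  have := b_sble wz; rewrite /wsble.
  by under [X in wsum _ X]eq_fun do rewrite cabs_b.
have sE y z : 0 < w z -> (s y z)%:E = wsum (S y) (b ^~ z).
  move=> wz; rewrite fineK// ge0_fin_numE ?wsum_ge0//.
  apply: (@le_lt_trans _ _ (wsum [set: X] (b ^~ z))); first exact: wsum_sub.
  by rewrite -ge0_fin_numE ?wsum_ge0// bfin.
apply: (@wsum_tonelli _ _ _ w_ge0 _ [set: X] _ (fun z y => 2 * (b y z * s y z))
  (fun y => 2 * (lam * cabs (f y)))).
- by move=> z y; apply: mulr_ge0 => //; exact: mulr_ge0.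
- move=> z _ wz; set g := fine (wsum [set: X] (b ^~ z)).
  have gE : wsum [set: X] (b ^~ z) = g%:E by rewrite fineK// bfin.
  have spg : cabs (spread z) <= g by rewrite -lee_fin -gE spread_le.
  have g0 : 0 <= g by apply: fine_ge0; apply: wsum_ge0.
  apply: (@le_trans _ _ (g ^+ 2)%:E).
    by rewrite lee_fin lerXn2r// nnegrE.
  pose u y := b y z * w y.
  have u0 y : 0 <= u y by rewrite mulr_ge0.
  have uE : (\esum_(y in [set: X]) (u y)%:E = g%:E)%E by exact: gE.
  have uSE y : (\esum_(y' in S y) (u y')%:E = (s y z)%:E)%E by rewrite sE.
  have -> : (g ^+ 2)%:E =
      (\esum_(y in [set: X]) \esum_(y' in [set: X]) (u y * u y')%:E)%E.
    under eq_esum do under eq_esum do rewrite EFinM.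
    under eq_esum => y _.
      rewrite esum_pZl//.
      rewrite uE muleC; over.
    rewrite /= esum_pZl//.
    by rewrite uE expr2 EFinM.
  apply: (le_trans (esum_square_comparable u0 (S := S) _)) => [y y'|].
    rewrite /u !mulf_eq0 !negb_or => /andP[/andP[_ Py] _] /andP[/andP[_ Py'] _].
    have {}Py : P y z by apply: contrapT => n; move: Py; rewrite indic_out ?eqxx.
    have {}Py' : P y' z by apply: contrapT => n; move: Py'; rewrite indic_out ?eqxx.
    have [le|/ltnW le] := leqP (stop y) (stop y').
      by left; exact: block_meet le Py Py'.
    by right; exact: block_meet le Py' Py.
  apply: le_esum => y _.
  under eq_esum do rewrite EFinM.
  rewrite esum_pZl//.
  rewrite uSE -!EFinM lee_fin.
  by rewrite /u mulrA le_eqVlt; apply/orP; left; apply/eqP; ring.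
- move=> y _ wy.
  have [fP|Poo] := mass_dichotomy w (P y); last first.
    rewrite (@le_trans _ _ 0%:E)//; last by rewrite lee_fin !mulr_ge0.
    rewrite /wsum esum1// => z _.
    by rewrite /b (mass_infty Poo) invr0 mulr0 !mul0r mulr0 mul0r.
  apply: (@wsum_leZ _ _ _ w_ge0 _ _ (fun z => b y z * s y z)) => //.
    by move=> z; exact: mulr_ge0.
  have [Oy|nOy] := pselect (Om y); last first.
    rewrite (@le_trans _ _ 0%:E)//; last by rewrite lee_fin mulr_ge0.
    rewrite /wsum esum1// => z _.
    by rewrite /b indic_out// mulr0 !mul0r.
  have m0 : 0 < mass (P y) by exact: (mass_gt0 w_ge0 fP (block_self HQ _ y)).
  rewrite (_ : lam * cabs (f y) =
    cabs (f y) * (mass (P y))^-1 * (lam * mass (P y))); last first.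
    by field; rewrite gt_eqF.
  apply: (@wsum_leZ _ _ _ w_ge0 _ _ (fun z => s y z)) => //.
  + by rewrite mulr_ge0// invr_ge0 ltW.
  + move=> z _ _; rewrite /b indic_in// mulr1 -mulrA ler_wpM2l//.
      by rewrite mulr_ge0// invr_ge0 ltW.
    by rewrite ler_piMl.
  + apply: (@wsum_tonelli _ _ _ w_ge0 _ (S y) _ (fun z y' => b y' z)
      (fun y' => cabs (f y'))) => //.
    * by move=> z _ wz; rewrite sE.
    * apply: (@le_trans _ _ (wsum (P y) (fun y' => cabs (f y')))).
        by apply: wsum_sub => // y'; apply; exact: block_self.
      by have [_ /(_ _ (leqnn _))] := stopP Oy; rewrite /light massE// -EFinM.
- apply: (@wsum_leZ _ _ _ w_ge0 _ _ (fun y => lam * cabs (f y))) => //.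
    by move=> y; rewrite mulr_ge0.
  exact: (@wsum_leZ _ _ _ w_ge0 _ _ (fun y => cabs (f y))).
Qed.

Definition good_part x := f x * \1_(~` Om) x + spread x.

Definition bad_part x := wint (fun y => f y * \1_Om y * (K x y - mean (P y) (K x))).

Lemma good_L2 :
  (wsum [set: X] (fun x => (cabs (good_part x) ^+ 2)%R) <= (6 * (lam * N))%:E)%E.
Proof.
rewrite (_ : 6 * (lam * N) = 2 * (lam * N) + 2 * (2 * (lam * N))); last by ring.
apply: (@wsum_leD _ _ _ w_ge0 _ _ (fun x => 2 * cabs (f x * \1_(~` Om) x) ^+ 2)
  (fun x => 2 * cabs (spread x) ^+ 2)).
- by move=> x; rewrite mulr_ge0.
- by move=> x; rewrite mulr_ge0.
- move=> x _ _; set a := f x * _; set c := spread x.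
  apply: (@le_trans _ _ ((cabs a + cabs c) ^+ 2)).
    by rewrite lerXn2r ?nnegrE ?addr_ge0//; exact: cabsD.
  rewrite -subr_ge0 (_ : _ - _ = (cabs a - cabs c) ^+ 2) ?sqr_ge0//; ring.
- apply: (@wsum_leZ _ _ _ w_ge0 _ _ (fun x => cabs (f x * \1_(~` Om) x) ^+ 2)) => //.
  apply: (@wsum_leZ _ _ _ w_ge0 _ _ (fun x => cabs (f x))) => // x _ wx.
  have [Ox|nOx] := pselect (Om x).
    by rewrite indic_out ?mulr0 ?cabs0 ?expr0n ?mulr_ge0//; apply.
  by rewrite indic_in// mulr1 expr2 ler_wpM2r// light_outside.
- exact: (@wsum_leZ _ _ _ w_ge0 _ _ (fun x => cabs (spread x) ^+ 2)).
Qed.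

(** Each point mass minus its spread copy is an atom in the sense of
    [kernel_atom], and a point outside [heavy_set] lies outside all the heavy
    blocks at once. *)
Lemma bad_L1 : (wsum (~` Om) (fun x => cabs (bad_part x)) <= (3 * C * N)%:E)%E.
Proof.
have C3 : 0 <= 3 * C by rewrite mulr_ge0.
apply: (@wsum_tonelli _ _ _ w_ge0 _ [set: X] _
  (fun x y => cabs (f y * \1_Om y * (K x y - mean (P y) (K x))))
  (fun y => 3 * C * cabs (f y))) => //.
- by move=> x _ _; exact: cabs_wint.
- move=> y _ wy; have [Oy|nOy] := pselect (Om y); last first.
    rewrite (@le_trans _ _ 0%:E)//; last by rewrite lee_fin mulr_ge0.
    by rewrite /wsum esum1// => x _; rewrite indic_out// mulr0 !mul0r cabs0 mul0r.
  rewrite [3 * C * _]mulrC; apply: (@wsum_leZ _ _ _ w_ge0 _ _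
      (fun x => cabs (K x y - mean (P y) (K x)))) => //.
    by move=> x _ _; rewrite indic_in// mulr1 cabsM.
  apply: le_trans (kernel_atom w_ge0 HQ HK (stop y) wy).
  apply: wsum_sub => // x nOx xy; apply: nOx.
  by have [] := stop_eq Oy xy.
- exact: (@wsum_leZ _ _ _ w_ge0 _ _ (fun y => cabs (f y))).
Qed.

Lemma kop_good_bad x : 0 < w x -> T f x = T good_part x + bad_part x.
Proof.
move=> wx; have Ks := kernel_row_sble w_ge0 HQ HK x.
have M0 : 0 <= C / w x by rewrite divr_ge0.
have KM z : cabs (K x z) <= C / w x.
  by rewrite ler_pdivlMr// (kernel_sym HK) (kernel_pointwise w_ge0 HQ HK).
have sOm : wsble (fun y => f y * \1_Om y) by exact: wsble_indic.
have sOmC : wsble (fun y => f y * \1_(~` Om) y) by exact: wsble_indic.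
have meanM y : cabs (mean (P y) (K x)) <= C / w x.
  have [fP|Poo] := mass_dichotomy w (P y); last by rewrite mean_infinite// cabs0.
  apply: cabs_mean_le => //; rewrite -wsum_cst//.
  exact: wsum_le.
have smean : wsble (fun y => f y * \1_Om y * mean (P y) (K x)).
  apply: (wsble_le w_ge0 _ (wsbleZ w_ge0 (C / w x)%:C%C sOm)) => y wy.
  by rewrite cabsM [leRHS]cabsM cabs_ge0_real// mulrC ler_wpM2r.
have swap : wint (fun y => f y * \1_Om y * mean (P y) (K x)) = T spread x.
  (* The double sum converges because row [x] of [K] is bounded by [C / w x]. *)
  pose F y z := f y * \1_Om y * ((mass (P y))^-1)%:C%C * (K x z * \1_(P y) z).
  transitivity (wint (fun y => wint (F y))).
    apply: eq_wint => // y wy; rewrite wintZ ?mulrA//; exact: wsble_indic.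
  rewrite (@wint_exchange _ _ _ _ w_ge0 _ (fun y => C / w x * cabs (f y))
    (C / w x * N)).
  - apply: eq_wint => // z wz; rewrite -wintZ//; last exact: b_sble.
    by congr wint; apply/funext => y; rewrite /F; ring.
  - move=> y wy; apply: (@wsum_leZ _ _ _ w_ge0 _ _ (b y)) => // z _ wz.
    rewrite /F (_ : _ * _ = K x z *
      (f y * \1_Om y * ((mass (P y))^-1)%:C%C * \1_(P y) z)); last by ring.
    by rewrite cabsM cabs_b ler_wpM2r.
  - exact: (@wsum_leZ _ _ _ w_ge0 _ _ (fun y => cabs (f y))).
have -> : bad_part x = wint (fun y => K x y * (f y * \1_Om y)) - T spread x.
  rewrite -swap -wintB//.
    by congr wint; apply/funext => y; rewrite mulrBr [K x y * _]mulrC.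
  exact: (kernel_mul_sble w_ge0 HQ HK).
have -> : T good_part x = wint (fun y => K x y * (f y * \1_(~` Om) y)) + T spread x.
  rewrite -wintD//; try exact: (kernel_mul_sble w_ge0 HQ HK).
  by congr wint; apply/funext => y; rewrite mulrDr.
rewrite addrACA subrr addr0 -wintD//; try exact: (kernel_mul_sble w_ge0 HQ HK).
congr wint; apply/funext => y; rewrite -mulrDr -mulrDr.
have [Oy|nOy] := pselect (Om y).
  by rewrite (indic_in Oy) indic_out ?add0r ?mulr1//; apply.
by rewrite (indic_out nOy) indic_in// addr0 mulr1.
Qed.

Lemma weak11_light :
  (wsum [set x | (lam < cabs (T f x))%R] (fun=> 1%R) <= (31 * C * N / lam)%:E)%E.
Proof.
have N0 : 0 <= N by rewrite -lee_fin (le_trans _ fN)// wsum_ge0.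
set A := [set x | _].
rewrite (@le_trans _ _ (N / lam + (4 / lam ^+ 2 * (C * (6 * (lam * N))) +
    2 / lam * (3 * C * N)))%:E)//; last first.
  rewrite lee_fin -subr_ge0 (_ : _ - _ = (C - 1) * (N / lam)).
    by rewrite mulr_ge0 ?subr_ge0// divr_ge0.
  by field; rewrite gt_eqF.
apply: (@wsum_cover _ _ _ w_ge0 _ Om (A `\` Om)) => //.
- by move=> x Ax; have [|] := pselect (Om x); [left|right].
- exact: heavy_set_mass.
(* One of the two parts exceeds [lam / 2]: Chebyshev in [L^2] for the good one,
   in [L^1] for the bad one. *)
apply: (@wsum_leD _ _ _ w_ge0 _ _ (fun x => 4 / lam ^+ 2 * cabs (T good_part x) ^+ 2)
  (fun x => 2 / lam * cabs (bad_part x))).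
- by move=> x; apply: mulr_ge0 => //; rewrite divr_ge0// sqr_ge0.
- by move=> x; rewrite mulr_ge0// divr_ge0.
- move=> x [lT nO] wx; have : lam < cabs (T f x) := lT; rewrite kop_good_bad//.
  move=> /lt_le_trans/(_ (cabsD _ _)).
  set p := cabs _; set q := cabs _ => lpq.
  have p0 : 0 <= p by exact: cabs_ge0.
  have q0 : 0 <= q by exact: cabs_ge0.
  rewrite (_ : 4 / lam ^+ 2 * p ^+ 2 + 2 / lam * q =
     (2 * p / lam) ^+ 2 + 2 * q / lam); last by field; rewrite gt_eqF.
  have : 1 <= 2 * p / lam \/ 1 <= 2 * q / lam.
    rewrite !ler_pdivlMr// !mul1r.
    by have [?|?] := leP lam (2 * p); [left|right; lra].
  have q1 : 0 <= 2 * q / lam by rewrite divr_ge0// mulr_ge0.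
  by move=> []; [nra|have := sqr_ge0 (2 * p / lam); lra].
- apply: (@wsum_leZ _ _ _ w_ge0 _ _ (fun x => cabs (T good_part x) ^+ 2)) => //.
    by rewrite divr_ge0// sqr_ge0.
  apply: (le_trans (wsum_sub w_ge0 (@subsetT _ _) _)) => //.
  exact: (kernel_L2 HK good_L2).
- apply: (@wsum_leZ _ _ _ w_ge0 _ _ (fun x => cabs (bad_part x))) => //.
    by rewrite divr_ge0.
  by apply: le_trans bad_L1; apply: wsum_sub => // x [].
Qed.

End StoppingTime.

(** When the whole space is heavy its mass is at most [N / lam], and the estimate
    is immediate. *)
Lemma kop_weak11 f N lam : (wsum [set: X] (fun x => cabs (f x)) <= N%:E)%E ->
  0 < lam ->
  (wsum [set x | (lam < cabs (T f x))%R] (fun=> 1%R) <= (31 * C * N / lam)%:E)%E.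
Proof.
move=> fN lam0.
have N0 : 0 <= N by rewrite -lee_fin (le_trans _ fN)// wsum_ge0.
have [l0|nl0] := pselect (forall x, light f lam 0 x); first exact: weak11_light.
apply: (le_trans (wsum_sub w_ge0 (@subsetT _ _) _)) => //.
have [x] : exists x, ~ light f lam 0 x by exact/existsNP.
rewrite /light (block0 HQ) => /negP; rewrite -ltNge => H.
rewrite (@le_trans _ _ (lam^-1 * N)%:E)//.
  rewrite EFinM -lee_pdivrMl// ?invr_gt0// ?invrK.
  by rewrite (le_trans (ltW H)).
rewrite lee_fin mulrC ler_pM2r ?invr_gt0//.
rewrite -[leLHS]mul1r ler_wpM2r//.
by have := C1; lra.
Qed.

End WeakType.

(** * Martingales and Fefferman's inequality *)

Section Variance.
Context {R : realType} {d : measure_display} {X : measurableType d}.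
Variable w : X -> R.
Hypothesis w_ge0 : forall x, 0 <= w x.
Implicit Types (A : set X) (f g h : X -> R[i]).
Local Notation wsum := (wsum w).
Local Notation mass := (mass w).
Local Notation wint := (wint w).
Local Notation wsble := (wsble w).
Local Notation mean := (mean w).

Lemma cabs_sqrD (z1 z2 : R[i]) :
  cabs (z1 + z2) ^+ 2 = cabs z1 ^+ 2 + cabs z2 ^+ 2 +
    complex.Re (2 * conjc z2 * z1).
Proof.
by rewrite !cabs_sqr; case: z1 z2 => a b [a' b'] /=; ring.
Qed.

Lemma wsum_sum A (I : choiceType) (s : seq I) (F : I -> X -> R) :
  (forall i x, 0 <= F i x) ->
  wsum A (fun x => \sum_(i <- s) F i x) = (\sum_(i <- s) wsum A (F i))%E.
Proof.
move=> F0.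
have pos (x : X) (i : I) : A x -> true -> (0 <= (F i x * w x)%:E)%E.
  by move=> _ _; rewrite lee_fin mulr_ge0.
transitivity (\esum_(x in A) \sum_(i <- s) (F i x * w x)%:E)%E.
  by apply: eq_esum => x _; rewrite mulr_suml sumEFin.
by rewrite (esum_sum s pos).
Qed.

Lemma cabs_mean_bounded A f M : 0 <= M ->
  (forall x, A x -> 0 < w x -> cabs (f x) <= M) -> cabs (mean A f) <= M.
Proof.
move=> M0 fM; have [fA|Aoo] := mass_dichotomy w A; last by rewrite mean_infinite// cabs0.
by apply: cabs_mean_le => //; rewrite -wsum_cst//; exact: wsum_le.
Qed.

Lemma cabs_mean_mass A f : (wsum A (fun=> 1%R) < +oo)%E ->
  ((cabs (mean A f) * mass A)%:E <= wsum A (fun x => cabs (f x)))%E.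
Proof.
move=> fA; have := mass_ge0 w_ge0 A; rewrite le_eqVlt => /predU1P[m0|m0].
  by rewrite -m0 mulr0 wsum_ge0.
rewrite cabsM cabs_ge0_real ?invr_ge0 ?mass_ge0// mulrAC mulVf ?gt_eqF// mul1r.
apply: (le_trans (cabs_wint w_ge0 _)).
rewrite [leRHS]wsum_mkcond; apply: wsum_le => // x _ _.
by rewrite cabsM cabs_indic.
Qed.

(** In the expansion of the right side around the mean, the cross terms sum to
    [0]. *)
Lemma wsum_variance A h c M : (wsum A (fun=> 1%R) < +oo)%E -> 0 < mass A ->
  (forall x, 0 < w x -> cabs (h x) <= M) ->
  (wsum A (fun x => (cabs (h x - mean A h) ^+ 2 + cabs (mean A h - c) ^+ 2)%R)
   <= wsum A (fun x => (cabs (h x - c) ^+ 2)%R))%E.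
Proof.
move=> fA m0 hM; set a := mean A h.
have hs : wsble (fun x => (h x - a) * \1_A x).
  apply: (@wsble_on_bounded _ _ _ _ w_ge0 _ _ (M + cabs a)) => // x _ wx.
  by rewrite (le_trans (cabsB _ _))// lerD2r hM.
have h0 : wint (fun x => (h x - a) * \1_A x) = 0.
  have sh : wsble (fun x => h x * \1_A x).
    by apply: (@wsble_on_bounded _ _ _ _ w_ge0 _ _ M) => // x _; exact: hM.
  have sa : wsble (fun x => - a * \1_A x).
    by apply: (@wsble_on_bounded _ _ _ _ w_ge0 _ (fun=> - a) (cabs (- a))).
  have : mean A (fun x => h x + - a) = 0.
    by rewrite meanD// (@mean_cst _ _ _ _ w_ge0 A (fun=> - a) (- a)) ?subrr.
  rewrite /mean => /eqP; rewrite mulf_eq0 => /orP[|/eqP//].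
  by rewrite fmorph_eq0 invr_eq0 gt_eqF.
pose p x := (cabs (h x - a) ^+ 2 + cabs (a - c) ^+ 2) * \1_A x * w x.
pose q x := cabs (h x - c) ^+ 2 * \1_A x * w x.
pose g x := 2 * conjc (a - c) * ((h x - a) * \1_A x).
pose r x := complex.Re (g x * (w x)%:C%C).
have i0 x : 0 <= \1_A x :> R by rewrite indicE.
have p0 x : 0 <= p x by rewrite !mulr_ge0// addr_ge0.
have q0 x : 0 <= q x by rewrite !mulr_ge0.
have gs : wsble g by exact: wsbleZ.
have Er : rsum r = 0.
  have : wint g = 0 by rewrite /g wintZ// h0 mulr0.
  by rewrite /wint /csum => -[].
have rs : rsble r.
  apply: le_lt_trans gs; apply: le_esum => x _; rewrite lee_fin.
  by rewrite (le_trans (Re_le_cabs _))// cabsM cabs_ge0_real.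
have pE : (\esum_(x in [set: X]) (p x)%:E = wsum A
    (fun x => (cabs (h x - a) ^+ 2 + cabs (a - c) ^+ 2)%R))%E.
  by rewrite wsum_mkcond.
have ps : rsble p.
  rewrite /rsble; under eq_esum do rewrite ger0_norm//.
  rewrite pE; apply: (@le_lt_trans _ _ (wsum A
      (fun=> ((M + cabs a) ^+ 2 + cabs (a - c) ^+ 2)%R))); last first.
    by rewrite wsum_cst ?ltry// addr_ge0// sqr_ge0.
  apply: wsum_le => // x _ wx; rewrite lerD2r lerXn2r// ?nnegrE//.
    by rewrite addr_ge0// (le_trans _ (hM x wx)).
  by rewrite (le_trans (cabsB _ _))// lerD2r hM.
have qE : q = (fun x => p x + r x).
  apply/funext => x; rewrite /q /p /r /g.
  have -> : h x - c = (h x - a) + (a - c) by rewrite addrA subrK.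
  rewrite cabs_sqrD.
  have -> : 2 * (a - c)^*%C * ((h x - a) * \1_A x) * (w x)%:C%C =
            ((\1_A x * w x)%:C%C) * (2 * (a - c)^*%C * (h x - a)).
    have -> : \1_A x = (\1_A x)%:C%C :> R[i].
      by rewrite !indicE; case: (x \in A).
    by rewrite rmorphM; ring.
  by rewrite Re_realM; ring.
have qEs : (\esum_(x in [set: X]) (q x)%:E = wsum A
    (fun x => (cabs (h x - c) ^+ 2)%R))%E by rewrite wsum_mkcond.
have qs : rsble q.
  rewrite /rsble qE; apply: (@le_lt_trans _ _
    (\esum_(x in [set: X]) (`|p x|%:E + `|r x|%:E))%E).
    by apply: le_esum => x _; rewrite lee_fin ler_normD.
  rewrite esumD; [|by move=> x _; rewrite lee_fin..].
  exact: lte_add_pinfty.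
have fin (k : X -> R) : (forall x, 0 <= k x) -> rsble k ->
    (\esum_(x in [set: X]) (k x)%:E \is a fin_num)%E.
  move=> k0 ks; rewrite ge0_fin_numE ?esum_ge0//; last by move=> x _; rewrite lee_fin.
  by move: ks; rewrite /rsble; under eq_esum do rewrite ger0_norm//.
rewrite -pE -qEs -[leLHS]fineK ?fin// -[leRHS]fineK ?fin//.
by rewrite lee_fin -!rsum_ge0E// qE rsumD// Er addr0.
Qed.

End Variance.

Section Martingales.
Context {R : realType} {d : measure_display} {X : measurableType d}.
Variables (w : X -> R) (Q : nat -> X -> set X).
Hypothesis w_ge0 : forall x, 0 <= w x.
Hypothesis HQ : nested_partitions Q.
Implicit Types (A : set X) (f g h : X -> R[i]).
Local Notation wsum := (wsum w).
Local Notation mass := (mass w).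
Local Notation wint := (wint w).
Local Notation wsble := (wsble w).
Local Notation mean := (mean w).

Definition cexp k f x : R[i] := mean (Q k x) f.

Definition mart_diff k f x : R[i] := cexp k.+1 f x - cexp k f x.

(** The square function truncated at level [n]; truncation keeps all the sums
    over levels finite. *)
Definition square_fun n f x : R :=
  Num.sqrt (\sum_(0 <= k < n) cabs (mart_diff k f x) ^+ 2).

Local Notation E := cexp.
Local Notation D := mart_diff.
Local Notation S := square_fun.

Lemma cexp_block j k f x y : (j <= k)%N -> Q k x y -> E j f y = E j f x.
Proof. by move=> jk xy; rewrite /cexp (block_eq HQ (block_sub HQ jk xy)). Qed.

Lemma block_infinite_sub j k x : (j <= k)%N ->
  wsum (Q k x) (fun=> 1%R) = +oo%E -> wsum (Q j x) (fun=> 1%R) = +oo%E.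
Proof.
move=> jk Qoo; apply/eqP; rewrite -leye_eq -Qoo.
by apply: wsum_sub => //; exact: block_sub.
Qed.

Lemma cexp_infinite j k f x : (j <= k)%N -> wsum (Q k x) (fun=> 1%R) = +oo%E ->
  E j f x = 0.
Proof. by move=> jk /(block_infinite_sub jk) /mean_infinite; apply. Qed.

Lemma cexp_fixed k f x c : 0 < w x -> wsum (Q k x) (fun=> 1%R) != +oo%E ->
  (forall y, Q k x y -> 0 < w y -> f y = c) -> E k f x = c.
Proof.
move=> wx; rewrite -ltey => fQ; apply: mean_cst => //.
exact: (mass_gt0 w_ge0 fQ (block_self HQ k x)).
Qed.

Lemma cexp_cexp j k f x : (j <= k)%N -> 0 < w x -> E k (E j f) x = E j f x.
Proof.
move=> jk wx; have [Qoo|fQ] := eqVneq (wsum (Q k x) (fun=> 1%R)) +oo%E.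
  by rewrite (cexp_infinite _ (leqnn k))// (cexp_infinite _ jk).
by apply: cexp_fixed => // y xy _; exact: cexp_block xy.
Qed.

Lemma cexp_isolated k f x : Q k x = [set x] -> 0 < w x -> E k f x = f x.
Proof.
move=> Qx wx; apply: cexp_fixed => //; rewrite Qx; last by move=> y ->.
by rewrite wsum_set1.
Qed.

Lemma cexp_bounded k f M x : 0 <= M -> (forall y, 0 < w y -> cabs (f y) <= M) ->
  cabs (E k f x) <= M.
Proof. by move=> M0 fM; apply: cabs_mean_bounded => // y _; exact: fM. Qed.

Lemma cexp_L1 k A f : (forall x, A x -> Q k x `<=` A) ->
  (wsum A (fun x => cabs (E k f x)) <= wsum A (fun x => cabs (f x)))%E.
Proof.
move=> QA; apply: (@wsum_blocks _ _ _ w_ge0 A (Q k)) => //.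
- by move=> x _; exact: block_self.
- by move=> x y _; exact: (block_eq HQ).
move=> x Ax wx; rewrite (@eq_wsum _ _ _ w_ge0 _ _ (fun=> cabs (E k f x))); last first.
  by move=> y xy _; rewrite (cexp_block _ (leqnn k) xy).
have [fQ|Qoo] := mass_dichotomy w (Q k x).
  by rewrite wsum_cst// cabs_mean_mass.
rewrite (cexp_infinite _ (leqnn k))// cabs0 /wsum esum1 ?esum_ge0//.
  by move=> y _; rewrite lee_fin mulr_ge0.
by move=> y _; rewrite mul0r.
Qed.

Lemma cexp_sble k f : wsble f -> wsble (E k f).
Proof. by apply: le_lt_trans; apply: cexp_L1 => x _ y. Qed.

Lemma mul_bounded_sble f h M : wsble f -> (forall y, 0 < w y -> cabs (h y) <= M) ->
  wsble (fun x => f x * h x).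
Proof.
move=> fs hM; apply: (wsble_le w_ge0 _ (wsbleZ w_ge0 (`|M|)%:C%C fs)) => x wx.
rewrite cabsM [leRHS]cabsM cabs_real normr_id mulrC ler_wpM2r//.
exact: le_trans (hM x wx) (ler_norm _).
Qed.

(** Conditional expectations are self-adjoint, between [L^1] and [L^infinity];
    both sides are the same double sum over pairs of points of one block. *)
Lemma cexp_adjoint k f h M : 0 <= M -> wsble f ->
  (forall y, 0 < w y -> cabs (h y) <= M) ->
  wint (fun x => E k f x * h x) = wint (fun x => f x * E k h x).
Proof.
move=> M0 fs hM.
have iE x y : \1_(Q k x) y = \1_(Q k y) x :> R[i].
  have [xy|nxy] := pselect (Q k x y).
    by rewrite !indic_in//; exact: (block_sym HQ).
  by rewrite !indic_out// => /(block_sym HQ).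
pose F y x := f y * (((mass (Q k y))^-1)%:C%C * (h x * \1_(Q k y) x)).
have hs y : wsble (fun x => ((mass (Q k y))^-1)%:C%C * (h x * \1_(Q k y) x)).
  have [fQ|Qoo] := mass_dichotomy w (Q k y).
    apply: wsbleZ => //; apply: (@wsble_on_bounded _ _ _ _ w_ge0 _ _ M) => // z _.
    exact: hM.
  rewrite /wsble /wsum esum1// => x _.
  by rewrite (mass_infty Qoo) invr0 mul0r cabs0 mul0r.
have mE y : wint (fun x => ((mass (Q k y))^-1)%:C%C * (h x * \1_(Q k y) x)) = E k h y.
  have [fQ|Qoo] := mass_dichotomy w (Q k y).
    rewrite wintZ//; apply: (@wsble_on_bounded _ _ _ _ w_ge0 _ _ M) => // z _.
    exact: hM.
  rewrite (cexp_infinite _ (leqnn k))// (mass_infty Qoo) invr0.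
  by rewrite -[RHS](wint0 w_ge0); congr wint; apply/funext => x; rewrite mul0r.
have hs1 y : (wsum [set: X] (fun x => cabs (((mass (Q k y))^-1)%:C%C *
    (h x * \1_(Q k y) x))%R) <= (M * 1)%:E)%E.
  apply: (@wsum_leZ _ _ _ w_ge0 _ _ (fun x => (mass (Q k y))^-1 * \1_(Q k y) x)) => //.
  - by move=> x; rewrite mulr_ge0 ?invr_ge0 ?mass_ge0// indicE.
  - move=> x _ wx; rewrite !cabsM cabs_indic cabs_ge0_real ?invr_ge0 ?mass_ge0//.
    rewrite mulrCA ler_wpM2r ?hM// mulr_ge0 ?invr_ge0 ?mass_ge0// indicE//.
  - by rewrite -(wsum_mkcond _ _ (fun=> (mass (Q k y))^-1)) wsum_avg1.
transitivity (wint (fun x => wint (F ^~ x))).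
  apply: eq_wint => // x wx; rewrite /cexp /mean mulrAC -wintZ//; last first.
    exact: wsble_indic.
  congr wint; apply/funext => y; rewrite /F (iE x y).
  have [yx|nyx] := pselect (Q k y x).
    by rewrite (block_eq HQ yx); ring.
  by rewrite (indic_out nyx) !mulr0.
have [N fN] : exists N, wsum [set: X] (fun x => cabs (f x)) = N%:E.
  exists (fine (wsum [set: X] (fun x => cabs (f x)))).
  by rewrite fineK// ge0_fin_numE// wsum_ge0.
rewrite -(@wint_exchange _ _ _ _ w_ge0 F (fun y => M * cabs (f y)) (M * N)).
- by apply: eq_wint => // y wy; rewrite wintZ// mE.
- move=> y wy; rewrite mulrC -[M]mulr1.
  apply: (@wsum_leZ _ _ _ w_ge0 _ _ (fun x => cabs (((mass (Q k y))^-1)%:C%C *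
    (h x * \1_(Q k y) x)))) => // x _ _.
  by rewrite /F [leLHS]cabsM.
- apply: (@wsum_leZ _ _ _ w_ge0 _ _ (fun y => cabs (f y))) => //.
  by rewrite fN.
Qed.

Lemma mart_diff_sble k f : wsble f -> wsble (D k f).
Proof. by move=> fs; apply: wsbleB => //; exact: cexp_sble. Qed.

Lemma mart_diff_bounded k h M x : 0 <= M -> (forall y, 0 < w y -> cabs (h y) <= M) ->
  cabs (D k h x) <= M + M.
Proof.
by move=> M0 hM; rewrite (le_trans (cabsB _ _))// lerD//; exact: cexp_bounded.
Qed.

(** Pairing two conditional expectations only sees the coarser of the two levels,
    so the four products of the expansion reduce to a difference of two. *)
Lemma wint_mart_diff k f h M : 0 <= M -> wsble f ->
  (forall y, 0 < w y -> cabs (h y) <= M) ->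
  wint (fun x => D k f x * h x) = wint (fun x => D k f x * D k h x).
Proof.
move=> M0 fs hM.
have Es j : wsble (E j f) by exact: cexp_sble.
have EM j y : 0 < w y -> cabs (E j h y) <= M by move=> _; exact: cexp_bounded.
have s1 j : wsble (fun x => E j f x * h x) by exact: mul_bounded_sble hM.
have s2 i j : wsble (fun x => E i f x * E j h x) by apply: mul_bounded_sble (EM j).
pose p i j := wint (fun x => E i f x * E j h x).
pose q i := wint (fun x => E i f x * h x).
have le_pair i j : (i <= j)%N -> p i j = q i.
  move=> ij; rewrite /p /q -(cexp_adjoint j M0 (Es i) hM).
  by apply: eq_wint => // x wx; rewrite cexp_cexp.
have ge_pair i j : (j <= i)%N -> p i j = q j.
  move=> ji; rewrite /p /q (cexp_adjoint i M0 fs (EM j)) (cexp_adjoint j M0 fs hM).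
  by apply: eq_wint => // x wx; rewrite cexp_cexp.
have -> : wint (fun x => D k f x * h x) = q k.+1 - q k.
  by rewrite -(wintB w_ge0 (s1 k.+1) (s1 k)); congr wint; apply/funext => x; rewrite -mulrBl.
have -> : wint (fun x => D k f x * D k h x) =
    (p k.+1 k.+1 - p k.+1 k) - (p k k.+1 - p k k).
  have e i := wintB w_ge0 (s2 i k.+1) (s2 i k).
  have sB i := wsbleB w_ge0 (s2 i k.+1) (s2 i k).
  have eB := etrans (wintB w_ge0 (sB k.+1) (sB k))
    (congr2 (fun a b => a - b) (e k.+1) (e k)).
  apply: etrans eB; congr wint; apply/funext => x; rewrite /mart_diff; ring.
rewrite (ge_pair k.+1 k (leqnSn k)) (le_pair k.+1 k.+1 (leqnn _)).
rewrite (le_pair k k.+1 (leqnSn k)) (le_pair k k (leqnn k)).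
by move: (q k.+1) (q k) => a b; rewrite subrr subr0.
Qed.

(** On a block of level [k + 1], where [E k h] is constant, this is
    [wsum_variance]. *)
Lemma cexp_pythagoras k A h M : (forall x, A x -> Q k.+1 x `<=` A) ->
  (wsum A (fun=> 1%R) < +oo)%E -> (forall y, 0 < w y -> cabs (h y) <= M) ->
  (wsum A (fun x => (cabs (h x - E k.+1 h x) ^+ 2 + cabs (D k h x) ^+ 2)%R)
   <= wsum A (fun x => (cabs (h x - E k h x) ^+ 2)%R))%E.
Proof.
move=> QA fA hM; apply: (@wsum_blocks _ _ _ w_ge0 A (Q k.+1)) => //.
- by move=> x _; exact: block_self.
- by move=> x y _; exact: (block_eq HQ).
- by move=> x; rewrite addr_ge0.
move=> x Ax wx.
have fQ : (wsum (Q k.+1 x) (fun=> 1%R) < +oo)%E.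
  by apply: le_lt_trans fA; apply: wsum_sub => //; exact: QA.
have m0 := mass_gt0 w_ge0 fQ (block_self HQ _ x) wx.
rewrite (@eq_wsum _ _ _ w_ge0 _ (fun y => cabs (h y - E k h y) ^+ 2)
  (fun y => cabs (h y - E k h x) ^+ 2)); last first.
  by move=> y xy _; rewrite (cexp_block _ (leqnSn k) xy).
apply: le_trans (wsum_variance w_ge0 (E k h x) fQ m0 hM).
apply: wsum_le => // y xy _; rewrite /mart_diff (cexp_block _ (leqnSn k) xy).
by rewrite /cexp (block_eq HQ xy).
Qed.

Lemma sum_mart_diff_sqr j n x0 h M : (j <= n)%N ->
  (wsum (Q j.+1 x0) (fun=> 1%R) < +oo)%E -> (forall y, 0 < w y -> cabs (h y) <= M) ->
  (wsum (Q j.+1 x0) (fun x => (\sum_(j <= k < n) cabs (D k h x) ^+ 2)%R)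
   <= wsum (Q j.+1 x0) (fun x => (cabs (h x - E j h x) ^+ 2)%R))%E.
Proof.
move=> jn fA hM; set A := Q j.+1 x0.
pose V n x := \sum_(j <= k < n) cabs (D k h x) ^+ 2.
have V0 m x : 0 <= V m x by apply: sumr_ge0.
suff H : (wsum A (fun x => (V n x + cabs (h x - E n h x) ^+ 2)%R) <=
    wsum A (fun x => (cabs (h x - E j h x) ^+ 2)%R))%E.
  by apply: le_trans H; apply: wsum_le => // x _ _; rewrite lerDl.
elim: n jn => [|n IH].
  rewrite leqn0 => /eqP ->; apply: wsum_le => // x _ _.
  by rewrite /V big_geq// add0r.
rewrite leq_eqVlt => /predU1P[<-|].
  by apply: wsum_le => // x _ _; rewrite /V big_geq// add0r.
rewrite ltnS => jn; apply: le_trans (IH jn).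
rewrite [leRHS]wsumD// (le_trans _ (leeD2l _ (cexp_pythagoras (k := n) (M := M) _ fA hM)))//.
  rewrite -wsumD//; last by move=> x; rewrite addr_ge0.
  apply: wsum_le => // x _ _; rewrite /V big_nat_recr//= -addrA.
  by rewrite [X in _ + X]addrC.
move=> x Ax y xy; rewrite /A -(block_eq HQ Ax); apply: block_sub xy => //.
Qed.

Lemma square_fun_ge0 n f x : 0 <= S n f x.
Proof. exact: sqrtr_ge0. Qed.

Lemma square_fun_sqrS n f x : S n.+1 f x ^+ 2 = S n f x ^+ 2 + cabs (D n f x) ^+ 2.
Proof.
have s0 m : 0 <= \sum_(0 <= k < m) cabs (D k f x) ^+ 2 by apply: sumr_ge0.
by rewrite /square_fun (sqr_sqrtr (s0 n)) (sqr_sqrtr (s0 n.+1)) big_nat_recr.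
Qed.

Lemma square_fun_le n f x : S n f x <= S n.+1 f x.
Proof.
by apply: ler_wsqrtr; rewrite big_nat_recr//= lerDl.
Qed.

Lemma square_fun0 f x : S 0 f x = 0.
Proof. by rewrite /square_fun big_geq// sqrtr0. Qed.

Lemma mart_diff_block k f x y : Q k.+1 x y -> D k f y = D k f x.
Proof.
move=> xy; rewrite /mart_diff (cexp_block _ (leqnn _) xy).
by rewrite (cexp_block _ (leqnSn _) xy).
Qed.

Lemma square_fun_block n f x y : Q n x y -> S n f y = S n f x.
Proof.
move=> xy; rewrite /square_fun; congr Num.sqrt.
apply: eq_big_nat => k /andP[_ kn]; rewrite (@mart_diff_block k f x y)//.
exact: block_sub xy.
Qed.

Lemma square_fun_infinite n f x : wsum (Q n x) (fun=> 1%R) = +oo%E -> S n f x = 0.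
Proof.
move=> Qoo; rewrite /square_fun big1_seq ?sqrtr0// => k /andP[_].
rewrite mem_index_iota => /andP[_ kn].
by rewrite /mart_diff !(cexp_infinite _ _ Qoo)// ?(ltnW kn)// subrr cabs0 expr0n.
Qed.

Definition square_incr n f x : R := S n.+1 f x - S n f x.

Lemma square_incr_ge0 n f x : 0 <= square_incr n f x.
Proof. by rewrite subr_ge0 square_fun_le. Qed.

Lemma sum_square_incr n f x : \sum_(0 <= j < n) square_incr j f x = S n f x.
Proof.
rewrite (@telescope_sumr _ 0%N n (fun j => S j f x))// square_fun0 subr0//.
Qed.

(** Weighting the square function by its increments turns the pairing of two
    differences into terms that the two norms control separately. *)
Lemma cabs_mart_diff_mul n f h x :
  cabs (D n f x) * cabs (D n h x) <=
  square_incr n f x + 2^-1 * (S n.+1 f x * cabs (D n h x) ^+ 2).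
Proof.
have d2 : cabs (D n f x) ^+ 2 = S n.+1 f x ^+ 2 - S n f x ^+ 2.
  by rewrite square_fun_sqrS addrAC subrr add0r.
have := square_fun_le n f x; have := square_fun_ge0 n f x; rewrite /square_incr.
have := cabs_ge0 (D n f x); move: d2.
set s := S n.+1 f x; set s0 := S n f x; set a := cabs _; set b := cabs _.
move=> a2 a0 s00 s0s.
have [s_eq0|s_neq0] := eqVneq s 0.
  have s0_eq0 : s0 = 0 by apply/eqP; rewrite eq_le s00 -s_eq0 s0s.
  have -> : a = 0.
    by apply/eqP; rewrite -sqrf_eq0 a2 s_eq0 s0_eq0 expr0n subr0.
  by rewrite s_eq0 s0_eq0 !mul0r mulr0 subr0 addr0.
have s_gt0 : 0 < s by rewrite lt_neqAle eq_sym s_neq0 (le_trans s00).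
rewrite -(ler_pM2l (_ : 0 < 2 * s)); last by rewrite mulr_gt0.
rewrite -subr_ge0.
have -> : 2 * s * (s - s0 + 2^-1 * (s * b ^+ 2)) - 2 * s * (a * b) =
  (s - s0) ^+ 2 + (s * b - a) ^+ 2 + (s ^+ 2 - s0 ^+ 2 - a ^+ 2) by field.
by rewrite a2 subrr addr0 addr_ge0// sqr_ge0.
Qed.

Lemma sum_cabs_mart_diff n f h x :
  \sum_(0 <= k < n) cabs (D k f x) * cabs (D k h x) <=
  S n f x + 2^-1 * \sum_(0 <= j < n)
    square_incr j f x * \sum_(j <= k < n) cabs (D k h x) ^+ 2.
Proof.
elim: n => [|n IH].
  by rewrite !big_geq// square_fun0 mulr0 addr0.
rewrite big_nat_recr//= (le_trans (lerD IH (cabs_mart_diff_mul n f h x)))//.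
rewrite le_eqVlt; apply/orP; left; apply/eqP.
have -> : \sum_(0 <= j < n.+1) square_incr j f x *
      \sum_(j <= k < n.+1) cabs (D k h x) ^+ 2 =
    \sum_(0 <= j < n) square_incr j f x * \sum_(j <= k < n) cabs (D k h x) ^+ 2
    + S n.+1 f x * cabs (D n h x) ^+ 2.
  rewrite -sum_square_incr mulr_suml [in RHS]big_nat_recr//= [in LHS]big_nat_recr//=.
  rewrite addrA -big_split/=; congr (_ + _); last by rewrite big_nat1.
  by apply: eq_big_nat => j /andP[_ jn]; rewrite big_nat_recr ?(ltnW jn)//= mulrDr.
by rewrite /square_incr; ring.
Qed.

(** A finite set carrying nearly all of [f] consists of points isolated at some
    level [n]; off those points [E n] contracts the [L^1] norm. *)
Lemma martingale_tail f (eps : R) : wsble f -> 0 < eps ->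
  exists n, (wsum [set: X] (fun x => cabs (f x - E n f x)%R) <= eps%:E)%E.
Proof.
move=> fs e0.
pose N := fine (wsum [set: X] (fun x => cabs (f x))).
have NE : wsum [set: X] (fun x => cabs (f x)) = N%:E.
  by rewrite fineK// ge0_fin_numE// wsum_ge0.
have : ((N - eps / 2)%:E < wsum [set: X] (fun x => cabs (f x)))%E.
  by rewrite NE lte_fin ltrBlDr ltrDl divr_gt0.
move=> /ereal_sup_gt[_ [F [finF _] <-]] NF.
have [n nF] : exists n, forall x, F x -> Q n x = [set x].
  pose iso x := xget 0%N [set n | forall k, (n <= k)%N -> Q k x = [set x]].
  have isoP x : forall k, (iso x <= k)%N -> Q k x = [set x].
    rewrite /iso; case: xgetP => [m _ //|/=]; have [m mP] := block_isolated HQ x.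
    by move=> /(_ m).
  exists (\max_(x <- finmap.enum_fset (fset_set F)) iso x)%N => x Fx.
  apply: isoP; apply: (@leq_bigmax_seq _ _ xpredT iso) => //.
  have : x \in fset_set F by rewrite in_fset_set// inE.
  by [].
exists n; pose A := [set x | Q n x <> [set x]].
have QA x : A x -> Q n x `<=` A.
  move=> Ax y xy; rewrite /A/= (block_eq HQ xy) => Qy; apply: Ax.
  by have := block_self HQ n x; rewrite Qy /= => ->.
have fA : (wsum A (fun x => cabs (f x)) <= (eps / 2)%:E)%E.
  have : (wsum F (fun x => cabs (f x)) + wsum A (fun x => cabs (f x)) <= N%:E)%E.
    rewrite -NE [wsum F _]wsum_mkcond [wsum A _]wsum_mkcond -wsumD//; last 2 first.
    - by move=> x; rewrite mulr_ge0// indicE.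
    - by move=> x; rewrite mulr_ge0// indicE.
    apply: wsum_le => // x _ _; rewrite -mulrDr ler_piMr//.
    have [Fx|nFx] := pselect (F x).
      by rewrite (indic_in Fx) indic_out ?addr0// => /(_ (nF x Fx)).
    by rewrite (indic_out nFx) add0r indicE; case: (x \in A).
  have -> : wsum F (fun x => cabs (f x)) = (\sum_(x \in F) (cabs (f x) * w x)%:E)%E.
    by rewrite /wsum esum_fset// => x _; rewrite lee_fin mulr_ge0.
  move: NF; rewrite fsbig_finite//= sumEFin lte_fin.
  set u := \sum_(_ <- _) _ => uN.
  have A0 : (0 <= wsum A (fun x => cabs (f x)))%E by exact: wsum_ge0.
  case: (wsum A _) A0 => [r _|//|//]; rewrite -EFinD !lee_fin => H; lra.
rewrite (@le_trans _ _ (wsum A (fun x => cabs (f x - E n f x)%R)))//.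
  rewrite [leRHS]wsum_mkcond; apply: wsum_le => // x _ wx.
  have [Ax|nAx] := pselect (A x); first by rewrite indic_in// mulr1.
  rewrite indic_out// mulr0 cexp_isolated//; first by rewrite subrr cabs0.
  exact: contrapT.
have -> : eps = eps / 2 + eps / 2 by field.
apply: (@wsum_leD _ _ _ w_ge0 _ _ (fun x => cabs (f x)) (fun x => cabs (E n f x))) => //.
- by move=> x _ _; exact: cabsB.
- exact: le_trans (cexp_L1 f QA) fA.
Qed.

(** Expand [f] in martingale differences.  By [sum_cabs_mart_diff] the pairing is
    at most the square function plus a sum over levels [j] of its increments
    times the tail of the differences of [h] from level [j] on.  The increment is
    constant on each block of level [j + 1], and there the tail has average at
    most [B] by [sum_mart_diff_sqr].  The bound being homogeneous in [f],
    the arithmetic-geometric inequality, applied term by term, suffices. *)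
Lemma fefferman f h M B N :
  wsble f -> wint f = 0 ->
  (forall n, (wsum [set: X] (S n f) <= N%:E)%E) ->
  0 <= M -> (forall y, 0 < w y -> cabs (h y) <= M) -> 0 <= B ->
  (forall k x, (wsum (Q k.+1 x) (fun=> 1%R) < +oo)%E ->
    (wsum (Q k.+1 x) (fun y => (cabs (h y - E k h y) ^+ 2)%R)
      <= (B * mass (Q k.+1 x))%:E)%E) ->
  cabs (wint (fun x => f x * h x)) <= (1 + B / 2) * N.
Proof.
move=> fs f0 SN M0 hM B0 hB.
have trunc n : cabs (wint (fun x => E n f x * h x)) <= (1 + B / 2) * N.
  pose V j x := \sum_(j <= k < n) cabs (D k h x) ^+ 2.
  have V0 j x : 0 <= V j x by apply: sumr_ge0.
  have Ds k : wsble (fun x => D k f x * D k h x).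
    by apply: (mul_bounded_sble (mart_diff_sble k fs)) => y _; exact: mart_diff_bounded hM.
  have Dhs k : wsble (fun x => D k f x * h x).
    exact: (mul_bounded_sble (mart_diff_sble k fs) hM).
  have E0 x : E 0 f x = 0.
    rewrite /cexp /mean (block0 HQ).
    have -> : (fun x => f x * \1_[set: X] x) = f.
      by apply/funext => y; rewrite indic_in// mulr1.
    by rewrite f0 mulr0.
  have -> : wint (fun x => E n f x * h x) =
      wint (fun x => \sum_(k <- index_iota 0 n) D k f x * D k h x).
    have [_ ->] := wint_sum w_ge0 (index_iota 0 n) Ds.
    under eq_bigr do rewrite -(wint_mart_diff _ M0 fs hM).
    have [_ <-] := wint_sum w_ge0 (index_iota 0 n) Dhs.
    congr wint; apply/funext => x; rewrite -mulr_suml.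
    by rewrite (@telescope_sumr _ 0%N n (fun k => E k f x))// E0 subr0.
  apply: (@cabs_wint_le _ _ _ _ w_ge0 _ [set: X]
      (fun x => S n f x + 2^-1 * \sum_(0 <= j < n) square_incr j f x * V j x)).
  - by move=> x /(_ I).
  - move=> x _ _; apply: le_trans (sum_cabs_mart_diff n f h x).
    apply: (big_ind2 (fun z r => cabs z <= r)) => [|a b c e ab ce|k _].
    + by rewrite cabs0.
    + by rewrite (le_trans (cabsD _ _))// lerD.
    + by rewrite cabsM.
  have iV0 j x : 0 <= square_incr j f x * V j x by rewrite mulr_ge0 ?square_incr_ge0.
  rewrite (_ : (1 + B / 2) * N = N + 2^-1 * (B * N)); last by ring.
  apply: (@wsum_leD _ _ _ w_ge0 _ _ (S n f)
    (fun x => 2^-1 * \sum_(0 <= j < n) square_incr j f x * V j x)) => //.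
  - by move=> x; exact: square_fun_ge0.
  - by move=> x; rewrite mulr_ge0 ?sumr_ge0.
  apply: (@wsum_leZ _ _ _ w_ge0 _ _
    (fun x => \sum_(0 <= j < n) square_incr j f x * V j x)) => //.
    by move=> x; apply: sumr_ge0.
  have sB : (wsum [set: X] (fun x => (B * S n f x)%R) <= (B * N)%:E)%E.
    apply: (@wsum_leZ _ _ _ w_ge0 _ _ (S n f)) => // x.
    exact: square_fun_ge0.
  apply: le_trans sB.
  rewrite [leLHS](wsum_sum w_ge0)//.
  rewrite (@eq_wsum _ _ _ w_ge0 _ (fun x => B * S n f x)
    (fun x => \sum_(j <- index_iota 0 n) B * square_incr j f x)); last first.
    by move=> x _ _; rewrite -mulr_sumr sum_square_incr.
  have Bi0 j x : 0 <= B * square_incr j f x by rewrite mulr_ge0 ?square_incr_ge0.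
  rewrite (wsum_sum w_ge0)// big_nat_cond [leRHS]big_nat_cond; apply: lee_sum => j.
  rewrite andbT => /andP[_ jn].
  apply: (@wsum_blocks _ _ _ w_ge0 _ (Q j.+1)) => //.
  - by move=> x _; exact: block_self.
  - by move=> x y _; exact: (block_eq HQ).
  move=> x _ wx; pose c := square_incr j f x.
  have cE y : Q j.+1 x y -> square_incr j f y = c.
    move=> xy; rewrite /square_incr (square_fun_block _ xy) /c.
    by rewrite (@square_fun_block j f x y)//; exact: block_sub xy.
  have c0 : 0 <= c by exact: square_incr_ge0.
  rewrite (@eq_wsum _ _ _ w_ge0 _ _ (fun y => c * V j y)); last by move=> y /cE ->.
  rewrite (@eq_wsum _ _ _ w_ge0 _ (fun x => B * square_incr j f x) (fun y => B * c)); last first.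
    by move=> y /cE ->.
  have [fQ|Qoo] := mass_dichotomy w (Q j.+1 x); last first.
    have -> : c = 0.
      by rewrite /c /square_incr square_fun_infinite// square_fun_infinite ?subrr//;
        exact: block_infinite_sub Qoo.
    by apply: wsum_le => // y _ _; rewrite mulr0 mul0r.
  rewrite wsumZ// wsum_cst ?mulr_ge0// mulrAC [_ * c]mulrC EFinM.
  rewrite lee_wpmul2l ?lee_fin//.
  by apply: le_trans (hB j x fQ); apply: (sum_mart_diff_sqr _ fQ hM); exact: ltnW.
rewrite -lee_fin; apply/lee_addgt0Pr => e e0.
(* [M + 1] in place of [M], which may vanish. *)
have e1 : 0 < e / (M + 1) by rewrite divr_gt0// ltr_wpDl.
have [n En] := martingale_tail fs e1.
rewrite -EFinD lee_fin.
have -> : wint (fun x => f x * h x) =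
    wint (fun x => E n f x * h x) + wint (fun x => (f x - E n f x) * h x).
  rewrite -wintD//; first by congr wint; apply/funext => x; ring.
    by apply: (mul_bounded_sble _ hM); exact: cexp_sble.
  by apply: (mul_bounded_sble _ hM); apply: wsbleB => //; exact: cexp_sble.
rewrite (le_trans (cabsD _ _))// lerD//.
apply: (@cabs_wint_le _ _ _ _ w_ge0 _ [set: X] (fun x => (M + 1) * cabs (f x - E n f x))).
- by move=> x /(_ I).
- move=> x _ wx; rewrite cabsM mulrC ler_wpM2r// (le_trans (hM x wx))//.
  by rewrite lerDl.
rewrite (_ : e = (M + 1) * (e / (M + 1))); last first.
  by rewrite mulrCA mulfV ?mulr1// gt_eqF// ltr_wpDl.
apply: (@wsum_leZ _ _ _ w_ge0 _ _ (fun x => cabs (f x - E n f x))) => //.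
by rewrite addr_ge0.
Qed.

End Martingales.

(** * From [H^1] to [L^1] *)

Section HardyBound.
Context {R : realType} {d : measure_display} {X : measurableType d}.
Variables (w : X -> R) (Q : nat -> X -> set X) (K : X -> X -> R[i]) (C : R).
Hypothesis w_ge0 : forall x, 0 <= w x.
Hypothesis HQ : nested_partitions Q.
Hypothesis HK : dyadic_CZ_kernel w Q K C.
Local Notation wsum := (wsum w).
Local Notation wint := (wint w).
Local Notation wsble := (wsble w).
Local Notation T := (kop w K).

(** The kernel is symmetric, and the finite support of [g] makes the double sum
    absolutely convergent. *)
Lemma kop_transpose f g (F : set X) : finite_set F -> wsble f ->
  (forall x, cabs (g x) <= \1_F x) ->
  wint (fun x => g x * T f x) = wint (fun y => f y * T g y).
Proof.
move=> finF fs gF; have C0 := kernel_C_ge0 HK.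
have [N fN] : exists N, wsum [set: X] (fun x => cabs (f x)) = N%:E.
  exists (fine (wsum [set: X] (fun x => cabs (f x)))).
  by rewrite fineK// ge0_fin_numE// wsum_ge0.
have N0 : 0 <= N by rewrite -lee_fin -fN wsum_ge0.
have gs x : wsble (fun y => K x y * g y).
  apply: (@kernel_mul_bounded_sble _ _ _ w Q K C w_ge0 HQ HK _ _ 1) => y _.
  by rewrite (le_trans (gF y))// indicE; case: (_ \in _).
transitivity (wint (fun x => wint (fun y => g x * (K x y * f y)))).
  apply: eq_wint => // x wx; rewrite wintZ//.
  exact: (kernel_mul_sble w_ge0 HQ HK wx fs).
pose k x := \1_F x * (C / w x * N).
have kF : (wsum [set: X] k < +oo)%E.
  rewrite (@eq_wsum _ _ w w_ge0 _ _ (fun x => (C / w x * N) * \1_F x)); last first.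
    by move=> x _ _; rewrite /k mulrC.
  rewrite -wsum_mkcond /wsum esum_fset//; last first.
    by move=> x _; rewrite lee_fin !mulr_ge0// invr_ge0.
  by rewrite fsbig_finite//= sumEFin ltry.
rewrite (@wint_exchange _ _ _ _ w_ge0 _ k (fine (wsum [set: X] k))).
- apply: eq_wint => // y _; rewrite /kop -wintZ//.
  by congr wint; apply/funext => x; rewrite (kernel_sym HK x y); ring.
- move=> x wx; rewrite /k mulrA; apply: (@wsum_leZ _ _ _ w_ge0 _ _ (fun y => cabs (f y))) => //.
  + by rewrite !mulr_ge0// ?indicE// invr_ge0.
  + move=> y _ _; rewrite !cabsM mulrA ler_wpM2r// ler_pM//.
    by rewrite ler_pdivlMr// (kernel_sym HK) (kernel_pointwise w_ge0 HQ HK).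
  + by rewrite fN.
- rewrite fineK// ge0_fin_numE// wsum_ge0// => x.
  by rewrite !mulr_ge0// ?indicE// invr_ge0.
Qed.

(** Test [T f] against functions of modulus at most [1] and finite support,
    transpose, and
    apply Fefferman's inequality to their images, whose oscillation is bounded
    by [kop_BMO2]. *)
Lemma kop_H1 f N : wsble f -> wint f = 0 ->
  (forall n, (wsum [set: X] (square_fun w Q n f) <= N%:E)%E) ->
  (wsum [set: X] (fun x => cabs (T f x)) <= ((1 + 10 * C ^+ 2) * N)%:E)%E.
Proof.
move=> fs f0 SN; have C0 := kernel_C_ge0 HK.
apply: ge_ereal_sup => _ [F [finF _] <-].
have [u uP] : {u : X -> R[i] & forall x, cabs (u x) <= 1 /\ u x * T f x = (cabs (T f x))%:C%C}.
  by apply: (@choice X _ (fun x z => cabs z <= 1 /\ z * T f x = (cabs (T f x))%:C%C))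
    => x; exact: cabs_rotate.
pose g x := u x * \1_F x.
have gF x : cabs (g x) <= \1_F x.
  by rewrite cabsM cabs_indic ler_piMl// ?indicE//; case: (uP x).
have g1 x : 0 < w x -> cabs (g x) <= 1.
  by move=> _; rewrite (le_trans (gF x))// indicE; case: (_ \in _).
have -> : (\sum_(x \in F) (cabs (T f x) * w x)%:E)%E =
    wsum [set: X] (fun x => cabs (T f x) * \1_F x).
  rewrite -wsum_mkcond /wsum esum_fset// => x _.
  by rewrite lee_fin mulr_ge0.
have r0 x : 0 <= cabs (T f x) * \1_F x by rewrite mulr_ge0// indicE.
have rfin : wsum [set: X] (fun x => cabs (T f x) * \1_F x) \is a fin_num.
  rewrite -wsum_mkcond /wsum esum_fset//; last by move=> x _; rewrite lee_fin mulr_ge0.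
  by rewrite fsbig_finite//= sumEFin.
rewrite -(fineK rfin) lee_fin.
rewrite -[leLHS]cabs_ge0_real; last by apply: fine_ge0; apply: wsum_ge0.
rewrite -wint_real//.
have -> : wint (fun x => (cabs (T f x) * \1_F x)%:C%C) = wint (fun x => f x * T g x).
  rewrite -(kop_transpose finF)//; congr wint; apply/funext => x.
  rewrite /g mulrAC (proj2 (uP x)) rmorphM; congr (_ * _).
  by rewrite !indicE; case: (x \in F).
pose M := \sum_(x <- finmap.enum_fset (fset_set F)) C.
have M0 : 0 <= M by apply: sumr_ge0.
have -> : (1 + 10 * C ^+ 2) * N = (1 + 20 * C ^+ 2 / 2) * N by field.
apply: (@fefferman _ _ _ w Q w_ge0 HQ f (T g) M) => //.
- move=> y _; apply: (@cabs_wint_le _ _ _ _ w_ge0 _ F (fun x => cabs (K y x))).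
  + by move=> x nFx; rewrite /g indic_out// !mulr0.
  + by move=> x _ wx; rewrite cabsM ler_piMr// g1.
  + rewrite /wsum esum_fset//; last by move=> x _; rewrite lee_fin mulr_ge0.
    rewrite fsbig_finite//= sumEFin lee_fin; apply: ler_sum => x _.
    exact: (kernel_pointwise w_ge0 HQ HK).
- by rewrite mulr_ge0// sqr_ge0.
- move=> k x fQ; have := kop_BMO2 w_ge0 HQ HK ltr01 g1 fQ.
  by rewrite expr1n mulr1.
Qed.

End HardyBound.

(** * Dyadic sets of a tree *)
Section TreeBlocks.
Context {X : choiceType} (e : rel X) (o : X).
Hypothesis Htree : is_tree e.
Local Notation lev x := (dist e x o).
Local Notation pr := (pred_vertex e o).

Lemma lev_spec x : walk e x o (lev x) /\ forall m, walk e x o m -> (lev x <= m)%N.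
Proof.
have [p [xp lp]] : exists p, path e x p /\ last x p = o by case: Htree.
have ex : exists n, `[< walk e x o n >].
  by exists (size p); apply/asboolP; exists p.
case: (ex_minnP ex) => n /asboolP wn nmin.
rewrite /dist; case: xgetP => [m _ []//|/(_ n)/=]; case; split => // m wm.
exact/nmin/asboolP.
Qed.

Lemma lev_origin : lev o = 0%N.
Proof.
apply/eqP; rewrite -leqn0; apply: (lev_spec o).2.
by exists [::].
Qed.

Lemma lev_eq0 x : lev x = 0%N -> x = o.
Proof.
move=> x0; have [[p [_ lp sp]] _] := lev_spec x.
by rewrite -lp (size0nil (etrans sp x0)).
Qed.

(** A shortest walk to the origin starts with a neighbour one level below. *)
Lemma lev_pred x : lev (pr x) = (lev x).-1.
Proof.
rewrite /pred_vertex; case: xgetP => [y _ [_ ->]//|none].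
have [->|/eqP xo] := eqVneq x o; first by rewrite lev_origin.
have [[[|y p] [/= xp lp sp]] _] := lev_spec x; first by case: xo.
case/andP: xp => xy yp; exfalso; apply: (none y); split => //=.
have wy : walk e y o (size p) by exists p.
apply/eqP; rewrite eqn_leq -{2}sp ltnS (lev_spec y).2// andbT.
have [[q [yq lq sq]] _] := lev_spec y.
apply: (lev_spec x).2; exists (y :: q); split => //=; first by rewrite xy.
by rewrite sq.
Qed.

Lemma lev_iter k x : lev (iter k pr x) = (lev x - k)%N.
Proof. by elim: k => [|k IH]; rewrite ?subn0//= lev_pred IH subnS. Qed.

Definition ancestor k x : X := iter (lev x - k) pr x.

Lemma lev_ancestor k x : (k <= lev x)%N -> lev (ancestor k x) = k.
Proof. by move=> kx; rewrite lev_iter subKn. Qed.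

Definition tree_block k x : set X :=
  if (lev x < k)%N then [set x] else sector e o (ancestor k x).

Lemma sectorP a y : sector e o a y <-> (lev a <= lev y)%N /\ ancestor (lev a) y = a.
Proof.
split=> [[/= ->|[j /= j1 ya]]|[ay ya]].
- by rewrite /ancestor subnn.
- have lj : lev a = (lev y - j)%N by rewrite -ya lev_iter.
  split; first by rewrite lj leq_subr.
  have [jy|yj] := leqP j (lev y); first by rewrite /ancestor lj subKn.
  have a0 : lev a = 0%N by rewrite lj; apply/eqP; rewrite subn_eq0 ltnW.
  by rewrite (lev_eq0 a0); apply: lev_eq0; rewrite lev_origin lev_ancestor.
- rewrite /sector/=; case: (posnP (lev y - lev a)) => [ya0|pos]; last first.
    by right; exists (lev y - lev a)%N.
  by left; rewrite -ya /ancestor ya0.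
Qed.

Lemma tree_block_small k x : (lev x < k)%N -> tree_block k x = [set x].
Proof. by rewrite /tree_block => ->. Qed.

Lemma tree_block_large k x y : (k <= lev x)%N ->
  tree_block k x y <-> (k <= lev y)%N /\ ancestor k y = ancestor k x.
Proof.
by move=> kx; rewrite /tree_block ltnNge kx/= sectorP lev_ancestor.
Qed.

Lemma ancestorS k x : (k < lev x)%N -> ancestor k x = pr (ancestor k.+1 x).
Proof. by move=> kx; rewrite /ancestor -iterS -subSn// subSS. Qed.

Lemma tree_block_nested : nested_partitions tree_block.
Proof.
split.
- move=> x; apply/seteqP; split => // y _; apply/tree_block_large => //; split=> //.
  by rewrite (lev_eq0 (lev_ancestor (leq0n _))) (lev_eq0 (lev_ancestor (leq0n _))).
- move=> k x; have [kx|xk] := leqP k (lev x); first by apply/tree_block_large.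
  by rewrite tree_block_small.
- move=> k x y; have [kx|xk] := leqP k (lev x); last by rewrite tree_block_small// => ->; rewrite tree_block_small.
  move=> /(tree_block_large _ kx)[ky yx].
  by rewrite /tree_block !ltnNge kx ky /= yx.
- move=> k x y; have [kx|xk] := leqP k.+1 (lev x).
    move=> /(tree_block_large _ kx)[ky yx].
    apply/tree_block_large; first exact: ltnW.
    by split; [exact: ltnW|rewrite (ancestorS kx) (ancestorS ky) yx].
  rewrite tree_block_small// => ->.
  have [kx|xk'] := leqP k (lev x); first by apply/tree_block_large.
  by rewrite tree_block_small.
- by move=> x; exists (lev x).+1; rewrite tree_block_small.
Qed.

Lemma dyadicP k B : dyadic e o k B <-> exists x, B = tree_block k x.
Proof.
split=> [[[x /= xk <-]|[x /= xk <-]]|[x ->]].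
- by exists x; rewrite tree_block_small.
- by exists x; rewrite /tree_block xk ltnn /ancestor xk subnn.
have [kx|xk] := leqP k (lev x); last by left; exists x => //=; rewrite tree_block_small.
by right; exists (ancestor k x) => /=; rewrite ?lev_ancestor// /tree_block ltnNge kx.
Qed.

Lemma dyadic_mem k B x : dyadic e o k B -> B x -> B = tree_block k x.
Proof.
by move=> /dyadicP[y ->] yx; rewrite (block_eq tree_block_nested yx).
Qed.

(** If the smaller block occurred at a level up to [k], it would contain the
    larger one. *)
Lemma tree_block_parent k x : tree_block k.+1 x <> tree_block k x ->
  is_parent e o (tree_block k.+1 x) (tree_block k x).
Proof.
move=> ne; have HQ := tree_block_nested.
exists k; split.
- by apply/dyadicP; exists x.
- move=> j jk /dyadic_mem/(_ (block_self HQ _ x)) jE; apply: ne.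
  apply/seteqP; split; first exact: block_sub.
  by rewrite jE; exact: block_sub.
- by apply/dyadicP; exists x.
- exact: block_sub.
Qed.

End TreeBlocks.

(** * Integrals against a measure given by point masses *)
Section PointMasses.
Context {R : realType} {d : measure_display} {X : measurableType d}.
Variable mu : {measure set X -> \bar R}.
Hypothesis Hmu : point_mass_measure mu.
Implicit Types (A D : set X) (f g : X -> R[i]).

Definition pweight (x : X) : R := fine (mu [set x]).
Local Notation w := pweight.
Local Notation wsum := (wsum w).
Local Notation mass := (mass w).
Local Notation wint := (wint w).
Local Notation mean := (mean w).

Lemma all_measurable A : measurable A. Proof. by case: Hmu. Qed.

Lemma all_measurable_fun {d'} {Y : sigmaRingType d'} D (f : X -> Y) :
  measurable_fun D f.
Proof. by move=> _ B _; exact: all_measurable. Qed.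

Lemma pweight_ge0 x : 0 <= w x.
Proof. by rewrite fine_ge0. Qed.
Hint Resolve pweight_ge0 : core.

Lemma pweightE x : mu [set x] = (w x)%:E.
Proof. by rewrite fineK// ge0_fin_numE//; case: Hmu. Qed.

Lemma measure_wsum A : mu A = wsum A (fun=> 1).
Proof.
case: Hmu => _ _ ->; apply: eq_esum => x _.
by rewrite pweightE mul1r.
Qed.

Lemma fine_measure A : fine (mu A) = mass A.
Proof. by rewrite measure_wsum. Qed.

Local Open Scope ereal_scope.
Import HBNNSimple.

Lemma integral_set1_atom x (h : X -> \bar R) : (forall y, 0 <= h y) ->
  \int[mu]_(y in [set x]) h y = h x * mu [set x].
Proof.
move=> h0; rewrite -integral_cst; last exact: all_measurable.
by apply: eq_integral => y; rewrite inE => ->.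
Qed.

(** All sets are measurable and simple functions have finite range, so on simple
    functions the integral is a finite sum of unordered sums; the general case
    follows by taking suprema. *)
Lemma ge0_integral_esum D (h : X -> \bar R) : (forall x, 0 <= h x) ->
  \int[mu]_(x in D) h x = \esum_(x in D) (h x * mu [set x]).
Proof.
move=> h0; apply/eqP; rewrite eq_le; apply/andP; split.
  rewrite ge0_integralE//; apply: ge_ereal_sup => _ [g gh <-].
  rewrite sintegralE [leRHS]esum_mkcond.
  have gr (r : R) : range g r -> (0 <= r)%R by move=> [x _ <-].
  rewrite fsbig_finite//=.
  pose s := finmap.enum_fset (fset_set (range g)).
  have sr r : r \in s -> range g r.
    move=> rs; have : r \in fset_set (range g) := rs.
    by rewrite in_fset_set// inE.
  apply: (@le_trans _ _ (\sum_(r <- s | r \in s) \esum_(x in [set: X])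
      (r%:E * ((\1_(g @^-1` [set r]) x)%:E * mu [set x])))).
    rewrite big_seq; apply: lee_sum => r /sr/gr r0.
    rewrite esum_pZl//.
    rewrite lee_wpmul2l ?lee_fin//; case: Hmu => _ _ ->.
    rewrite esum_mkcond; apply: le_esum => x _; rewrite indicE.
    by case: (x \in _); rewrite ?mul1e// mul0e.
  rewrite -esum_sum; last first.
    by move=> x r _ /sr/gr r0; rewrite !mule_ge0// lee_fin// indicE.
  apply: le_esum => x _.
  have xs : g x \in s.
    have : g x \in fset_set (range g) by rewrite in_fset_set// inE; exists x.
    by [].
  rewrite -big_seq (bigD1_seq (g x))//=; last first.
    exact: finmap.fset_uniq.
  rewrite big1; last first.
    move=> r rx; rewrite indic_out ?mul0e ?mule0//= => gxr.
    by rewrite gxr eqxx in rx.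
  rewrite adde0 indic_in// mul1e.
  have := gh x; rewrite /patch; case: ifP => _ ghx; first by rewrite lee_wpmul2r.
  by rewrite -(mul0e (mu [set x])) lee_wpmul2r.
apply: ge_ereal_sup => _ [F [finF FD] <-].
apply: (@le_trans _ _ (\int[mu]_(x in F) h x)); last first.
  apply: ge0_subset_integral => //; try exact: all_measurable.
  exact: all_measurable_fun.
set s := finmap.enum_fset (fset_set F).
have FE : F = \big[setU/set0]_(i <- s) [set i].
  by rewrite /s bigsetU_fset_set// bigcup_imset1 image_id.
rewrite [X in _ <= integral _ X _]FE ge0_integral_bigsetU//.
- rewrite fsbig_finite//=; apply: lee_sum => x _.
  by rewrite integral_set1_atom.
- by move=> x; exact: all_measurable.
- exact: finmap.fset_uniq.
- by move=> x y _ _ [z [-> ->]].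
- exact: all_measurable_fun.
Qed.

Local Close Scope ereal_scope.

Lemma esum_pweight A (r : X -> R) :
  (\esum_(x in A) ((r x)%:E * mu [set x]) = wsum A r)%E.
Proof. by apply: eq_esum => x _; rewrite pweightE. Qed.

Lemma integral_wsum A (r : X -> R) : (forall x, 0 <= r x) ->
  (\int[mu]_(x in A) (r x)%:E = wsum A r)%E.
Proof. by move=> r0; rewrite ge0_integral_esum ?esum_pweight. Qed.

Lemma ae_atoms (P : X -> Prop) : (forall x, 0 < w x -> P x) -> {ae mu, forall x, P x}.
Proof.
move=> wP; exists [set x | w x = 0]; split; first exact: all_measurable.
  by rewrite measure_wsum /wsum esum1// => x /= ->; rewrite mulr0.
move=> x /= nP; apply: contrapT => /eqP wx.
by apply: nP; apply: wP; rewrite lt_neqAle eq_sym pweight_ge0 andbT.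
Qed.

Lemma atoms_ae (P : X -> Prop) x : {ae mu, forall x, P x} -> 0 < w x -> P x.
Proof.
move=> [N [mN N0 sN]] wx; apply: contrapT => nP.
have : (mu [set x] <= mu N)%E.
  by apply: le_measure; rewrite ?inE//; [exact: all_measurable|move=> _ ->; exact: sN].
by rewrite N0 pweightE lee_fin leNgt wx.
Qed.

Lemma cLnorm1 f : cLnorm mu 1%:E f = wsum [set: X] (fun x => cabs (f x)).
Proof.
rewrite /cLnorm Lnorm1 -integral_wsum//.
by apply: eq_integral => x _; rewrite abse_EFin ger0_norm.
Qed.

Lemma cLnorm2 f :
  cLnorm mu 2%:E f = (wsum [set: X] (fun x => (cabs (f x) ^+ 2)%R) `^ (2^-1)%R)%E.
Proof.
rewrite /cLnorm Lnorm.unlock; congr (_ `^ _)%E; rewrite -integral_wsum//.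
by apply: eq_integral => x _; rewrite abse_EFin ger0_norm// poweR_EFin powR_mulrn.
Qed.

Lemma Lnormoo_le (h : X -> \bar R) (c : R) : 0 <= c ->
  (forall x, 0 < w x -> (`|h x| <= c%:E)%E) -> (Lnorm mu +oo h <= c%:E)%E.
Proof.
move=> c0 hc; rewrite Lnorm.unlock; case: ifP => _; last by rewrite lee_fin.
apply: ereal_inf_lbound; exact: ae_atoms.
Qed.

Lemma Lnormoo_lt (h : X -> \bar R) (M : R) x : (Lnorm mu +oo h < M%:E)%E ->
  0 < w x -> (`|h x| <= M%:E)%E.
Proof.
rewrite Lnorm.unlock => + wx.
have -> : (0 < mu [set: X])%E.
  apply: (@lt_le_trans _ _ (mu [set x])); first by rewrite pweightE lte_fin.
  by apply: le_measure; rewrite ?inE//; exact: all_measurable.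
move=> /ereal_inf_lt[y /= hy yM].
by have /le_trans := atoms_ae hy wx; apply; exact: ltW.
Qed.

(** Absolute summability matters: otherwise the conventions for infinite
    positive and negative parts differ on the two sides. *)
Lemma cintegral_wint A f : (wsum A (fun x => cabs (f x)) < +oo)%E ->
  cintegral mu A f = wint (fun x => f x * \1_A x).
Proof.
move=> fs; rewrite /cintegral /wint /csum.
have key (part : R[i] -> R) : (forall z, `|part z| <= cabs z) ->
    (forall z (r : R), part (z * r%:C%C) = part z * r) ->
    Rintegral mu A (fun x => part (f x)) =
    rsum (fun x => part (f x * \1_A x * (w x)%:C%C)).
  move=> part_le partM; rewrite /Rintegral integralE.
  have pE (s : R -> R) : (forall r, 0 <= s r) -> (forall r, s r <= `|r|) ->
     (forall r a, 0 <= a -> s (r * a) = s r * a) ->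
     ((\int[mu]_(x in A) (s (part (f x)))%:E) =
      \esum_(x in [set: X]) (s (part (f x * \1_A x * (w x)%:C%C)))%:E)%E /\
     (\int[mu]_(x in A) (s (part (f x)))%:E)%E \is a fin_num.
    move=> s0 sle sM; rewrite integral_wsum//; split; last first.
      rewrite ge0_fin_numE; last exact: wsum_ge0.
      apply: le_lt_trans fs; apply: wsum_le => // x _ _.
      exact: le_trans (sle _) (part_le _).
    rewrite wsum_mkcond; apply: eq_esum => x _; congr EFin.
    have -> : \1_A x = (\1_A x)%:C%C :> R[i] by rewrite !indicE; case: (x \in A).
    by rewrite !partM !sM// indicE.
  have [pos1 pos2] := pE (fun r => Num.max r 0)
    (fun r => ltac:(by rewrite le_max lexx orbT))
    (fun r => ltac:(by rewrite ge_max normr_ge0 andbT ler_norm))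
    (fun r a a0 => ltac:(by rewrite maxr_pMl// mul0r)).
  have [neg1 neg2] := pE (fun r => Num.max (- r) 0)
    (fun r => ltac:(by rewrite le_max lexx orbT))
    (fun r => ltac:(by rewrite ge_max normr_ge0 andbT -normrN ler_norm))
    (fun r a a0 => ltac:(by rewrite maxr_pMl// mul0r mulNr)).
  have -> : (\int[mu]_(x in A) ((fun x => (part (f x))%:E)^\+ x) =
      \int[mu]_(x in A) (Num.max (part (f x)) 0)%:E)%E.
    by apply: eq_integral => x _; rewrite funeposE EFin_max.
  have -> : (\int[mu]_(x in A) ((fun x => (part (f x))%:E)^\- x) =
      \int[mu]_(x in A) (Num.max (- part (f x)) 0)%:E)%E.
    by apply: eq_integral => x _; rewrite funenegE EFin_max EFinN.
  by rewrite fineB// pos1 neg1.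
congr (_ +i* _)%C; apply: key.
- exact: Re_le_cabs.
- by case=> a b r /=; rewrite mulr0 subr0.
- exact: Im_le_cabs.
- by case=> a b r /=; rewrite mulr0 add0r.
Qed.

Lemma avg_mean A f : ((wsum A (fun=> 1%R) < +oo)%E ->
    (wsum A (fun x => cabs (f x)) < +oo)%E) -> avg mu f A = mean A f.
Proof.
move=> fs; rewrite /avg fine_measure.
have [/fs fA|/mass_infty m0] := mass_dichotomy w A.
  by rewrite cintegral_wint// mulrC.
by rewrite /mean m0 invr0 mulr0 mul0r.
Qed.

End PointMasses.

(** * The endpoint bounds *)

Section Translation.
Context {R : realType} {d : measure_display} {X : measurableType d}.
Variables (mu : {measure set X -> \bar R}) (e : rel X) (o : X) (K : X -> X -> R[i]).
Hypothesis Htree : is_tree e.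
Hypothesis Hmu : point_mass_measure mu.
Implicit Types (A : set X) (f g : X -> R[i]).
Local Notation w := (pweight mu).
Local Notation Q := (tree_block e o).
Local Notation wsum := (wsum w).
Local Notation mass := (mass w).
Local Notation mean := (mean w).
Let w_ge0 : forall x, 0 <= w x := pweight_ge0 mu.
Let HQ : nested_partitions Q := tree_block_nested o Htree.

Lemma opT_kop f : opT mu K f = kop w K f.
Proof. by []. Qed.

Lemma lt_pinfty_bound (S : set (\bar R)) : (ereal_sup S < +oo)%E ->
  exists2 c : R, 0 <= c & forall s, S s -> (s <= c%:E)%E.
Proof.
move=> Soo; exists (Num.max (fine (ereal_sup S)) 0); first by rewrite le_max lexx orbT.
move=> s /ereal_sup_ubound sS; apply: (le_trans sS).
by case: (ereal_sup S) Soo => [r _|//|_]; rewrite ?leNye// lee_fin le_max lexx.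
Qed.

Lemma sqrt_poweR_le (a b c : R) (s : \bar R) : 0 <= a -> (0 <= s)%E -> 0 <= b ->
  (s `^ (2^-1)%R <= a%:E * (b%:E `^ (2^-1)%R))%E -> (s <= (a ^+ 2 * b)%:E)%E.
Proof.
move=> a0 + b0; case: s => [s||//]; last first.
  by rewrite poweRyr ?invr_eq0// poweR_EFin -EFinM leye_eq.
rewrite lee_fin => s0; rewrite !poweR_EFin -EFinM !lee_fin => H.
rewrite -[s]sqr_sqrtr// -[b in leRHS]sqr_sqrtr// -exprMn.
by rewrite lerXn2r ?nnegrE ?mulr_ge0 ?sqrtr_ge0// -!powR12_sqrt.
Qed.

(** The size condition quantifies over genuine children; when two consecutive
    blocks of a point coincide, the corresponding sum is empty. *)
Lemma tree_CZ_kernel :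
  opT_bounded mu K (in_Lp mu 2%:E) (cLnorm mu 2%:E) (cLnorm mu 2%:E) ->
  (forall x y, K x y = K y x) -> size_condition mu e o K ->
  Hormander_condition mu e o K ->
  exists C, dyadic_CZ_kernel w Q K C.
Proof.
move=> [C2 HL2] Hsym /lt_pinfty_bound[c1 c10 size] /lt_pinfty_bound[c2 c20 hor].
exists (1 + c1 + c2 + C2 ^+ 2); have C20 := sqr_ge0 C2.
split=> //.
- by lra.
- move=> k x; apply: (@le_trans _ _ c1%:E); last by rewrite lee_fin; lra.
  have [QE|QE] := pselect (Q k.+1 x = Q k x).
    by rewrite QE setDv /wsum esum_set0 lee_fin.
  apply: size; exists (Q k.+1 x), (Q k x), x; split.
  + exact: tree_block_parent.
  + exact: block_self.
  + by rewrite esum_pweight.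
- move=> k x y xy; apply: (@le_trans _ _ c2%:E); last by rewrite lee_fin; lra.
  apply: hor; exists (Q k x), x, y; split => //.
  + by exists k => //; apply/dyadicP => //; exists x.
  + exact: block_self.
  + by rewrite esum_pweight.
- move=> f c fc.
  pose s (g : X -> R[i]) := wsum [set: X] (fun x => (cabs (g x) ^+ 2)%R).
  have s0 g : (0 <= s g)%E by apply: wsum_ge0.
  have sf : s f = (fine (s f))%:E.
    by rewrite fineK// ge0_fin_numE// (le_lt_trans fc)// ltry.
  have f2 : in_Lp mu 2%:E f.
    by rewrite /in_Lp cLnorm2// -/(s f) sf poweR_EFin ltry.
  have [_] := HL2 f f2; rewrite !cLnorm2// -/(s f) -/(s (opT mu K f)) sf => H.
  have b0 : 0 <= fine (s f) by rewrite fine_ge0.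
  have H' : (s (opT mu K f) <= (`|C2| ^+ 2 * fine (s f))%:E)%E.
    apply: sqrt_poweR_le => //; apply: (le_trans H).
    by rewrite lee_wpmul2r ?poweR_ge0// lee_fin ler_norm.
  apply: (le_trans H'); rewrite lee_fin real_normK ?num_real//.
  have c0 : fine (s f) <= c by rewrite -lee_fin -sf.
  rewrite ler_pM//; lra.
Qed.

(** Only one block of each level contains a given point, so the sum over the
    partition has a single nonzero term. *)
Lemma condE_mean k f x : condE mu e o k f x = avg mu f (Q k x).
Proof.
rewrite /condE -(@fsbig_widen _ _ _ _ [set Q k x]).
- by rewrite fsbig_set1 indic_in ?mulr1//; exact: block_self.
- by move=> _ ->; apply/dyadicP => //; exists x.
- move=> B [/= dB nB]; rewrite indic_out ?mulr0// => Bx; apply: nB.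
  exact: (dyadic_mem Htree dB Bx).
Qed.

Lemma econdE_mean k (h : X -> \bar R) x : econdE mu e o k h x = eavg mu h (Q k x).
Proof.
rewrite /econdE -(@fsbig_widen _ _ _ _ [set Q k x]).
- by rewrite fsbig_set1 indic_in ?mule1//; exact: block_self.
- by move=> _ ->; apply/dyadicP => //; exists x.
- move=> B [/= dB nB]; rewrite indic_out ?mule0// => Bx; apply: nB.
  exact: (dyadic_mem Htree dB Bx).
Qed.

Variable C : R.
Hypothesis HK : dyadic_CZ_kernel w Q K C.
Let C0 : 0 < C := kernel_C0 HK.
Let C_ge0 : 0 <= C := kernel_C_ge0 HK.

Lemma opT_defined_on f :
  (forall x, 0 < w x -> wsble w (fun y => K x y * f y)) -> opT_defined mu K f.
Proof.
move=> fs; apply: (ae_atoms Hmu) => x wx; rewrite /summable.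
apply: le_lt_trans (fs x wx); apply: le_esum => y _.
by rewrite /opT_term lee_fin ger0_norm// cabsM cabs_ge0_real.
Qed.

Lemma in_L1_wsble f : in_Lp mu 1%:E f -> wsble w f.
Proof. by rewrite /in_Lp cLnorm1. Qed.

Lemma in_L1_defined f : in_Lp mu 1%:E f -> opT_defined mu K f.
Proof.
move=> /in_L1_wsble fs; apply: opT_defined_on => x wx.
exact: (kernel_mul_sble w_ge0 HQ HK).
Qed.

Lemma opT_weak11 :
  opT_bounded mu K (in_Lp mu 1%:E) (cLnorm mu 1%:E) (weakL1_norm mu).
Proof.
exists (31 * C) => f f1; split; first exact: in_L1_defined.
have fs := in_L1_wsble f1; rewrite cLnorm1// opT_kop.
set s := wsum _ _.
have sE : s = (fine s)%:E by rewrite fineK// ge0_fin_numE// wsum_ge0.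
apply: ge_ereal_sup => _ [l l_gt0 <-]; have l0 : 0 < l by exact: l_gt0.
rewrite measure_wsum// sE -EFinM.
have fN : (s <= (fine s)%:E)%E by rewrite -sE.
apply: (@le_trans _ _ (l%:E * (31 * C * fine s / l)%:E)%E).
  rewrite lee_wpmul2l ?lee_fin//; first exact: ltW.
  exact: (kop_weak11 w_ge0 HQ HK fN l0).
by rewrite -EFinM lee_fin mulrC divfK// gt_eqF.
Qed.

Lemma opT_H1 :
  opT_bounded mu K (in_H1 mu e o) (H1_norm mu e o) (cLnorm mu 1%:E).
Proof.
exists (1 + 10 * C ^+ 2) => f [f1 f0 fH]; split; first exact: in_L1_defined.
have fs := in_L1_wsble f1.
have cexpE k x : condE mu e o k f x = cexp w Q k f x.
  rewrite condE_mean avg_mean// => _; apply: le_lt_trans fs.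
  by apply: wsum_sub.
have w0 : wint w f = 0.
  move: f0; rewrite cintegral_wint//.
  suff -> : (fun x => f x * \1_[set: X] x) = f by [].
  by apply/funext => x; rewrite indic_in// mulr1.
have H0 : (0 <= H1_norm mu e o f)%E by exact: Lnorm_ge0.
have HE : H1_norm mu e o f = (fine (H1_norm mu e o f))%:E.
  by rewrite fineK// ge0_fin_numE.
rewrite cLnorm1// HE -EFinM; apply: (kop_H1 w_ge0 HQ HK fs w0) => n.
rewrite -HE /H1_norm Lnorm1 -(esum_pweight Hmu) -ge0_integral_esum//; last first.
  by move=> x; rewrite lee_fin; exact: square_fun_ge0.
apply: ge0_le_integral => //; try exact: (all_measurable_fun Hmu).
- by move=> x _; rewrite lee_fin; exact: square_fun_ge0.
move=> x _; rewrite gee0_abs ?poweR_ge0//.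
have t0 m : (0 <= (cabs (mdiff mu e o m f x) ^+ 2)%:E)%E by rewrite lee_fin.
have sum0 : 0 <= \sum_(0 <= k < n) cabs (mart_diff w Q k f x) ^+ 2.
  by apply: sumr_ge0.
have le_series : ((\sum_(0 <= k < n) cabs (mart_diff w Q k f x) ^+ 2)%:E <=
    \sum_(1 <= k <oo) (cabs (mdiff mu e o k f x) ^+ 2)%:E)%E.
  apply: le_trans (nneseries_lim_ge n.+1 (fun m _ _ => t0 m)).
  rewrite big_add1/= sumEFin lee_fin le_eqVlt; apply/orP; left; apply/eqP.
  by apply: eq_bigr => k _; rewrite /mdiff /mart_diff !cexpE.
rewrite /square_fun -powR12_sqrt// -poweR_EFin.
apply: gt0_ler_poweR => //; rewrite !in_itv/= ?leey ?andbT ?lee_fin//.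
exact: le_trans le_series.
Qed.

Lemma in_Loo_bounded f M : (cLnorm mu +oo f < M%:E)%E ->
  forall x, 0 < w x -> cabs (f x) <= M.
Proof.
move=> fM x wx; have := Lnormoo_lt Hmu fM wx.
by rewrite abse_EFin lee_fin ger0_norm.
Qed.

(** Stated for every strict bound [M] of the essential supremum of [f], which
    avoids the degenerate case [M = 0]. *)
Lemma opT_BMO_bound f M : 0 < M -> (forall y, 0 < w y -> cabs (f y) <= M) ->
  (BMO_norm mu e o (opT mu K f) <= (6 * C * M)%:E)%E.
Proof.
move=> M0 fM; rewrite opT_kop.
have CM0 : 0 < C * M by rewrite mulr_gt0.
have avgE k y : condE mu e o k (kop w K f) y = mean (Q k y) (kop w K f).
  rewrite condE_mean avg_mean// => fQ.
  exact: (kop_block_summable w_ge0 HQ HK M0 fM fQ).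
rewrite (_ : 6 * C * M = C * M + 5 * C * M); last by ring.
rewrite EFinD leeD//.
  apply: Lnormoo_le => //; first exact: ltW.
  move=> x _; rewrite abse_EFin lee_fin ger0_norm// avgE.
  exact: (kop_mean0 w_ge0 HQ HK x M0 fM).
have M5 : 0 < 5 * C * M by rewrite -mulrA mulr_gt0.
apply: ge_ereal_sup => _ [[//|k] _ <-].
apply: Lnormoo_le => //; first exact: ltW.
move=> x wx; rewrite econdE_mean /eavg fine_measure// integral_wsum//=.
have [fQ|Qoo] := mass_dichotomy w (Q k.+1 x); last first.
  by rewrite (mass_infty Qoo) invr0 mule0 abse0 lee_fin ltW.
have m0 := mass_gt0 w_ge0 fQ (block_self HQ k.+1 x) wx.
have bound : (wsum (Q k.+1 x)
    (fun y => cabs (kop w K f y - condE mu e o k (kop w K f) y)%R) <=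
    (5 * C * M * mass (Q k.+1 x))%:E)%E.
  apply: wsum_cauchy_schwarz => //; first by rewrite massE.
  rewrite (@eq_wsum _ _ _ w_ge0 _ _
    (fun y => cabs (kop w K f y - mean (Q k y) (kop w K f)) ^+ 2)); last first.
    by move=> y _ _; rewrite avgE.
  apply: (le_trans (kop_BMO2 w_ge0 HQ HK M0 fM fQ)).
  rewrite lee_fin (_ : (5 * C * M) ^+ 2 = 25 * (C ^+ 2 * M ^+ 2)); last by ring.
  have t0 : 0 <= C ^+ 2 * M ^+ 2 by rewrite mulr_ge0// sqr_ge0.
  apply: ler_wpM2r; first exact: mass_ge0.
  by rewrite -mulrA; lra.
have mV : 0 <= (mass (Q k.+1 x))^-1 by rewrite invr_ge0 ltW.
rewrite gee0_abs; last by rewrite mule_ge0// ?wsum_ge0// lee_fin.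
rewrite muleC (le_trans (lee_wpmul2l _ bound))// ?lee_fin//.
by rewrite mulrC mulfK// gt_eqF.
Qed.

Lemma opT_BMO :
  opT_bounded mu K (in_Lp mu +oo%E) (cLnorm mu +oo%E) (BMO_norm mu e o).
Proof.
exists (6 * C) => f foo.
have L0 : (0 <= cLnorm mu +oo f)%E by exact: Lnorm_ge0.
pose L := fine (cLnorm mu +oo f).
have LE : cLnorm mu +oo f = L%:E by rewrite fineK// ge0_fin_numE.
have L_ge0 : 0 <= L by rewrite -lee_fin -LE.
have fM M : L < M -> forall y, 0 < w y -> cabs (f y) <= M.
  by move=> LM; apply: in_Loo_bounded; rewrite LE lte_fin.
split.
  apply: opT_defined_on => x _.
  by apply: (kernel_mul_bounded_sble w_ge0 HQ HK); apply: (fM (L + 1)); rewrite ltrDl.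
rewrite LE -EFinM; apply/lee_addgt0Pr => eps eps0.
have C6 : 0 < 6 * C by rewrite mulr_gt0.
pose M := L + eps / (6 * C).
have LM : L < M by rewrite ltrDl divr_gt0.
rewrite -EFinD (_ : 6 * C * L + eps = 6 * C * M); last first.
  by rewrite /M mulrDr mulrCA mulfV ?mulr1// gt_eqF.
by apply: opT_BMO_bound; [exact: le_lt_trans LM|exact: fM].
Qed.

End Translation.

Unset Implicit Arguments.

Theorem theorem3 (R : realType) (d : measure_display) (X : measurableType d)
    (mu : {measure set X -> \bar R}) (e : rel X) (o : X) (K : X -> X -> R[i])
    (Htree : is_tree e)
    (Hmu : point_mass_measure mu)
    (HL2 : opT_bounded mu K (in_Lp mu 2%:E) (cLnorm mu 2%:E) (cLnorm mu 2%:E))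
    (Hsym : forall x y : X, K x y = K y x)
    (Hsize : size_condition mu e o K)
    (Hhorm : Hormander_condition mu e o K) :
  [/\ opT_bounded mu K (in_Lp mu 1%:E) (cLnorm mu 1%:E) (weakL1_norm mu),
      opT_bounded mu K (in_H1 mu e o) (H1_norm mu e o) (cLnorm mu 1%:E)
    & opT_bounded mu K (in_Lp mu +oo%E) (cLnorm mu +oo%E) (BMO_norm mu e o)].
Proof.
have [C HK] := tree_CZ_kernel Htree Hmu HL2 Hsym Hsize Hhorm.
by split; [exact: opT_weak11 HK|exact: opT_H1 HK|exact: opT_BMO HK].
Qed.
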